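(* Let $\mathcal{G}$ be the infinite two-dimensional hexagonal grid (honeycomb) with edges of length $l>0$. For every $p\in[4,6]$ there exists a critical mass $\mu_p>0$ such that: (i) if $p\in(4,6)$, then ground states of mass $\mu$ exist if and only if $\mu\geq\mu_p$, and $$\mathcal{E}(\mu)\begin{cases}=0 & \text{if }\mu\leq\mu_p,\\ <0 & \text{if }\mu>\mu_p;\end{cases}$$ (ii) if $p=4$, then ground states of mass $\mu$ exist if $\mu>\mu_4$ and they do not exist if $\mu<\mu_4$; furthermore, $\mathcal{E}(\mu)=0$ if $\mu\leq\mu_4$ and $\mathcal{E}(\mu)<0$ if $\mu>\mu_4$; (iii) if $p=6$, then ground states never exist, independently of the value of $\mu>0$, and $$\mathcal{E}(\mu)=\begin{cases}0 & \text{if }\mu\leq\mu_6,\\ -\infty & \text{if }\mu>\mu_6.\end{cases}$$ Here $\mu$ ranges over $(0,\infty)$, and the energy $E(\cdot,\mathcal{G})$, the infimum $\mathcal{E}$ and the notion of ground state are those with the exponent $p$ under consideration.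
   Context: The honeycomb $\mathcal{G}$ is the metric graph given by the vertices and edges of the tiling of the plane $\mathbb{R}^2$ by identical regular hexagons of side length $l>0$. Equivalently: its vertices are $a_{m,n}, b_{m,n}$ with $(m,n)\in\mathbb{Z}^2$, and each $a_{m,n}$ is joined by exactly one edge to each of $b_{m,n}$, $b_{m-1,n}$, $b_{m,n-1}$ (and there are no other edges). Every edge is identified with the interval $[0,l]$ through an arclength coordinate. A (complex-valued) function $u$ on $\mathcal{G}$ is a family of functions $u_e:[0,l]\to\mathbb{C}$, one for each edge $e$; integrals and norms on $\mathcal{G}$ are obtained by summing over edges, e.g. $\int_{\mathcal{G}}|u|^q\,dx=\sum_e\int_0^l|u_e|^q\,dx$ and $\|u\|_{L^q(\mathcal{G})}=(\int_{\mathcal{G}}|u|^q\,dx)^{1/q}$; $u'$ is the edgewise weak derivative. $H^1(\mathcal{G})$ is the space of functions $u$ that are continuous on $\mathcal{G}$ (in particular at vertices) with $u,u'\in L^2(\mathcal{G})$. For $\mu>0$, $H^1_\mu(\mathcal{G}):=\{u\in H^1(\mathcal{G}) : \|u\|_{L^2(\mathcal{G})}^2=\mu\}$. The NLS energy is $$E(u,\mathcal{G})=\frac12\int_{\mathcal{G}}|u'|^2\,dx-\frac1p\int_{\mathcal{G}}|u|^p\,dx,$$ and $\mathcal{E}(\mu):=\inf_{u\in H^1_\mu(\mathcal{G})}E(u,\mathcal{G})\in[-\infty,\infty)$. A ground state of mass $\mu$ is a minimizer of $E(\cdot,\mathcal{G})$ over $H^1_\mu(\mathcal{G})$, i.e.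 a function $u\in H^1_\mu(\mathcal{G})$ with $E(u,\mathcal{G})=\mathcal{E}(\mu)$. *)

(* Defs.v *)
From mathcomp Require Import all_boot all_order all_algebra.
From mathcomp Require Import complex.
From mathcomp Require Import all_classical all_reals all_analysis.
Set Implicit Arguments.
Unset Strict Implicit.
Unset Printing Implicit Defensive.
Import Order.TTheory GRing.Theory Num.Theory.
Import numFieldNormedType.Exports.
Local Open Scope classical_set_scope.
Local Open Scope ring_scope.

(* The honeycomb: inl (m, n) is a_{m,n} and inr (m, n) is b_{m,n}.
   The edge ((m, n), k) runs from a_{m,n}, at arclength coordinate 0, to
   b_{m,n}, b_{m-1,n} or b_{m,n-1} (k = 0, 1 or 2), at coordinate l. *)
Notation hvertex := ((int * int) + (int * int))%type.
Notation hedge := ((int * int) * 'I_3)%type.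

Definition htail (e : hedge) : hvertex := inl e.1.

Definition hhead (e : hedge) : hvertex :=
  let: ((m, n), k) := e in
  inr (match val k with
       | 0%N => (m, n)
       | 1%N => (m - 1, n)
       | _ => (m, n - 1)
       end).

(* Only the values u e x with 0 <= x <= l are meaningful. *)
Definition gfun (R : realType) : Type := hedge -> R -> R[i].

(* C^1 with compact support in ]0, l[: a closed set contained in the bounded
   interval ]0, l[ is compact. *)
Definition test_function (R : realType) (l : R) (phi : R -> R) : Prop :=
  [/\ forall x, derivable phi x 1, continuous (derive1 phi) &
      closure [set x | phi x != 0] `<=` `]0, l[%classic].

(* Weak derivative on ]0, l[, first for real-valued functions; testing against
   C^1_c or C^oo_c functions gives the same notion, and real test functions
   suffice for complex-valued functions, which are treated componentwise. *)
Definition is_weak_deriv_real (R : realType) (l : R) (f g : R -> R) : Prop :=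
  [/\ locally_integrable `]0, l[%classic f,
      locally_integrable `]0, l[%classic g &
      forall phi : R -> R, test_function l phi ->
        \int[lebesgue_measure]_(x in `]0, l[) (f x * derive1 phi x)
        = - \int[lebesgue_measure]_(x in `]0, l[) (g x * phi x)].

Definition is_weak_deriv (R : realType) (l : R) (f g : R -> R[i]) : Prop :=
  is_weak_deriv_real l (fun x => complex.Re (f x)) (fun x => complex.Re (g x))
  /\
  is_weak_deriv_real l (fun x => complex.Im (f x)) (fun x => complex.Im (g x)).

(* Weak derivatives are unique almost everywhere, so the choice made here does
   not affect any integral below. *)
Definition gderiv (R : realType) (l : R) (u : gfun R) : gfun R :=
  fun e => xget (fun=> 0) [set g | is_weak_deriv l (u e) g].

(* \int_G |u|^q dx *)
Definition gintegral (R : realType) (l q : R) (u : gfun R) : \bar R :=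
  (\esum_(e in [set: hedge])
     \int[lebesgue_measure]_(x in `[0%R, l])
       ((ComplexField.Normc.normc (u e x)) `^ q)%:E)%E.

Definition edge_continuous (R : realType) (l : R) (f : R -> R[i]) : Prop :=
  {within `[0, l], continuous (fun x => complex.Re (f x))} /\
  {within `[0, l], continuous (fun x => complex.Im (f x))}.

Definition gcontinuous (R : realType) (l : R) (u : gfun R) : Prop :=
  (forall e, edge_continuous l (u e)) /\
  exists v : hvertex -> R[i],
    forall e, u e 0 = v (htail e) /\ u e l = v (hhead e).

(* Measurability of u and of its derivative is part of gcontinuous and
   is_weak_deriv. *)
Definition H1 (R : realType) (l : R) : set (gfun R) :=
  [set u | [/\ gcontinuous l u,
               forall e, exists g, is_weak_deriv l (u e) g,
               (gintegral l 2 u < +oo)%E &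
               (gintegral l 2 (gderiv l u) < +oo)%E]].

Definition H1_mass (R : realType) (l mu : R) : set (gfun R) :=
  [set u | H1 l u /\ gintegral l 2 u = mu%:E].

(* On H1 both integrals are finite when 2 <= p. *)
Definition energy (R : realType) (l p : R) (u : gfun R) : \bar R :=
  ((2^-1)%:E * gintegral l 2 (gderiv l u) - (p^-1)%:E * gintegral l p u)%E.

Definition energy_level (R : realType) (l p mu : R) : \bar R :=
  ereal_inf [set energy l p u | u in H1_mass l mu].

Definition ground_state (R : realType) (l p mu : R) (u : gfun R) : Prop :=
  H1_mass l mu u /\ energy l p u = energy_level l p mu.

(* Main.v *)
Require Import Defs.
From mathcomp Require Import all_boot all_order all_algebra.
From mathcomp Require Import complex ring lra zify.
From mathcomp Require Import all_classical all_reals all_analysis measurable_realfun.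
Set Implicit Arguments.
Unset Strict Implicit.
Unset Printing Implicit Defensive.
Import Order.TTheory GRing.Theory Num.Theory.
Import numFieldNormedType.Exports.
Local Open Scope classical_set_scope.
Local Open Scope ring_scope.

(* Replacing [u] by [|u|], it suffices to consider nonnegative functions.

   Every vertex lies on two lines of the honeycomb running to infinity, and the square of the
   function is bounded by its variation along either of them; multiplying the two bounds gives the
   two-dimensional Gagliardo-Nirenberg inequality.  Together with the one-dimensional one it shows
   that the energy is nonnegative for small masses when 4 <= p <= 6, while slowly decaying profiles
   show that the level is never positive.  Multiplying a function by a constant larger than 1 makes
   a nonpositive energy negative, so the masses at which the energy is nonnegative form an interval
   (0, mu_p], on whose interior the energy is positive and the level 0 is not attained.

   For p < 6 the energy is coercive.  A minimizing sequence that does not vanish uniformly is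
   translated and converges locally; cutting the functions off at large distance, the part that
   escapes costs at least its share of the level, so the limit carries the whole mass up to scaling
   and is a ground state.  Above mu_p vanishing is excluded by the negative level, and at mu_p, for
   p > 4, by the bound of the p-th power integral by the (p-4)-th power of the supremum times the
   Dirichlet integral.

   For p = 6 the critical mass is that of the real line, pi sqrt 3 / 2.  If M is the maximum of f
   and F(t)^2 = (M^4 t^2 - t^6) / 3, then E(f) + M^4 mass(f) / 6 is half the integral of
   f'^2 + F(f)^2, hence at least the integral of F(f) |f'|, which is computed along two rays leaving
   the maximum.  A third ray gives strictness: in case of equality f vanishes at a vertex of the
   edge carrying the maximum and |f'| = F(f) <= M^2 f there, so f vanishes on that edge.  Above the
   critical mass, solitons concentrated inside one edge have energy tending to -oo. *)

(** * Integrals over an edge *)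

(** Neither |u| nor a local limit comes with a derivative. Both receive one from the criterion of F.
    Riesz: if the interpolations at the dyadic nodes have Dirichlet integrals at most C, then a
    derivative exists and its square has integral at most C. For |u| this compares the two Dirichlet
    integrals; for a limit, where the interpolations at fixed nodes converge, it is lower
    semicontinuity, so no weak topology enters. The level 0 is also approached by spreading, so at
    mu_p a suitable minimizing sequence has to be built: functions of negative energy with masses
    slightly above mu_p are scaled down to mu_p, and their Dirichlet integral stays controlled by
    the potential term. The factor given by the (p-4)-th power of the supremum then keeps the
    supremum away from 0. At p = 4 this factor is constant and gives nothing, whence the silence
    about ground states of mass mu_4. *)

Section IntervalIntegral.
Variable R : realType.
Local Notation mu := (@lebesgue_measure R).
Implicit Types (a b c d : R) (f g h : R -> R).

Definition cts a b f := {within `[a, b], continuous f}.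
Definition itg a b f := mu.-integrable `[a, b] (EFin \o f).
Definition itl a b f : R := \int[mu]_(x in `[a, b]) f x.

Lemma itv_in a b (x : R) : `[a, b]%classic x = (a <= x <= b) :> Prop.
Proof. by rewrite /= in_itv /=. Qed.

Lemma cts_sub a b c d f : a <= c -> d <= b -> cts a b f -> cts c d f.
Proof.
move=> ac db; apply: continuous_subspaceW => x; rewrite !itv_in => /andP[cx xd].
by rewrite (le_trans ac cx) (le_trans xd db).
Qed.

Lemma ctsT a b f : continuous f -> cts a b f.
Proof. exact: continuous_subspaceT. Qed.

Lemma cts_comp a b (phi : R -> R) f : continuous phi -> cts a b f ->
  cts a b (fun x => phi (f x)).
Proof. by move=> cp cf; apply: within_continuous_comp cf => x _; exact: cp. Qed.

Lemma ctsD a b f g : cts a b f -> cts a b g -> cts a b (fun x => f x + g x).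
Proof. by move=> cf cg x; apply: continuousD; [exact: cf|exact: cg]. Qed.

Lemma ctsM a b f g : cts a b f -> cts a b g -> cts a b (fun x => f x * g x).
Proof. by move=> cf cg x; apply: continuousM; [exact: cf|exact: cg]. Qed.

Lemma cts_cst a b c : cts a b (fun=> c).
Proof. by apply: ctsT => x; exact: cvg_cst. Qed.

Lemma ctsX a b f n : cts a b f -> cts a b (fun x => f x ^+ n).
Proof. by move=> cf; apply: (@cts_comp a b (fun x => x ^+ n)) => //; exact: exprn_continuous. Qed.

Lemma itg_meas a b f : itg a b f -> measurable_fun `[a, b] f.
Proof. by move=> /measurable_int/measurable_EFinP. Qed.

Lemma itg_sub a b c d f : a <= c -> d <= b -> itg a b f -> itg c d f.
Proof.
move=> ac db; apply: integrableS => //; move=> x; rewrite !itv_in => /andP[cx xd].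
by rewrite (le_trans ac cx) (le_trans xd db).
Qed.

Lemma cts_itg a b f : cts a b f -> itg a b f.
Proof. by move=> cf; apply: continuous_compact_integrable => //; exact: segment_compact. Qed.

Lemma itgD a b f g : itg a b f -> itg a b g -> itg a b (fun x => f x + g x).
Proof. by move=> f1 g1; exact: (integrableD _ f1 g1). Qed.

Lemma itgB a b f g : itg a b f -> itg a b g -> itg a b (fun x => f x - g x).
Proof. by move=> f1 g1; exact: (integrableB _ f1 g1). Qed.

Lemma itgZ a b c f : itg a b f -> itg a b (fun x => c * f x).
Proof. by move=> f1; exact: (integrableZl _ c f1). Qed.

Lemma itg_norm a b f : itg a b f -> itg a b (fun x => `|f x|).
Proof. by move=> /integrable_norm. Qed.

Lemma le_itg a b f g : measurable_fun `[a, b] f ->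
  (forall x, a <= x <= b -> `|f x| <= g x) -> itg a b g -> itg a b f.
Proof.
move=> mf fg; apply: le_integrable => //; first exact/measurable_EFinP.
by move=> x; rewrite itv_in => /fg fgx; rewrite /= lee_fin (le_trans fgx)// ler_norm.
Qed.

Lemma cts_bounded a b f : cts a b f -> exists2 M, 0 <= M & forall x, a <= x <= b -> `|f x| <= M.
Proof.
move=> cf; have [ab|ba] := leP a b; last first.
  by exists 0 => // x /andP[ax xb]; move: (le_trans ax xb); rewrite leNgt ba.
have cn : cts a b (fun x => `|f x|) by apply: cts_comp cf; exact: norm_continuous.
have [c _ hc] := EVT_max ab cn; by exists `|f c|.
Qed.

Lemma itgM a b f g : cts a b f -> itg a b g -> itg a b (fun x => f x * g x).
Proof.
move=> cf ig; have [M M0 hM] := cts_bounded cf.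
apply: (@le_itg _ _ _ (fun x => M * `|g x|)).
- by apply: measurable_funM; apply: itg_meas => //; exact: cts_itg.
- by move=> x hx; rewrite normrM ler_wpM2r// hM.
- by apply: itgZ; exact: itg_norm.
Qed.

Lemma itlD a b f g : itg a b f -> itg a b g ->
  itl a b (fun x => f x + g x) = itl a b f + itl a b g.
Proof. by move=> *; exact: RintegralD. Qed.

Lemma itlB a b f g : itg a b f -> itg a b g ->
  itl a b (fun x => f x - g x) = itl a b f - itl a b g.
Proof. by move=> *; exact: RintegralB. Qed.

Lemma itlZ a b c f : itg a b f -> itl a b (fun x => c * f x) = c * itl a b f.
Proof. by move=> *; exact: RintegralZl. Qed.

Lemma itl_cst a b c : a <= b -> itl a b (fun=> c) = c * (b - a).
Proof.
move=> ab; rewrite /itl Rintegral_cst//= lebesgue_measure_itv /= lte_fin.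
have [//|ba] := ltP a b; have -> : a = b by apply/eqP; rewrite eq_le ab.
by rewrite subrr.
Qed.

Lemma itl_le a b f g : itg a b f -> itg a b g ->
  (forall x, a <= x <= b -> f x <= g x) -> itl a b f <= itl a b g.
Proof. by move=> i1 i2 fg; apply: le_Rintegral => // x; rewrite itv_in; exact: fg. Qed.

Lemma eq_itl a b f g : (forall x, a <= x <= b -> f x = g x) -> itl a b f = itl a b g.
Proof. by move=> fg; apply: eq_Rintegral => x; rewrite inE itv_in; exact: fg. Qed.

Lemma eq_itg a b f g : (forall x, a <= x <= b -> f x = g x) -> itg a b f -> itg a b g.
Proof. by move=> fg; apply: eq_integrable => // x; rewrite inE itv_in => /fg /= ->. Qed.

Lemma itl_ge0 a b f : (forall x, a <= x <= b -> 0 <= f x) -> 0 <= itl a b f.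
Proof. by move=> f0; apply: Rintegral_ge0 => x; rewrite itv_in; exact: f0. Qed.

Lemma itl_norm a b f : itg a b f -> `|itl a b f| <= itl a b (fun x => `|f x|).
Proof. by move=> i1; exact: le_normr_Rintegral. Qed.

Lemma itl_split a b c f : a <= c <= b -> itg a b f ->
  itl a b f = itl a c f + itl c b f.
Proof.
move=> /andP[ac cb] i1; have := @Rintegral_itvB R f (BLeft a) (BRight b) c i1.
rewrite !bnd_simp => /(_ ac cb) /eqP; rewrite subr_eq => /eqP; rewrite /itl => ->; rewrite addrC; congr (_ + _).
rewrite Rintegral_itv_obnd_cbnd//; apply: integrableS i1 => //.
by move=> x /=; rewrite !in_itv /= => /andP[cx ->]; rewrite (le_trans ac (ltW cx)).
Qed.

Lemma itl_id a f : itl a a f = 0.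
Proof. by rewrite /itl set_itv1 Rintegral_set1. Qed.

Lemma itl_mono a b c d f : a <= c -> c <= d -> d <= b -> itg a b f ->
  (forall x, a <= x <= b -> 0 <= f x) -> itl c d f <= itl a b f.
Proof.
move=> ac cd db i1 f0; rewrite (@itl_split a b c)//; last by rewrite ac (le_trans cd).
rewrite (@itl_split c b d) ?cd//; last exact: itg_sub i1.
have := @itl_ge0 a c f; have := @itl_ge0 d b f => h1 h2.
rewrite -[leLHS]add0r lerD ?h2//; last rewrite lerDl h1//.
- by move=> x /andP[x1 x2]; rewrite f0// x1 (le_trans x2)// (le_trans cd).
- by move=> x /andP[x1 x2]; rewrite f0// x2 (le_trans _ x1)// (le_trans ac).
Qed.

Definition L2 a b h := measurable_fun `[a, b] h /\ itg a b (fun x => h x ^+ 2).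

Lemma L2_sub a b c d h : a <= c -> d <= b -> L2 a b h -> L2 c d h.
Proof.
move=> ac db [mh ih]; split; last exact: itg_sub ih.
apply: measurable_funS mh => // x; rewrite !itv_in => /andP[cx xd].
by rewrite (le_trans ac cx) (le_trans xd db).
Qed.

Lemma L2_itg a b h : L2 a b h -> itg a b h.
Proof.
move=> [mh ih]; apply: (@le_itg _ _ _ (fun x => 1 + h x ^+ 2)) => //.
  move=> x _; rewrite -[h x ^+ 2]real_normK ?num_real//; have := normr_ge0 (h x); nra.
by apply: itgD => //; apply: cts_itg; exact: cts_cst.
Qed.

Lemma cts_L2 a b h : cts a b h -> L2 a b h.
Proof.
by move=> ch; split; [apply: itg_meas; exact: cts_itg|apply: cts_itg; exact: ctsX].
Qed.

Lemma L2D a b f g : L2 a b f -> L2 a b g -> L2 a b (fun x => f x + g x).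
Proof.
move=> [mf i1] [mg ig]; have m1 : measurable_fun `[a, b] (fun x => f x + g x).
  by apply: measurable_funD.
split=> //; apply: (@le_itg _ _ _ (fun x => 2 * f x ^+ 2 + 2 * g x ^+ 2)).
- exact: measurable_funX.
- by move=> x _; rewrite ger0_norm ?sqr_ge0//; have := sqr_ge0 (f x - g x); nra.
- by apply: itgD; exact: itgZ.
Qed.

Lemma L2Ml a b f g : cts a b f -> L2 a b g -> L2 a b (fun x => f x * g x).
Proof.
move=> cf [mg ig]; split.
  by apply: measurable_funM => //; apply: itg_meas; exact: cts_itg.
apply: (@eq_itg _ _ (fun x => f x ^+ 2 * g x ^+ 2)) => [x _|]; first by rewrite exprMn.
by apply: itgM => //; exact: ctsX.
Qed.

Lemma L2Z a b c g : L2 a b g -> L2 a b (fun x => c * g x).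
Proof. by apply: L2Ml; exact: cts_cst. Qed.

Lemma L2_norm a b g : L2 a b g -> L2 a b (fun x => `|g x|).
Proof.
move=> [mg ig]; split; first exact: measurableT_comp.
by apply: eq_itg ig => x _; rewrite real_normK// num_real.
Qed.

(** Cauchy-Schwarz against the constant 1: the integral of [(h - t)^2] is nonnegative, and the best
    [t] is the mean of [h]. *)
Lemma itl_CS a b h : a <= b -> L2 a b h ->
  itl a b h ^+ 2 <= (b - a) * itl a b (fun x => h x ^+ 2).
Proof.
move=> ab Lh; have ih := L2_itg Lh; set I := itl a b h.
set J := itl a b (fun x => h x ^+ 2).
have key t : 0 <= J - 2 * t * I + t ^+ 2 * (b - a).
  have -> : J - 2 * t * I + t ^+ 2 * (b - a) = itl a b (fun x => (h x - t) ^+ 2).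
    rewrite (eq_itl (g := fun x => h x ^+ 2 - (2 * t) * h x + t ^+ 2)); last by move=> x _; ring.
    have i2 := Lh.2; have i1 : itg a b (fun x => 2 * t * h x) by exact: itgZ.
    have i0 : itg a b (fun=> t ^+ 2) by apply: cts_itg; exact: cts_cst.
    by rewrite itlD ?itlB ?itl_cst ?itlZ//; exact: itgB.
  by apply: itl_ge0 => x _; exact: sqr_ge0.
have [ba|] := ltP a b; last first.
  move=> ba; have ba' : a = b by apply/eqP; rewrite eq_le ab.
  by subst b; rewrite /I itl_id subrr mul0r expr0n.
have bma : 0 < b - a by rewrite subr_gt0.
have := key (I / (b - a)).
have -> : J - 2 * (I / (b - a)) * I + (I / (b - a)) ^+ 2 * (b - a) = J - I ^+ 2 / (b - a).
  by field; rewrite gt_eqF.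
by rewrite subr_ge0 ler_pdivrMr// mulrC.
Qed.

End IntervalIntegral.

Lemma norm_between (R : realDomainType) (a b c z d : R) :
  a <= z <= b -> `|a - c| < d -> `|b - c| < d -> `|z - c| < d.
Proof. by rewrite !ltr_norml => /andP[? ?] /andP[? ?] /andP[? ?]; apply/andP; split; lra. Qed.

(** * Absolutely continuous functions: product rule and chain inequality *)

Section AbsolutelyContinuous.
Variable R : realType.
Local Notation mu := (@lebesgue_measure R).
Implicit Types (a b c d : R) (f g h : R -> R).

Lemma ucont_cts a b f :
  (forall e, 0 < e -> exists2 d, 0 < d & forall x y, a <= x <= b -> a <= y <= b ->
     `|x - y| < d -> `|f x - f y| < e) -> cts a b f.
Proof.
move=> uf; apply/subspace_continuousP => x; rewrite itv_in => xab.
apply/cvgrPdist_lt => e e0; have [d d0 hd] := uf e e0.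
rewrite !near_withinE; near=> y => yab; apply: hd; [by []|by rewrite -itv_in|].
by near: y; exact: cvgr_dist_lt.
Unshelve. all: by end_near. Qed.

Lemma cts_ucont a b f : cts a b f ->
  forall e, 0 < e -> exists2 d, 0 < d & forall x y, a <= x <= b -> a <= y <= b ->
     `|x - y| < d -> `|f x - f y| < e.
Proof.
move=> /subspace_continuousP cf e e0.
have /compact_near_coveringP cK := @segment_compact R a b.
have [] := @cK R (0^'+) (fun d x => a <= x <= b ->
  forall y, a <= y <= b -> `|x - y| < d -> `|f x - f y| < e); last first.
- move=> d /= d0 H; exists (d / 2); first by rewrite divr_gt0.
  move=> x y xab yab xy; apply: (H (d / 2)) => //=.
  + rewrite sub0r normrN ger0_norm ?divr_ge0 ?ltW//; lra.
  + by rewrite divr_gt0.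
move=> x; rewrite itv_in => xab.
have /cvgrPdist_lt/(_ (e / 2)) : f y @[y --> within `[a, b]%classic (nbhs x)] --> f x.
  by apply: cf; rewrite itv_in.
rewrite divr_gt0// => /(_ isT); rewrite near_withinE => -[d /= d0 H].
exists (ball (x : R) (d / 2), ball (0 : R) (d / 2) `&` [set t : R | 0 < t]) => /=.
  split; first by exists (d / 2) => //=; rewrite divr_gt0.
  exists (d / 2) => /=; first by rewrite divr_gt0.
  by move=> t /= t1 t0.
move=> [y t] /= [y1 [t1 t0]] yab z zab yz.
have hy : `|f x - f y| < e / 2.
  by apply: H; rewrite ?itv_in//=; apply: (lt_le_trans y1); lra.
have hz : `|f x - f z| < e / 2.
  apply: H; rewrite ?itv_in//=.
  move: y1 t1; rewrite /ball /= sub0r normrN (gtr0_norm t0) => y1 t1.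
  rewrite (_ : x - z = (x - y) + (y - z)); last by ring.
  by apply: (le_lt_trans (ler_normD _ _)); lra.
rewrite (_ : f y - f z = (f x - f z) - (f x - f y)); last by ring.
by apply: (le_lt_trans (ler_normB _ _)); lra.
Qed.

(** Summing over a fine uniform partition gives [G b - G a <= e * (N b - N a)] for every [e]. This
    replaces almost everywhere differentiation in the calculus rules below. *)
Lemma local_to_global a b (G N : R -> R) : a <= b ->
  (forall e, 0 < e -> exists2 d, 0 < d & forall x y, a <= x -> x <= y -> y <= b ->
     y - x < d -> G y - G x <= e * (N y - N x)) -> G b <= G a.
Proof.
move=> ab H; have key e : 0 < e -> G b - G a <= e * (N b - N a).
  move=> /H [d d0 hd].
  have [n hn] : exists n : nat, (b - a) / d < n.+1%:R.
    by exists (Num.trunc ((b - a) / d)); rewrite truncnS_gt.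
  pose x i := a + i%:R * ((b - a) / n.+1%:R).
  have x0 : x 0%N = a by rewrite /x mul0r addr0.
  have xn : x n.+1 = b by rewrite /x mulrC divfK ?pnatr_eq0//; ring.
  have st0 : 0 <= (b - a) / n.+1%:R by rewrite divr_ge0// subr_ge0.
  have T u : u b - u a = \sum_(0 <= i < n.+1) (u (x i.+1) - u (x i)) :> R.
    by rewrite (@telescope_sumr _ 0 n.+1 (u \o x))//= xn x0.
  rewrite !T mulr_sumr.
  rewrite big_nat_cond [leRHS]big_nat_cond; apply: ler_sum => i /andP[/andP[_ i_n] _].
  have xS : x i.+1 - x i = (b - a) / n.+1%:R by rewrite /x -natr1; ring.
  apply: hd; first by rewrite /x lerDl mulr_ge0.
  - by rewrite -subr_ge0 xS.
  - by rewrite -xn /x lerD2l ler_wpM2r// ler_nat.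
  - by rewrite xS ltr_pdivrMr// mulrC -ltr_pdivrMr.
rewrite -subr_le0; apply/ler_addgt0Pr => e e0.
have := key (e / (1 + `|N b - N a|)); rewrite add0r.
have n0 : 0 < 1 + `|N b - N a| by rewrite ltr_wpDr.
rewrite divr_gt0// => /(_ isT) /le_trans; apply.
by rewrite mulrAC ler_pdivrMr//; have := ler_norm (N b - N a); nra.
Qed.

(** Absolute continuity with derivative in L^2, expressed through increments so that values of [h]
    on null sets are immaterial. *)
Definition der (l : R) f h := L2 0 l h /\
  (forall x y, 0 <= x -> x <= y -> y <= l -> f y - f x = itl x y h).

Lemma der_CS l f h x y : der l f h -> 0 <= x -> x <= y -> y <= l ->
  (f y - f x) ^+ 2 <= (y - x) * itl x y (fun t => h t ^+ 2).
Proof.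
move=> [Lh fh] x0 xy yl; rewrite fh//; apply: itl_CS => //.
exact: L2_sub Lh.
Qed.

Lemma sqr_int_ucont l f C : 0 <= C ->
  (forall x y, 0 <= x -> x <= y -> y <= l -> (f y - f x) ^+ 2 <= (y - x) * C) ->
  forall e, 0 < e -> exists2 d, 0 < d & forall x y, 0 <= x <= l -> 0 <= y <= l ->
     `|x - y| < d -> `|f x - f y| < e.
Proof.
move=> C0 H e e0; exists (e ^+ 2 / (C + 1)); first by rewrite divr_gt0 ?exprn_gt0// ltr_wpDl.
have C1 : 0 < C + 1 by rewrite ltr_wpDl.
suff W x y : 0 <= x -> x <= y -> y <= l -> y - x < e ^+ 2 / (C + 1) -> `|f y - f x| < e.
  move=> x y /andP[x0 xl] /andP[y0 yl]; have [xy|yx] := leP x y.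
    by rewrite distrC ger0_norm ?subr_ge0// => d1; rewrite distrC; exact: W.
  by rewrite gtr0_norm ?subr_gt0// => d1; apply: W => //; exact: ltW.
move=> x0 xy yl; rewrite ltr_pdivlMr// => d1.
rewrite -(ltr_pXn2r (n := 2)) ?nnegrE ?(ltW e0) ?normr_ge0//.
rewrite real_normK ?num_real//; apply: (le_lt_trans (H _ _ x0 xy yl)).
have yx : 0 <= y - x by rewrite subr_ge0.
by nra.
Qed.

Lemma der_sqr l f h : der l f h -> forall x y, 0 <= x -> x <= y -> y <= l ->
  (f y - f x) ^+ 2 <= (y - x) * itl 0 l (fun t => h t ^+ 2).
Proof.
move=> fh x y x0 xy yl; apply: (le_trans (der_CS fh x0 xy yl)).
rewrite ler_wpM2l ?subr_ge0//; apply: itl_mono => //; first exact: fh.1.2.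
by move=> t _; exact: sqr_ge0.
Qed.

Lemma der_ucont l f h : der l f h ->
  forall e, 0 < e -> exists2 d, 0 < d & forall x y, 0 <= x <= l -> 0 <= y <= l ->
     `|x - y| < d -> `|f x - f y| < e.
Proof.
move=> fh; apply: sqr_int_ucont (der_sqr fh).
by apply: itl_ge0 => x _; exact: sqr_ge0.
Qed.

Lemma der_cts l f h : der l f h -> cts 0 l f.
Proof. by move=> fh; apply: ucont_cts; exact: der_ucont fh. Qed.

Lemma der_upper l f h x y : der l f h -> 0 <= x -> x <= y -> y <= l ->
  `|f y - f x| <= itl x y (fun t => `|h t|).
Proof.
move=> [Lh fh] x0 xy yl; rewrite fh//; apply: itl_norm.
by apply: L2_itg; exact: L2_sub Lh.
Qed.

(** By [local_to_global], for both signs: over a short [x, y] the defect of the product rule is the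
    integral of [(g y - g t) * h t + (f x - f t) * k t], small relative to that of [|h| + |k|] by
    uniform continuity. *)
Lemma derM l f g h k : 0 <= l -> der l f h -> der l g k ->
  der l (fun x => f x * g x) (fun x => f x * k x + g x * h x).
Proof.
move=> l0 fh gk; have cf := der_cts fh; have cg := der_cts gk.
have LL : L2 0 l (fun x => f x * k x + g x * h x).
  by apply: L2D; apply: L2Ml => //; [exact: gk.1|exact: fh.1].
split=> // a b a0 ab bl.
have Ih : itg a b h by apply: L2_itg; exact: L2_sub fh.1.
have Ik : itg a b k by apply: L2_itg; exact: L2_sub gk.1.
have II : itg a b (fun x => f x * k x + g x * h x) by apply: L2_itg; exact: L2_sub LL.
have main (s : R) : s = 1 \/ s = -1 ->
    s * (f b * g b - itl a b (fun x => f x * k x + g x * h x)) <= s * (f a * g a).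
  move=> s1.
  have := @local_to_global a b
    (fun y => s * (f y * g y - itl a y (fun x => f x * k x + g x * h x)))
    (fun y => itl a y (fun t => `|h t| + `|k t|)) ab.
  rewrite /= [itl a a _ as X in _ -> _ <= s * (_ - X)]itl_id subr0; apply.
  move=> e e0; have [d1 d10 hd1] := der_ucont fh e0.
  have [d2 d20 hd2] := der_ucont gk e0.
  exists (Num.min d1 d2); first by rewrite lt_min d10.
  move=> x y ax xy yb yx; move: yx; rewrite lt_min => /andP[yx1 yx2].
  have Ixy u : itg a b u -> itg x y u by apply: itg_sub.
  have Say u : itg a b u -> itl a y u = itl a x u + itl x y u.
    by move=> iu; apply: itl_split; [rewrite ax|apply: itg_sub iu].
  have x0 := le_trans a0 ax; have yl := le_trans yb bl.
  have iA : itg a b (fun t => `|h t| + `|k t|) by apply: itgD; exact: itg_norm.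
  rewrite [itl a y (fun x => f x * _ + _)]Say// [itl a y (fun t => `|h t| + _)]Say//.
  rewrite [itl a x _ + _ - _]addrC addrA addNr add0r.
  have -> : s * (f y * g y - (itl a x (fun x => f x * k x + g x * h x) +
       itl x y (fun x => f x * k x + g x * h x))) -
     s * (f x * g x - itl a x (fun x => f x * k x + g x * h x)) =
     s * ((f y - f x) * g y + f x * (g y - g x) - itl x y (fun x => f x * k x + g x * h x)).
    by ring.
  have -> : (f y - f x) * g y + f x * (g y - g x) - itl x y (fun x => f x * k x + g x * h x)
     = itl x y (fun t => (g y - g t) * h t + (f x - f t) * k t).
    rewrite [RHS](eq_itl (g := fun t => (g y * h t + f x * k t) - (f t * k t + g t * h t))); last by move=> *; ring.
    have i1 : itg x y (fun t => g y * h t) by apply: itgZ; exact: Ixy.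
    have i2 : itg x y (fun t => f x * k t) by apply: itgZ; exact: Ixy.
    rewrite [RHS]itlB; [|exact: itgD|exact: Ixy].
    rewrite [X in _ = X - _]itlD// !itlZ; [|exact: Ixy|exact: Ixy].
    by rewrite fh.2// gk.2//; ring.
  set J := itl x y _.
  have iB : itg x y (fun t => (g y - g t) * h t + (f x - f t) * k t).
    have cc u v : cts 0 l u -> cts x y (fun t => v - u t).
      move=> cu; apply: ctsD; first exact: cts_cst.
      apply: (@cts_comp _ _ _ (fun z => - z)); first exact: opp_continuous.
      by apply: cts_sub cu.
    by apply: itgD; apply: itgM; by [apply: cc|apply: Ixy].
  apply: (@le_trans _ _ `|J|).
    by case: s1 => ->; rewrite ?mul1r ?mulN1r ?ler_norm// -normrN ler_norm.
  apply: (le_trans (itl_norm iB)).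
  rewrite -itlZ; last exact: Ixy.
  apply: itl_le; [exact: itg_norm|by apply: itgZ; exact: Ixy|].
  move=> t /andP[xt ty]; apply: (le_trans (ler_normD _ _)); rewrite mulrDr !normrM.
  have tl : 0 <= t <= l by rewrite (le_trans x0 xt) (le_trans ty yl).
  apply: lerD; rewrite ler_wpM2r//; apply: ltW.
    apply: hd2 => //; first by rewrite yl (le_trans x0 xy).
    by rewrite ger0_norm ?subr_ge0//; apply: le_lt_trans yx2; rewrite lerB.
  apply: hd1 => //; first by rewrite x0 (le_trans xy yl).
  by rewrite distrC ger0_norm ?subr_ge0//; apply: le_lt_trans yx1; rewrite lerB.
have := main 1 (or_introl erefl); have := main (-1) (or_intror erefl).
by rewrite !mul1r !mulN1r => h1 h2; apply/eqP; rewrite eq_le; apply/andP; split; lra.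
Qed.

(** An inequality is enough for squares, potentials and logarithms, and it asks of [Phi] only a mean
    value bound. The point [z] lies between [f x] and [f y], so on a short interval [F z] may be
    replaced by [F (f t)] up to [e]. *)
Lemma der_chain l f h (A B : R) (Phi F : R -> R) : 0 <= l -> der l f h ->
  (forall x, 0 <= x <= l -> A <= f x <= B) -> cts A B F ->
  (forall t, A <= t <= B -> 0 <= F t) ->
  (forall s t, A <= s -> s <= t -> t <= B ->
     exists2 z, s <= z <= t & `|Phi t - Phi s| <= F z * (t - s)) ->
  cts 0 l (fun t => F (f t)) ->
  forall a b, 0 <= a -> a <= b -> b <= l ->
  `|Phi (f b) - Phi (f a)| <= itl a b (fun t => F (f t) * `|h t|).
Proof.
move=> l0 fh fAB cF F0 PhiF cFf a b a0 ab bl.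
have Ih : itg a b (fun t => `|h t|).
  by apply: L2_itg; apply: L2_norm; exact: L2_sub fh.1.
have II : itg a b (fun t => F (f t) * `|h t|).
  by apply: itgM => //; apply: cts_sub cFf.
have HP u v : 0 <= u <= l -> 0 <= v <= l ->
    exists2 z, (f u <= z <= f v) || (f v <= z <= f u) & `|Phi (f v) - Phi (f u)| <= F z * `|f v - f u|.
  move=> ul vl; have /andP[u1 u2] := fAB u ul; have /andP[v1 v2] := fAB v vl.
  have [uv|vu] := leP (f u) (f v).
    have [z z1 z2] := PhiF _ _ u1 uv v2; exists z; first by rewrite z1.
    by rewrite [`|f v - f u|]ger0_norm ?subr_ge0.
  have [z z1 z2] := PhiF _ _ v1 (ltW vu) u2; exists z; first by rewrite z1 orbT.
  by rewrite distrC [`|f v - f u|]distrC [`|f u - f v|]ger0_norm ?subr_ge0 ?(ltW vu).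
have main (s : R) : s = 1 \/ s = -1 ->
    s * Phi (f b) - itl a b (fun t => F (f t) * `|h t|) <= s * Phi (f a).
  move=> s1.
  have := @local_to_global a b
    (fun y => s * Phi (f y) - itl a y (fun t => F (f t) * `|h t|))
    (fun y => itl a y (fun t => `|h t|)) ab.
  rewrite /= [itl a a _ as X in _ -> _ <= _ - X]itl_id subr0; apply.
  move=> e e0; have [d1 d10 hd1] := cts_ucont cF e0.
  have [d d0 hd] := der_ucont fh d10.
  exists d => // x y ax xy yb yx.
  have Ixy u : itg a b u -> itg x y u by apply: itg_sub.
  have Say u : itg a b u -> itl a y u = itl a x u + itl x y u.
    by move=> iu; apply: itl_split; [rewrite ax|apply: itg_sub iu].
  have x0 := le_trans a0 ax; have yl := le_trans yb bl.
  rewrite !Say// [itl a x (fun t => `|h t|) + _ - _]addrC addrA addNr add0r.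
  have xl : 0 <= x <= l by rewrite x0 (le_trans xy yl).
  have yl' : 0 <= y <= l by rewrite yl (le_trans x0 xy).
  have [z z1 z2] := HP x y xl yl'.
  have zAB : A <= z <= B.
    have /andP[u1 u2] := fAB x xl; have /andP[v1 v2] := fAB y yl'.
    by case/orP: z1 => /andP[w1 w2]; rewrite ?(le_trans _ w1)// (le_trans w2).
  suff : s * (Phi (f y) - Phi (f x)) <= itl x y (fun t => F (f t) * `|h t|) + e * itl x y (fun t => `|h t|) by lra.
  apply: (@le_trans _ _ `|Phi (f y) - Phi (f x)|).
    by case: s1 => ->; rewrite ?mul1r ?mulN1r ?ler_norm// -normrN ler_norm.
  apply: (le_trans z2); apply: (@le_trans _ _ (F z * itl x y (fun t => `|h t|))).
    by rewrite ler_wpM2l ?F0// (der_upper fh).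
  rewrite -!itlZ; [|exact: Ixy|exact: Ixy].
  rewrite -itlD; [|exact: Ixy|by apply: itgZ; exact: Ixy].
  apply: itl_le; [by apply: itgZ; exact: Ixy|by apply: itgD; [|apply: itgZ]; exact: Ixy|].
  move=> t /andP[xt ty]; rewrite -mulrDl ler_wpM2r//.
  have tl : 0 <= t <= l by rewrite (le_trans x0 xt) (le_trans ty yl).
  have : `|F z - F (f t)| < e.
    apply: hd1 => //; first exact: fAB.
    have hx : `|f x - f t| < d1.
      apply: hd => //; rewrite distrC ger0_norm ?subr_ge0//.
      by apply: le_lt_trans yx; rewrite lerB.
    have hy : `|f y - f t| < d1.
      apply: hd => //; rewrite ger0_norm ?subr_ge0//.
      by apply: le_lt_trans yx; rewrite lerB.
    by case/orP: z1 => zb; [exact: norm_between zb hx hy|exact: norm_between zb hy hx].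
  by rewrite ltr_norml => /andP[_ h1]; lra.
have := main 1 (or_introl erefl); have := main (-1) (or_intror erefl).
by rewrite !mul1r !mulN1r => h1 h2; rewrite ler_norml; apply/andP; split; lra.
Qed.

End AbsolutelyContinuous.

(** * Functions with square integrable derivative *)

Section RieszFischer.
Variable R : realType.
Local Notation mu := (@lebesgue_measure R).
Implicit Types (a b c d : R) (f g h : R -> R).

Lemma EFin_itl a b f : itg a b f ->
  (\int[mu]_(x in `[a, b]) (f x)%:E)%E = (itl a b f)%:E.
Proof. by move=> fi; rewrite fineK//; exact: integrable_fin_num. Qed.

Lemma itg_ge0_fin a b f (C : R) : measurable_fun `[a, b] f ->
  (forall x, a <= x <= b -> 0 <= f x) ->
  (\int[mu]_(x in `[a, b]) (f x)%:E <= C%:E)%E -> itg a b f /\ itl a b f <= C.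
Proof.
move=> mf f0 fC; have i1 : itg a b f.
  apply/integrableP; split; first exact/measurable_EFinP.
  apply: le_lt_trans (ltry C); apply: le_trans fC.
  rewrite le_eqVlt; apply/orP; left; apply/eqP; apply: eq_integral => x.
  by rewrite inE itv_in => xab; rewrite /= ger0_norm// f0.
by split=> //; rewrite -lee_fin -EFin_itl.
Qed.

Lemma ae_imp (P Q : R -> Prop) : (forall x, P x -> Q x) ->
  {ae mu, forall x, P x} -> {ae mu, forall x, Q x}.
Proof. by move=> PQ; apply: filterS; first exact: (ae_filter_ringOfSetsType mu). Qed.

(** The increments are summable in L^1, so the sequence converges almost everywhere under an
    integrable majorant. Fatou's lemma gives the bound by [C], dominated convergence the limits of
    the integrals. *)
Lemma riesz_fischer l C (g : nat -> R -> R) : 0 <= l ->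
  (forall k, L2 0 l (g k)) ->
  (forall k, itl 0 l (fun x => g k x ^+ 2) <= C) ->
  (forall k, itl 0 l (fun x => (g k.+1 x - g k x) ^+ 2) <= (4^-1) ^+ k) ->
  exists h, [/\ L2 0 l h, itl 0 l (fun x => h x ^+ 2) <= C &
    forall x y, 0 <= x -> x <= y -> y <= l ->
      (fun k => itl x y (g k)) @ \oo --> itl x y h].
Proof.
move=> l0 Lg gC gd; pose D : set R := `[0, l]%classic.
have mD : measurable D by exact: measurable_itv.
pose t k x := `|g k.+1 x - g k x|.
have Ld k : L2 0 l (fun x => g k.+1 x - g k x).
  apply: L2D => //; have [m1 i1] := L2Z (-1) (Lg k).
  by have -> : (fun x => - g k x) = (fun x => -1 * g k x) by apply/funext => x; ring.
have it k : itg 0 l (t k) by apply: itg_norm; exact: L2_itg.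
have it_le k : itl 0 l (t k) <= (l + 1) / 2 * (2^-1) ^+ k.
  have i2 := (Ld k).2.
  (* Young's inequality with weight 2^k turns the bound 4^-k for the square into one of order 2^-k
     for the L^1 norm. *)
  apply: (@le_trans _ _ (itl 0 l (fun x => (2^-1) ^+ k / 2 + (2 ^+ k / 2) * (g k.+1 x - g k x) ^+ 2))).
    apply: itl_le => //.
      by apply: itgD; [apply: cts_itg; exact: cts_cst|exact: itgZ].
    move=> x _; rewrite /t -[(_ - _) ^+ 2]real_normK ?num_real// exprVn.
    set z := `|_|; have z0 : 0 <= z := normr_ge0 _.
    have p0 : (0 : R) < 2 ^+ k by rewrite exprn_gt0.
    rewrite -(ler_pM2l p0).
    have -> : 2 ^+ k * ((2 ^+ k)^-1 / 2 + 2 ^+ k / 2 * z ^+ 2) = (1 + (2 ^+ k * z) ^+ 2) / 2.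
      by field; rewrite gt_eqF.
    by have := sqr_ge0 (1 - 2 ^+ k * z); nra.
  rewrite itlD; [|by apply: cts_itg; exact: cts_cst|exact: itgZ].
  rewrite itl_cst// itlZ// subr0.
  have := ler_wpM2l (_ : 0 <= 2 ^+ k / 2 :> R) (gd k).
  rewrite divr_ge0 ?exprn_ge0// => /(_ isT).
  have -> : 2 ^+ k / 2 * (4^-1) ^+ k = (2^-1) ^+ k / 2 :> R.
    rewrite !exprVn (_ : 4 = 2 * 2 :> R) ?exprMn; last by rewrite -natrM.
    by field; rewrite expf_neq0.
  lra.
have ED u : itg 0 l u -> (\int[mu]_(x in D) (u x)%:E)%E = (itl 0 l u)%:E.
  exact: EFin_itl.
have mt k : measurable_fun D (fun x => (t k x)%:E).
  by apply/measurable_EFinP; exact: itg_meas.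
(* The majorant: [|g 0|] plus all increments dominates every [|g n|]. *)
pose G x : \bar R := (`|g 0%N x|%:E + \sum_(k <oo) (t k x)%:E)%E.
have S0 x : (0 <= \sum_(k <oo) (t k x)%:E)%E.
  by apply: nneseries_ge0 => k _ _; rewrite lee_fin normr_ge0.
have mS : measurable_fun D (fun x => \sum_(k <oo) (t k x)%:E)%E.
  by apply: ge0_emeasurable_sum => // k x _ _; rewrite lee_fin normr_ge0.
have iS : mu.-integrable D (fun x => \sum_(k <oo) (t k x)%:E)%E.
  apply/integrableP; split => //.
  under eq_integral do rewrite gee0_abs//.
  rewrite integral_nneseries//; last by move=> k x _; rewrite lee_fin normr_ge0.
  apply: (@le_lt_trans _ _ (\sum_(k <oo) (((l + 1) / 2)%:E * (((2^-1) ^+ k : R))%:E))%E).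
    apply: lee_nneseries => [k _ _|k _].
      by apply: integral_ge0 => x _; rewrite lee_fin normr_ge0.
    by rewrite ED// -EFinM lee_fin.
  rewrite (_ : (fun n => _) = (fun n => ((series (geometric ((l + 1) / 2) (2^-1)) : nat -> R) n)%:E)); last first.
    apply/funext => n; rewrite /series /= -sumEFin; apply: eq_bigr => k _.
    by rewrite -EFinM.
  have h2 : `|2^-1| < 1 :> R by rewrite ger0_norm; lra.
  rewrite EFin_lim ?ltey//.
  exact: (is_cvg_geometric_series h2).
have iG : mu.-integrable D G.
  apply: integrableD => //; apply: itg_norm.
  by apply: L2_itg.
have gG x n : (`|(g n x)%:E| <= G x)%E.
  rewrite /G /= ; apply: (@le_trans _ _ (`|g 0%N x|%:E + \sum_(0 <= k < n) (t k x)%:E)%E).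
    rewrite sumEFin -EFinD lee_fin.
    elim: n => [|n IH]; first by rewrite big_geq// addr0.
    rewrite big_nat_recr//= addrA.
    rewrite (_ : g n.+1 x = g n x + (g n.+1 x - g n x)); last by ring.
    by apply: (le_trans (ler_normD _ _)); rewrite lerD2r.
  by rewrite leeD2l//; apply: nneseries_lim_ge => k _ _; rewrite lee_fin normr_ge0.
have gcvg x : (\sum_(k <oo) (t k x)%:E)%E \is a fin_num -> cvgn (fun n => g n x).
  move=> /fineK Sx.
  have cs : cvgn (series (fun k => g k.+1 x - g k x)).
    apply: normed_cvg; apply: nondecreasing_is_cvgn.
      by apply: nondecreasing_series => n _ _; exact: normr_ge0.
    exists (fine (\sum_(k <oo) (t k x)%:E)%E) => _ [n _ <-].
    rewrite -lee_fin Sx /series /= -sumEFin.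
    by apply: nneseries_lim_ge => k _ _; rewrite lee_fin normr_ge0.
  have -> : (fun n => g n x) = (fun n => series (fun k => g k.+1 x - g k x) n + g 0%N x).
    by apply/funext => n; rewrite /series /= (@telescope_sumr _ 0 n (fun k => g k x))//; ring.
  by apply: is_cvgD => //; exact: is_cvg_cst.
(* The upper limit is measurable everywhere and equals the limit almost everywhere; [fine] gives 0
   where it is infinite. *)
pose f x := limn_esup (fun n => (g n x)%:E).
have mf : measurable_fun D f.
  by apply: measurable_fun_limn_esup => n; apply/measurable_EFinP; exact: (Lg n).1.
pose h x := fine (f x).
have mh : measurable_fun D h by apply: measurableT_comp mf; exact: fine_measurable.
have hlim x : (\sum_(k <oo) (t k x)%:E)%E \is a fin_num ->
    f x = (h x)%:E /\ (fun n => g n x) @ \oo --> h x.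
  move=> /gcvg gx.
  have ef : (fun n => (g n x)%:E) @ \oo --> (limn (fun n => g n x))%:E.
    by apply: cvg_EFin; [exact: nearW|].
  have fE : f x = (limn (fun n => g n x))%:E.
    by rewrite /f is_cvg_limn_esupE; [apply/cvg_lim|apply/cvg_ex; eexists; exact: ef].
  by rewrite /h fE.
have ae_h : {ae mu, forall x, D x -> f x = (h x)%:E /\ (fun n => g n x) @ \oo --> h x}.
  have : {ae mu, forall x, D x -> (\sum_(k <oo) (t k x)%:E)%E \is a fin_num} by exact: integrable_ae iS.
  apply: ae_imp => x + Dx => /(_ Dx); exact: hlim.
have sqC : (\int[mu]_(x in D) (h x ^+ 2)%:E <= C%:E)%E.
  have E1 : (\int[mu]_(x in D) (h x ^+ 2)%:E =
     \int[mu]_(x in D) limn_einf (fun n => (g n x ^+ 2)%:E))%E.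
    apply: ae_eq_integral => //.
    - by apply/measurable_EFinP; exact: measurable_funX.
    - rewrite (_ : (fun x => limn_einf _) =
          (fun x => - limn_esup (fun n => - (g n x ^+ 2)%:E))%E); last first.
        by apply/funext => x; rewrite (limn_esupN (fun n => (g n x ^+ 2)%:E)) oppeK.
      apply: measurableT_comp => //; apply: measurable_fun_limn_esup => n.
      apply: measurableT_comp => //; apply/measurable_EFinP.
      by apply: measurable_funX; exact: (Lg n).1.
    move: (ae_h); apply: ae_imp => x + Dx => /(_ Dx) [_ cx].
    have c2 : (fun n => (g n x ^+ 2)%:E) @ \oo --> (h x ^+ 2)%:E.
      by apply: cvg_EFin; [exact: nearW|]; rewrite expr2; exact: cvgM.
    rewrite is_cvg_limn_einfE; last by apply/cvg_ex; eexists; exact: c2.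
    by apply/esym/cvg_lim.
  rewrite E1; apply: (le_trans (fatou _ _ _ _)) => //.
  - by move=> n; apply/measurable_EFinP; apply: measurable_funX; exact: (Lg n).1.
  - by move=> n x _; rewrite lee_fin sqr_ge0.
  rewrite limn_einf_lim; apply: lime_le; first exact: is_cvg_einfs.
  apply: nearW => n; apply: (@le_trans _ _ (\int[mu]_(x in D) (g n x ^+ 2)%:E)%E).
    by apply: ereal_inf_lbound; exists n => //=.
  by rewrite ED ?lee_fin//; exact: (Lg n).2.
have [ih2 hC] : itg 0 l (fun x => h x ^+ 2) /\ itl 0 l (fun x => h x ^+ 2) <= C.
  apply: itg_ge0_fin => //; first exact: measurable_funX.
  by move=> x _; exact: sqr_ge0.
have Lh : L2 0 l h by split.
exists h; split=> // x y x0 xy yl.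
have xyD : `[x, y]%classic `<=` D.
  by move=> z; rewrite /D !itv_in => /andP[xz zy]; rewrite (le_trans x0 xz) (le_trans zy yl).
have Ih : itg x y h by apply: L2_itg; apply: L2_sub Lh.
have m1 n : measurable_fun `[x, y] (fun t => (g n t)%:E).
  by apply/measurable_EFinP; apply: measurable_funS (Lg n).1.
have m2 : measurable_fun `[x, y] (fun t => (h t)%:E).
  by apply/measurable_EFinP; apply: measurable_funS mh.
have c1 : {ae mu, forall z, `[x, y]%classic z -> (fun n => (g n z)%:E) @ \oo --> (h z)%:E}.
  move: ae_h; apply: ae_imp => z + xyz => /(_ (xyD _ xyz)) [_ cz].
  by apply: cvg_EFin => //; exact: nearW.
have iG' : mu.-integrable `[x, y] G by exact: integrableS iG.
have bG : {ae mu, forall z n, `[x, y]%classic z -> (`|(g n z)%:E| <= G z)%E}.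
  by apply: aeW => z n _; exact: gG.
have [_ _ H] := @dominated_convergence _ _ R mu `[x, y] (measurable_itv _) _ _ G m1 m2 c1 iG' bG.
have : (fun n => (itl x y (g n))%:E) @ \oo --> (itl x y h)%:E.
  rewrite -(EFin_itl Ih) (_ : (fun n => _) = [sequence (\int[mu]_(x0 in `[x, y]) (g n x0)%:E)%E]_n)//.
  by apply/funext => n /=; rewrite EFin_itl//; apply: L2_itg; apply: L2_sub (Lg n).
by move=> /fine_cvg.
Qed.

End RieszFischer.

(** * The criterion of F. Riesz for a square integrable derivative *)

Section RieszCriterion.
Variable R : realType.
Local Notation mu := (@lebesgue_measure R).
Implicit Types (a b c d : R) (f g h : R -> R).

(** The step functions below are constant on half-open cells only; the right endpoint is a null
    set. *)
Lemma eq_itl_co a b f g : itg a b f -> itg a b g ->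
  (forall x, a <= x < b -> f x = g x) -> itl a b f = itl a b g.
Proof.
move=> i1 i2 fg.
have sub : (`[a, b[%classic : set R) `<=` `[a, b]%classic by apply: subset_itv_co_cc.
rewrite /itl -!Rintegral_itv_bndo_bndc//; [|exact: integrableS i2|exact: integrableS i1].
by apply: eq_Rintegral => x; rewrite inE /= in_itv /=; exact: fg.
Qed.

Variables (l : R) (f : R -> R).
Hypothesis l0 : 0 < l.

Definition gp n i : R := i%:R * (l / n%:R).
Definition slope n i : R := (f (gp n i.+1) - f (gp n i)) / (l / n%:R).
Definition stp n (x : R) : R :=
  \sum_(i < n) slope n i * \1_(`[gp n i, gp n i.+1[%classic) x.

(** The Dirichlet integral of the piecewise linear interpolation of [f] at the nodes [gp n i], whose
    derivative is [stp n]. *)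
Definition grid_energy n : R := \sum_(i < n) (f (gp n i.+1) - f (gp n i)) ^+ 2 / (l / n%:R).

Lemma gp0 n : gp n 0 = 0. Proof. by rewrite /gp mul0r. Qed.

Lemma gpn n : (0 < n)%N -> gp n n = l.
Proof. by move=> n0; rewrite /gp mulrC divfK// pnatr_eq0 -lt0n. Qed.

Lemma mesh_gt0 n : (0 < n)%N -> 0 < l / n%:R.
Proof. by move=> n0; rewrite divr_gt0// ltr0n. Qed.

Lemma gp_le n i j : (0 < n)%N -> (i <= j)%N -> gp n i <= gp n j.
Proof. by move=> n0 ij; rewrite /gp ler_wpM2r ?ler_nat// ltW// mesh_gt0. Qed.

Lemma gpS n i : gp n i.+1 - gp n i = l / n%:R.
Proof. by rewrite /gp -natr1; ring. Qed.

Lemma gp_ge0 n i : (0 < n)%N -> 0 <= gp n i.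
Proof. by move=> n0; rewrite -(gp0 n) gp_le. Qed.

Lemma gp_lel n i : (0 < n)%N -> (i <= n)%N -> gp n i <= l.
Proof. by move=> n0 i_n; rewrite -[leRHS](gpn n0) gp_le. Qed.

Lemma gp_refine n m i : (0 < n)%N -> (0 < m)%N -> gp (n * m) (i * m) = gp n i.
Proof.
move=> n0 m0; rewrite /gp !natrM; field.
by rewrite !pnatr_eq0 -!lt0n n0 m0.
Qed.

Lemma stp_val n i x : (i < n)%N -> gp n i <= x < gp n i.+1 -> stp n x = slope n i.
Proof.
move=> i_n /andP[ix xi]; have n0 : (0 < n)%N by exact: leq_ltn_trans i_n.
rewrite /stp (bigD1 (Ordinal i_n))//= big1 ?addr0 => [|j ji].
  by rewrite indicE mem_set ?mulr1//= in_itv /= ix.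
rewrite indicE memNset ?mulr0//= in_itv /= => /andP[jx xj].
case: (ltngtP j i) => ij.
- by move: (gp_le n0 ij); rewrite leNgt (le_lt_trans ix xj).
- by move: (gp_le n0 ij); rewrite leNgt (le_lt_trans jx xi).
- by move/eqP: ji; apply; apply: val_inj.
Qed.

Lemma stp_L2 n a b : L2 a b (stp n).
Proof.
have mS : measurable_fun `[a, b] (stp n).
  apply: measurable_sum => i; apply: measurable_funM; first exact: measurable_cst.
  exact: measurable_indic.
split=> //; apply: (@le_itg _ _ _ _ (fun=> (\sum_(i < n) `|slope n i|) ^+ 2)).
- exact: measurable_funX.
- move=> x _; rewrite normrX lerXn2r ?nnegrE ?sumr_ge0//.
  apply: (le_trans (ler_norm_sum _ _ _)); apply: ler_sum => i _.
  by rewrite normrM ler_piMr// indicE; case: (_ \in _); rewrite ?normr1 ?normr0.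
- by apply: cts_itg; exact: cts_cst.
Qed.

Lemma stp_itg n a b : itg a b (stp n).
Proof. by apply: L2_itg; exact: stp_L2. Qed.

Lemma stp_int_cell n i : (i < n)%N -> itl (gp n i) (gp n i.+1) (stp n) = f (gp n i.+1) - f (gp n i).
Proof.
move=> i_n; have n0 : (0 < n)%N by exact: leq_ltn_trans i_n.
rewrite (@eq_itl_co _ _ _ (fun=> slope n i)); first last.
- by move=> x xi; exact: stp_val.
- by apply: cts_itg; exact: cts_cst.
- exact: stp_itg.
by rewrite itl_cst ?gp_le// gpS divfK// gt_eqF// mesh_gt0.
Qed.

Lemma stp_int n i j : (0 < n)%N -> (i <= j)%N -> (j <= n)%N ->
  itl (gp n i) (gp n j) (stp n) = f (gp n j) - f (gp n i).
Proof.
move=> n0; elim: j => [|j IH].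
  by rewrite leqn0 => /eqP -> _; rewrite itl_id subrr.
rewrite leq_eqVlt => /orP[/eqP -> _|]; first by rewrite itl_id subrr.
rewrite ltnS => ij jn; rewrite (@itl_split _ _ _ (gp n j)); last exact: stp_itg.
  by rewrite IH ?(ltnW jn)// stp_int_cell//; ring.
by rewrite !gp_le.
Qed.

(** Pythagoras for a martingale: on a coarse cell [stp n] is constant, equal to the mean of the
    refinement [stp (n * m)]. *)
Lemma stp_orth n m j : (0 < n)%N -> (0 < m)%N -> (j <= n)%N ->
  itl 0 (gp n j) (fun x => (stp (n * m) x - stp n x) ^+ 2) =
  itl 0 (gp n j) (fun x => stp (n * m) x ^+ 2) - itl 0 (gp n j) (fun x => stp n x ^+ 2).
Proof.
move=> n0 m0; elim: j => [|j IH] jn; first by rewrite gp0 !itl_id subrr.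
have Ls k a b := (stp_L2 k a b).2.
have Ld a b : itg a b (fun x => (stp (n * m) x - stp n x) ^+ 2).
  have L1 : L2 a b (fun x => - stp n x).
    have -> : (fun x => - stp n x) = (fun x => -1 * stp n x) by apply/funext => x; ring.
    by apply: L2Z; exact: stp_L2.
  by have [] := L2D (stp_L2 (n * m) a b) L1.
have sp : 0 <= gp n j <= gp n j.+1 by rewrite gp_ge0//= gp_le.
rewrite !(itl_split sp)// IH ?(ltnW jn)//.
suff -> : itl (gp n j) (gp n j.+1) (fun x => (stp (n * m) x - stp n x) ^+ 2) =
  itl (gp n j) (gp n j.+1) (fun x => stp (n * m) x ^+ 2) -
  itl (gp n j) (gp n j.+1) (fun x => stp n x ^+ 2) by ring.
set s := slope n j.
have ic c : itg (gp n j) (gp n j.+1) (fun=> c) by apply: cts_itg; exact: cts_cst.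
have -> : itl (gp n j) (gp n j.+1) (fun x => stp n x ^+ 2) = s ^+ 2 * (l / n%:R).
  rewrite (@eq_itl_co _ _ _ (fun=> s ^+ 2))//; last by move=> x xi; rewrite (stp_val jn xi).
  by rewrite itl_cst ?gp_le// gpS.
have i1 : itg (gp n j) (gp n j.+1) (fun x => 2 * s * stp (n * m) x).
  by apply: itgZ; exact: stp_itg.
have i2 : itg (gp n j) (gp n j.+1) (fun x => stp (n * m) x ^+ 2 - 2 * s * stp (n * m) x).
  exact: itgB.
rewrite (@eq_itl_co _ _ _ (fun x => stp (n * m) x ^+ 2 - 2 * s * stp (n * m) x + s ^+ 2))//; first last.
- by move=> x xi; rewrite (stp_val jn xi) -/s; ring.
- exact: itgD.
rewrite itlD// itlB// itl_cst ?gp_le// gpS itlZ; last exact: stp_itg.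
have -> : itl (gp n j) (gp n j.+1) (stp (n * m)) = s * (l / n%:R).
  rewrite -(gp_refine j n0 m0) -(gp_refine j.+1 n0 m0) stp_int ?muln_gt0 ?n0 ?leq_mul2r ?leqnSn ?jn ?orbT//.
  by rewrite !gp_refine// /s /slope divfK// gt_eqF// mesh_gt0.
ring.
Qed.

Lemma stp_sq n : (0 < n)%N -> itl 0 l (fun x => stp n x ^+ 2) = grid_energy n.
Proof.
move=> n0; rewrite -[in LHS](gpn n0) /grid_energy.
suff H j : (j <= n)%N -> itl 0 (gp n j) (fun x => stp n x ^+ 2) =
    \sum_(i < j) (f (gp n i.+1) - f (gp n i)) ^+ 2 / (l / n%:R) by exact: H.
have Ls a b := (stp_L2 n a b).2.
elim: j => [|j IH] jn; first by rewrite gp0 itl_id big_ord0.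
have sp : 0 <= gp n j <= gp n j.+1 by rewrite gp_ge0//= gp_le.
rewrite (itl_split sp)// IH ?(ltnW jn)// big_ord_recr /=; congr (_ + _).
rewrite (@eq_itl_co _ _ _ (fun=> slope n j ^+ 2))//.
- rewrite itl_cst ?gp_le// gpS /slope; field.
  by rewrite (gt_eqF l0) pnatr_eq0 -lt0n n0.
- by apply: cts_itg; exact: cts_cst.
- by move=> x xi; rewrite (stp_val jn xi).
Qed.

(* The slopes of the dyadic interpolations of [f] form an L^2 martingale, hence converge. *)
Lemma riesz_criterion C : cts 0 l f -> (forall N, grid_energy (2 ^ N) <= C) ->
  exists h, der l f h /\ itl 0 l (fun x => h x ^+ 2) <= C.
Proof.
move=> cf HC; pose a N := grid_energy (2 ^ N).
have p2 N : (0 < 2 ^ N)%N by rewrite expn_gt0.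
have diff N m : itl 0 l (fun x => (stp (2 ^ (N + m)) x - stp (2 ^ N) x) ^+ 2) = a (N + m)%N - a N.
  by rewrite expnD /a expnD -!stp_sq ?muln_gt0 ?p2// -[in LHS](gpn (p2 N)) stp_orth// gpn.
have a_mono N m : a N <= a (N + m)%N.
  by rewrite -subr_ge0 -diff; apply: itl_ge0 => x _; exact: sqr_ge0.
have a_nd : nondecreasing_seq a.
  by apply/nondecreasing_seqP => n; rewrite -addn1.
have a_ub : has_ubound (range a) by exists C => _ [n _ <-]; exact: HC.
have a_cvg : a @ \oo --> sup (range a) by exact: nondecreasing_cvgn.
have a_le n : a n <= sup (range a) by apply: ub_le_sup => //; exists n.
(* The grid energies increase with refinement and are bounded; from [nn k] on they are within 4^-k
   of their supremum, the rate asked by [riesz_fischer]. *)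
have /choice[nn hnn] : forall k, exists n0, forall n, (n0 <= n)%N -> sup (range a) - a n <= (4^-1) ^+ k.
  move=> k; have k0 : (0 : R) < (4^-1) ^+ k by rewrite exprn_gt0// invr_gt0.
  move/cvgrPdist_le: a_cvg => /(_ _ k0) [n0 _ hn]; exists n0 => n /hn /=.
  by apply: le_trans; exact: ler_norm.
(* Partial sums make the subsequence strictly increasing while [nn k <= NN k]. *)
pose NN k := (\sum_(j < k.+1) (nn j).+1)%N.
have NNS k : NN k.+1 = (NN k + (nn k.+1).+1)%N by rewrite /NN big_ord_recr.
have NN_ge k : (nn k <= NN k)%N by rewrite /NN big_ord_recr /= (leq_trans (leqnSn _))// leq_addl.
pose g k := stp (2 ^ NN k).
have NN_up k : (k <= NN k)%N.
  by elim: k => // j IH; rewrite NNS addnS ltnS (leq_trans IH)// leq_addr.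
have Lg k : L2 0 l (g k) by exact: stp_L2.
have gC k : itl 0 l (fun x => g k x ^+ 2) <= C by rewrite stp_sq//; exact: HC.
have gd k : itl 0 l (fun x => (g k.+1 x - g k x) ^+ 2) <= (4^-1) ^+ k.
  rewrite /g NNS diff -NNS; apply: (le_trans _ (hnn k _ (NN_ge k))).
  by rewrite lerD2r.
have [h [Lh hC hl]] := riesz_fischer (ltW l0) Lg gC gd.
have Ih : itg 0 l h by exact: L2_itg.
pose H x := itl 0 x h.
(* A dyadic node belongs to all finer dyadic grids, so the integrals up to it are eventually
   constant. *)
have Hgrid N i : (i <= 2 ^ N)%N -> H (gp (2 ^ N) i) = f (gp (2 ^ N) i) - f 0.
  move=> iN; have := hl 0 (gp (2 ^ N) i) (lexx _) (gp_ge0 i (p2 N)) (gp_lel (p2 N) iN).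
  move=> /(cvg_unique (@Rhausdorff R)); apply.
  have : (fun=> f (gp (2 ^ N) i) - f 0 : R) @ \oo --> f (gp (2 ^ N) i) - f 0 by exact: cvg_cst.
  apply: cvg_trans; apply: near_eq_cvg; near=> k.
  have Nk : (N <= NN k)%N by apply: leq_trans (NN_up k); near: k; exact: nbhs_infty_ge.
  rewrite /g -(subnKC Nk) expnD; set m := (2 ^ (NN k - N))%N; set n := (2 ^ N)%N.
  have n0 : (0 < n)%N by exact: p2.
  have m0 : (0 < m)%N by exact: p2.
  have -> : itl 0 (gp n i) (stp (n * m)) = itl (gp (n * m) 0) (gp (n * m) (i * m)) (stp (n * m)).
    by rewrite gp0 gp_refine.
  rewrite stp_int ?muln_gt0 ?n0 ?m0//; last by rewrite leq_mul2r iN orbT.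
  by rewrite gp_refine// gp0.
have H_cont : forall e, 0 < e -> exists2 d, 0 < d & forall x y, 0 <= x <= l -> 0 <= y <= l ->
     `|x - y| < d -> `|H x - H y| < e.
  apply: (@der_ucont _ _ _ h); split=> // x y x0 xy yl.
  rewrite /H (@itl_split _ 0 y x) ?x0//; first by ring.
  by apply: itg_sub Ih.
(* Both sides are continuous and agree at the dyadic nodes. *)
have HE x : 0 <= x <= l -> f x - f 0 = H x.
  move=> xl; apply/eqP; rewrite -subr_eq0 -normr_le0; apply/ler_addgt0Pr => e e0; rewrite add0r.
  have e2 : 0 < e / 2 by rewrite divr_gt0.
  have [d1 d10 hd1] := H_cont _ e2; have [d2 d20 hd2] := cts_ucont cf e2.
  pose d := Num.min d1 d2; have d0 : 0 < d by rewrite lt_min d10.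
  have [N hN] : exists N, l / (2 ^ N)%:R < d.
    exists (Num.trunc (l / d)).+1; rewrite ltr_pdivrMr ?ltr0n// mulrC -ltr_pdivrMr//.
    apply: (lt_trans (truncnS_gt _)); rewrite ltr_nat.
    exact: ltn_expl.
  have m0 := mesh_gt0 (p2 N).
  pose i := Num.trunc (x / (l / (2 ^ N)%:R)).
  case/andP: (xl) => x0 xl'.
  have ix : gp (2 ^ N) i <= x.
    by rewrite /gp -ler_pdivlMr// truncn_le// divr_ge0// ltW.
  have xi : x - gp (2 ^ N) i < d.
    apply: lt_trans hN; rewrite ltrBlDr -{1}(gpS (2 ^ N) i) subrK.
    by rewrite /gp -ltr_pdivrMr// truncnS_gt.
  have iN : (i <= 2 ^ N)%N.
    rewrite -(ler_nat R) -(ler_pM2r m0) -/(gp _ _) (le_trans ix)//.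
    by rewrite mulrC divfK// pnatr_eq0 -lt0n p2.
  have gl : 0 <= gp (2 ^ N) i <= l by rewrite gp_ge0//= (le_trans ix).
  have dx : `|x - gp (2 ^ N) i| < d by rewrite ger0_norm// subr_ge0.
  have [dx1 dx2] : `|x - gp (2 ^ N) i| < d1 /\ `|x - gp (2 ^ N) i| < d2.
    by move: dx; rewrite /d lt_min => /andP[].
  have {}hd1 := hd1 _ _ xl gl dx1.
  have {}hd2 := hd2 _ _ xl gl dx2.
  rewrite (_ : f x - f 0 - H x = (f x - f (gp (2 ^ N) i)) - (H x - H (gp (2 ^ N) i))).
    by apply: (le_trans (ler_normB _ _)); lra.
  by rewrite Hgrid//; ring.
exists h; split=> //; split=> // x y x0 xy yl.
have -> : f y - f x = (f y - f 0) - (f x - f 0) by ring.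
rewrite !HE ?x0 ?yl ?(le_trans xy yl) ?(le_trans x0 xy)//.
rewrite /H (@itl_split _ 0 y x) ?x0//; first by ring.
by apply: itg_sub Ih.
Unshelve. all: by end_near. Qed.

End RieszCriterion.

(** * Weak derivatives *)

Section WeakDerivative.
Variable R : realType.
Local Notation mu := (@lebesgue_measure R).
Implicit Types (a b c d l x y K h : R) (f g phi : R -> R).

Lemma C1_itl phi k a b : a <= b ->
  (forall x, is_derive x (1 : R) phi (k x)) -> continuous k -> phi b - phi a = itl a b k.
Proof.
move=> ab dphi ck; have [ab'|ba] := ltP a b; last first.
  have -> : b = a by apply/eqP; rewrite eq_le ab ba.
  by rewrite itl_id subrr.
have der x : derivable phi x 1 by have [] := dphi x.
have cphi : continuous phi by move=> x; apply: differentiable_continuous; apply/derivable1_diffP.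
rewrite /itl /Rintegral (@continuous_FTC2 _ _ phi)//.
- exact: continuous_subspaceT.
- split; [by move=> x _|apply: cvg_at_right_filter; exact: cphi|apply: cvg_at_left_filter; exact: cphi].
- by move=> x _; rewrite derive1E; have [] := dphi x.
Qed.

Lemma C1_der phi k l : (forall x, is_derive x (1 : R) phi (k x)) -> continuous k -> der l phi k.
Proof.
move=> dphi ck; split; first by apply: cts_L2; exact: ctsT.
by move=> x y _ xy _; exact: C1_itl.
Qed.

Lemma Rint_oo l u : itg 0 l u -> \int[mu]_(x in `]0, l[) u x = itl 0 l u.
Proof.
move=> iu; rewrite /Rintegral -(@integral_itv_bndoo _ _ _ _ true false)//.
apply/measurable_EFinP; apply: measurable_funS (itg_meas iu) => //.
exact: subset_itv_oo_cc.
Qed.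

(** Gives the derivative of the square of the positive part, for which a quadratic error bound is
    available by cases. *)
Lemma is_derive_quad phi x c K : (forall h, `|phi (x + h) - phi x - c * h| <= K * h ^+ 2) ->
  is_derive x (1 : R) phi c.
Proof.
move=> H.
have K0 : 0 <= K by have := le_trans (normr_ge0 _) (H 1); rewrite expr1n mulr1.
have cv : h^-1 *: (phi (h *: 1 + x) - phi x) @[h --> 0^'] --> c.
  apply/cvgrPdist_lt => e e0; near=> h.
  have h0 : h != 0 by near: h; exact: nbhs_dnbhs_neq.
  have -> : c - h^-1 *: (phi (h *: 1 + x) - phi x) = - (phi (x + h) - phi x - c * h) / h.
    by rewrite /GRing.scale /= mulr1 (addrC h); field.
  rewrite normrM normfV normrN ltr_pdivrMr ?normr_gt0//.
  apply: (le_lt_trans (H h)).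
  have : `|h| < e / (K + 1).
    near: h; apply: dnbhs0_lt; rewrite divr_gt0// ltr_wpDl//.
  rewrite ltr_pdivlMr ?ltr_wpDl// -[h ^+ 2]real_normK ?num_real//.
  have : 0 < `|h| by rewrite normr_gt0.
  by nra.
by split; [apply/cvg_ex; exists c|apply/cvg_lim].
Unshelve. all: by end_near. Qed.

Definition pos_part (x : R) : R := (x + `|x|) / 2.

Lemma pos_part_ge x : 0 <= x -> pos_part x = x.
Proof. by move=> x0; rewrite /pos_part ger0_norm//; field. Qed.

Lemma pos_part_le x : x <= 0 -> pos_part x = 0.
Proof. by move=> x0; rewrite /pos_part ler0_norm// subrr mul0r. Qed.

Lemma continuous_pos_part : continuous pos_part.
Proof.
move=> x; apply: cvgMl; apply: cvgD; [exact: cvg_id|exact: norm_continuous].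
Qed.

Lemma pos_part_quad x h :
  `|pos_part (x + h) ^+ 2 - pos_part x ^+ 2 - 2 * pos_part x * h| <= h ^+ 2.
Proof.
rewrite ler_norml.
have [x0|x0] := leP 0 x; have [y0|y0] := leP 0 (x + h);
  rewrite ?(pos_part_ge x0) ?(pos_part_le (ltW x0)) ?(pos_part_ge y0) ?(pos_part_le (ltW y0));
  by apply/andP; split; nra.
Qed.

(* A C^1 step from 0 to 1 on [a, a + 2d], as a second difference of (x^+)^2. *)
Definition step a d x : R :=
  (pos_part (x - a) ^+ 2 - 2 * pos_part (x - a - d) ^+ 2
   + pos_part (x - a - 2 * d) ^+ 2) / (2 * d ^+ 2).

Definition dstep a d x : R :=
  (pos_part (x - a) - 2 * pos_part (x - a - d) + pos_part (x - a - 2 * d)) / d ^+ 2.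

Lemma is_derive_step a d x : 0 < d -> is_derive x (1 : R) (step a d) (dstep a d x).
Proof.
move=> d0; apply: (@is_derive_quad _ _ _ (4 / (2 * d ^+ 2))) => h.
have d2 : 0 < 2 * d ^+ 2 by rewrite mulr_gt0// exprn_gt0.
have -> : step a d (x + h) - step a d x - dstep a d x * h =
  ((pos_part (x - a + h) ^+ 2 - pos_part (x - a) ^+ 2 - 2 * pos_part (x - a) * h)
  - 2 * (pos_part (x - a - d + h) ^+ 2 - pos_part (x - a - d) ^+ 2 - 2 * pos_part (x - a - d) * h)
  + (pos_part (x - a - 2 * d + h) ^+ 2 - pos_part (x - a - 2 * d) ^+ 2 - 2 * pos_part (x - a - 2 * d) * h))
  / (2 * d ^+ 2).
  rewrite /step /dstep (_ : x + h - a = x - a + h); last by ring.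
  rewrite (_ : x - a + h - d = x - a - d + h); last by ring.
  rewrite (_ : x - a + h - 2 * d = x - a - 2 * d + h); last by ring.
  by field; rewrite gt_eqF.
rewrite normrM normfV (gtr0_norm d2) [leRHS]mulrAC ler_pM2r ?invr_gt0//.
have := pos_part_quad (x - a) h; have := pos_part_quad (x - a - d) h.
have := pos_part_quad (x - a - 2 * d) h.
set A := _ - _; set B := _ - _; set C := _ - _.
by rewrite !ler_norml => /andP[? ?] /andP[? ?] /andP[? ?]; apply/andP; split; lra.
Qed.

Lemma continuous_dstep a d : continuous (dstep a d).
Proof.
have cp c : continuous (fun x => pos_part (x - c)).
  move=> x; apply: (@continuous_comp _ _ _ (fun x => x - c) pos_part).
    by apply: cvgB; [exact: cvg_id|exact: cvg_cst].
  exact: continuous_pos_part.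
move=> x; apply: cvgMl; apply: cvgD; first apply: cvgB.
- exact: cp.
- apply: cvgMr.
  have -> : (fun y => pos_part (y - a - d)) = (fun y => pos_part (y - (a + d))).
    by apply/funext => y; congr pos_part; ring.
  rewrite (_ : x - a - d = x - (a + d)); [exact: cp|by ring].
- have -> : (fun y => pos_part (y - a - 2 * d)) = (fun y => pos_part (y - (a + 2 * d))).
    by apply/funext => y; congr pos_part; ring.
  rewrite (_ : x - a - 2 * d = x - (a + 2 * d)); [exact: cp|by ring].
Qed.

Lemma step_l a d x : 0 < d -> x <= a -> step a d x = 0 /\ dstep a d x = 0.
Proof.
move=> d0 xa; by rewrite /step /dstep !pos_part_le; lra.
Qed.

Lemma step_r a d x : 0 < d -> a + 2 * d <= x -> step a d x = 1 /\ dstep a d x = 0.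
Proof.
move=> d0 xa; rewrite /step /dstep !pos_part_ge; try lra.
by split; field; rewrite gt_eqF.
Qed.

Lemma step_01 a d x : 0 < d -> 0 <= step a d x <= 1 /\ 0 <= dstep a d x.
Proof.
move=> d0; have d2 : 0 < d ^+ 2 by rewrite exprn_gt0.
have d3 : 0 < 2 * d ^+ 2 by rewrite mulr_gt0.
have [xa|ax] := leP x a.
  by have [-> ->] := step_l d0 xa; rewrite lexx ler01.
have [bx|xb] := leP (a + 2 * d) x.
  by have [-> ->] := step_r d0 bx; rewrite lexx ler01.
rewrite /step /dstep (@pos_part_ge (x - a)); last lra.
rewrite (@pos_part_le (x - a - 2 * d)); last lra.
have [xm|mx] := leP x (a + d).
  rewrite pos_part_le; last lra.
  split; last by apply: divr_ge0; [lra|exact: ltW].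
  by rewrite ler_pdivlMr ?ler_pdivrMr//; apply/andP; split; nra.
rewrite pos_part_ge; last lra.
split; last by apply: divr_ge0; [lra|exact: ltW].
by rewrite ler_pdivlMr ?ler_pdivrMr//; apply/andP; split; nra.
Qed.

(** For [a + 2 * d <= b] this function is a plateau: it equals 1 on [a + 2d, b], and its derivative
    consists of two tents of integral 1 and -1. *)
Lemma test_function_bump l a b d : 0 < d -> 0 < a -> a <= b -> b + 2 * d < l ->
  test_function l (fun x => step a d x - step b d x) /\
  derive1 (fun x => step a d x - step b d x) = (fun x => dstep a d x - dstep b d x).
Proof.
move=> d0 a0 ab bl.
have D x : is_derive x (1 : R) (fun x => step a d x - step b d x) (dstep a d x - dstep b d x).
  by apply: is_deriveB; exact: is_derive_step.
have E : derive1 (fun x => step a d x - step b d x) = (fun x => dstep a d x - dstep b d x).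
  by apply/funext => x; rewrite derive1E; have [] := D x.
split=> //; split; first by move=> x; have [] := D x.
  by rewrite E => x; apply: cvgB; exact: continuous_dstep.
have : closure [set x | step a d x - step b d x != 0] `<=` `[a, b + 2 * d]%classic.
  rewrite [X in _ `<=` X](closure_id _).1; last exact: itv_closed.
  apply: closureS.
  move=> x /=; rewrite in_itv /= => /eqP H; apply/andP; split; rewrite leNgt; apply/negP => xx; apply: H.
    by rewrite (step_l d0 (ltW xx)).1 (step_l d0 (_ : x <= b)).1 ?subrr//; lra.
  by rewrite (step_r d0 (ltW xx)).1 (step_r d0 (_ : a + 2 * d <= x)).1 ?subrr//; lra.
move/subset_trans; apply => x /=; rewrite !in_itv /= => /andP[x1 x2].
by apply/andP; split; lra.
Qed.

End WeakDerivative.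

Section WeakDerivative2.
Variable R : realType.
Local Notation mu := (@lebesgue_measure R).
Implicit Types (a b c d l x y : R) (f g phi : R -> R).

Lemma loc_itg a b l g : 0 < a -> b < l -> locally_integrable `]0, l[%classic g -> itg a b g.
Proof.
move=> a0 bl [mg og kg].
have sub : `[a, b]%classic `<=` (`]0, l[%classic : set R).
  by move=> x; rewrite itv_in /= in_itv /= => /andP[ax xb]; rewrite (lt_le_trans a0 ax) (le_lt_trans xb bl).
apply/integrableP; split.
  by apply/measurable_EFinP; apply: measurable_funS mg.
by apply: kg => //; exact: segment_compact.
Qed.

(** Testing against a plateau gives averages of [f] just to the right of [a] and [b], and the
    integral of [g] up to the two ramps. The endpoints are interior because [g] is only locally
    integrable on the open interval. *)
Lemma weak_deriv_diff l f g : cts 0 l f -> is_weak_deriv_real l f g ->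
  forall a b, 0 < a -> a <= b -> b < l -> f b - f a = itl a b g.
Proof.
move=> cf [lf lg wd] a b a0 ab bl.
pose c := (b + l) / 2.
have bc : b < c by rewrite /c; lra.
have cl : c < l by rewrite /c; lra.
have ig : itg a c g by exact: loc_itg lg.
have ign := itg_norm ig.
have ig1 : itg a b g by apply: itg_sub ig => //; exact: ltW.
have [ba|ab'] := leP b a.
  have -> : b = a by apply/eqP; rewrite eq_le ab ba.
  by rewrite subrr itl_id.
apply/eqP; rewrite -subr_eq0 -normr_le0; apply/ler_addgt0Pr => e e0; rewrite add0r.
have e4 : 0 < e / 4 by rewrite divr_gt0.
have [df df0 hdf] := cts_ucont cf e4.
have near1 x : a <= x -> x < c -> exists2 d, 0 < d & forall y, x <= y -> y - x < d -> itl x y (fun t => `|g t|) < e / 4.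
  move=> ax xc; have ix : itg x c (fun t => `|g t|) by apply: itg_sub ign.
  have [d /= d0 H] := parameterized_integral_near_left xc e4 ix.
  exists d => // y xy yd; apply: le_lt_trans (ler_norm _) _; apply: H => //=.
  by rewrite distrC ger0_norm ?subr_ge0.
have [d1 d10 hd1] := near1 a (lexx _) (le_lt_trans ab bc).
have [d2 d20 hd2] := near1 b ab bc.
(* At distance below [m], [f] varies little, [|g|] has small integral on both ramps, the support
   stays below [c], and the first ramp ends before [b]. *)
pose m := Num.min (Num.min df d1) (Num.min d2 (Num.min (c - b) (b - a))).
have m0 : 0 < m by rewrite !lt_min df0 d10 d20 !subr_gt0 bc.
pose d := m / 4; have d0 : 0 < d by rewrite divr_gt0.
have : 2 * d < m by rewrite /d; clear - m0; lra.
rewrite !lt_min => /andP[/andP[m1 m2] /and3P[m3 m4 m5]].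
have bdc : b + 2 * d < c by clear - m4; lra.
have bdl : b + 2 * d < l by exact: lt_trans bdc cl.
have aad : a <= a + 2 * d by clear - d0; lra.
have adb : a + 2 * d <= b by clear - m5; lra.
have bbd' : b <= b + 2 * d by clear - d0; lra.
have m1' : a + 2 * d - a < d1 by clear - m2; lra.
have m3' : b + 2 * d - b < d2 by clear - m3; lra.
have [tf dE] := test_function_bump d0 a0 ab bdl.
pose phi x := step a d x - step b d x.
have lpos : 0 < l by clear - a0 ab bl; lra.
have := wd _ tf; rewrite dE.
have cT x : continuous (dstep x d) by exact: continuous_dstep.
have iT x : itg 0 l (dstep x d) by apply: cts_itg; exact: ctsT.
have ifT x : itg 0 l (fun t => f t * dstep x d t) by apply: itgM.
have -> : (fun x => f x * (dstep a d x - dstep b d x)) = (fun t => f t * dstep a d t - f t * dstep b d t).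
  by apply/funext => t; ring.
have iff : itg 0 l (fun t => f t * dstep a d t - f t * dstep b d t) by exact: itgB.
rewrite (Rint_oo iff) (itlB (ifT a) (ifT b)).
(* [dstep x d] is nonnegative with integral 1 and vanishes outside [x, x + 2d], so this is an
   average of [f] near [x]. *)
have tent x : 0 < x -> x + 2 * d < l -> `|itl 0 l (fun t => f t * dstep x d t) - f x| <= e / 4.
  move=> x0 xl.
  have T1 : itl 0 l (dstep x d) = 1.
    rewrite -(C1_itl (ltW lpos) (fun t => is_derive_step x t d0) (cT x)).
    by rewrite (step_r d0 (ltW xl)).1 (step_l d0 (ltW x0)).1 subr0.
  have -> : f x = itl 0 l (fun t => f x * dstep x d t) by rewrite itlZ// T1 mulr1.
  rewrite -itlB//; last exact: itgZ.
  have iD : itg 0 l (fun t => f t * dstep x d t - f x * dstep x d t) by apply: itgB => //; exact: itgZ.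
  apply: (le_trans (itl_norm iD)).
  have -> : e / 4 = itl 0 l (fun t => e / 4 * dstep x d t) by rewrite itlZ// T1 mulr1.
  apply: itl_le; [exact: itg_norm|exact: itgZ|].
  move=> t tl; rewrite -mulrBl normrM (ger0_norm (step_01 x t d0).2).
  have [tx|xt] := leP t x; first by rewrite (step_l d0 tx).2 !mulr0.
  have [tx|tx] := leP (x + 2 * d) t; first by rewrite (step_r d0 tx).2 !mulr0.
  apply: ler_wpM2r; first exact: (step_01 x t d0).2.
  have tx' : t - x < df by clear - tx m1; lra.
  apply/ltW/hdf => //; first by rewrite (ltW x0)/=; clear - xl d0; lra.
  by rewrite gtr0_norm// subr_gt0.
have tA := tent a a0 (le_lt_trans adb bl).
have tB := tent b (lt_le_trans a0 ab) bdl.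
have cphi : cts a c phi.
  apply: ctsD; first by apply: ctsT => t; apply: differentiable_continuous; apply/derivable1_diffP; have [] := is_derive_step a t d0.
  apply: (@cts_comp _ _ _ (fun z => - z)); first exact: opp_continuous.
  by apply: ctsT => t; apply: differentiable_continuous; apply/derivable1_diffP; have [] := is_derive_step b t d0.
have igphi : itg a c (fun t => g t * phi t).
  by apply: (eq_itg (f := fun t => phi t * g t)) => [t _|]; [ring|exact: itgM].
(* The test function vanishes outside [a, c], where [g] is known to be integrable. *)
have -> : \int[mu]_(x in `]0, l[) (g x * (step a d x - step b d x)) = itl a c (fun t => g t * phi t).
  rewrite /itl -[X in _ = Rintegral _ X _](_ : `]0, l[%classic `&` `[a, c]%classic = _); last first.
    apply/setIidr => x; rewrite itv_in /= in_itv /= => /andP[x1 x2].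
    by rewrite (lt_le_trans a0 x1) (le_lt_trans x2 cl).
  rewrite Rintegral_mkcondr; apply: eq_Rintegral => x _; rewrite patchE.
  case: ifPn => // /negP xac; rewrite (_ : step a d x - step b d x = 0) ?mulr0//.
  have [xa|ax] := leP x a.
    by rewrite (step_l d0 xa).1 (step_l d0 (le_trans xa ab)).1 subrr.
  have [cx|xc] := leP c x.
    have cx' : b + 2 * d <= x by rewrite (le_trans _ cx)// ltW.
    by rewrite (step_r d0 (le_trans adb (le_trans bbd' cx'))).1 (step_r d0 cx').1 subrr.
  by exfalso; apply: xac; rewrite inE itv_in (ltW ax) (ltW xc).
have bc' : a <= b <= c by rewrite ab ltW.
rewrite (itl_split bc' igphi).
have iphib : itg a b (fun t => g t * phi t) by apply: itg_sub igphi => //; exact: ltW.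
have iphic : itg b c (fun t => g t * phi t) by apply: itg_sub igphi.
have igm1 : itg a b (fun t => g t * phi t - g t) by exact: itgB.
have abd : a <= a + 2 * d <= b by rewrite aad.
have E1 : itl a b (fun t => g t * phi t) - itl a b g = itl a (a + 2 * d) (fun t => g t * phi t - g t).
  rewrite -itlB// (itl_split abd igm1) [X in _ + X](_ : _ = 0) ?addr0//.
  rewrite (eq_itl (g := fun=> 0)).
    by rewrite itl_cst ?mul0r// ltW.
  move=> t /andP[t1 t2]; rewrite /phi (step_r d0 t1).1 (step_l d0 t2).1; ring.
have bbd : b <= b + 2 * d <= c by rewrite bbd' ltW.
have E2 : itl b c (fun t => g t * phi t) = itl b (b + 2 * d) (fun t => g t * phi t).
  rewrite (itl_split bbd iphic) [X in _ + X](_ : _ = 0) ?addr0//.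
  rewrite (eq_itl (g := fun=> 0)).
    by rewrite itl_cst ?mul0r// ltW.
  move=> t /andP[t1 t2]; have at_ : a + 2 * d <= t by rewrite (le_trans adb)// (le_trans bbd').
  by rewrite /phi (step_r d0 t1).1 (step_r d0 at_).1 subrr mulr0.
have N1 : `|itl a (a + 2 * d) (fun t => g t * phi t - g t)| <= e / 4.
  have i1 : itg a (a + 2 * d) (fun t => g t * phi t - g t) by apply: itg_sub igm1.
  apply: (le_trans (itl_norm i1)); apply: ltW; apply: le_lt_trans (hd1 (a + 2 * d) aad m1').
  apply: itl_le; [exact: itg_norm|by apply: itg_sub ign => //; rewrite (le_trans adb)// ltW|].
  move=> t /andP[t1 t2]; rewrite -{2}[g t]mulr1 -mulrBr normrM ler_piMr//.
  have [/andP[s1 s2] _] := step_01 a t d0.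
  rewrite /phi (step_l d0 (le_trans t2 adb)).1 ler_norml.
  by clear - s1 s2; apply/andP; split; lra.
have N2 : `|itl b (b + 2 * d) (fun t => g t * phi t)| <= e / 4.
  have i1 : itg b (b + 2 * d) (fun t => g t * phi t) by apply: itg_sub iphic => //; exact: ltW.
  apply: (le_trans (itl_norm i1)); apply: ltW; apply: le_lt_trans (hd2 (b + 2 * d) bbd' m3').
  apply: itl_le; [exact: itg_norm|by apply: itg_sub ign => //; exact: ltW|].
  move=> t /andP[t1 t2]; rewrite normrM ler_piMr//.
  have [/andP[s1 s2] _] := step_01 a t d0; have [/andP[s3 s4] _] := step_01 b t d0.
  by rewrite /phi ler_norml; clear - s1 s2 s3 s4; apply/andP; split; lra.
rewrite E2 => main.
have -> : f b - f a - itl a b g =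
   (itl 0 l (fun t => f t * dstep a d t) - f a) - (itl 0 l (fun t => f t * dstep b d t) - f b)
   + (itl a (a + 2 * d) (fun t => g t * phi t - g t)) + itl b (b + 2 * d) (fun t => g t * phi t).
  by rewrite -E1; clear - main; lra.
clear - tA tB N1 N2; move: tA tB N1 N2; rewrite !ler_norml => /andP[? ?] /andP[? ?] /andP[? ?] /andP[? ?].
by apply/andP; split; lra.
Qed.

(** The product rule [derM] for [f * phi], which vanishes at both ends. *)
Lemma der_weak_deriv l f h : 0 < l -> der l f h -> is_weak_deriv_real l f h.
Proof.
move=> l0 fh; have cf := der_cts fh.
have sub : (`]0, l[%classic : set R) `<=` `[0, l]%classic by exact: subset_itv_oo_cc.
have Iof u : itg 0 l u -> locally_integrable `]0, l[%classic u.
  move=> iu; apply: open_integrable_locally; first exact: interval_open.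
  exact: integrableS iu.
have ih := L2_itg fh.1.
split; [by apply: Iof; exact: cts_itg|exact: Iof|].
move=> phi [dphi cphi sphi].
have phi_out x : ~ (0 < x < l) -> phi x = 0.
  move=> xo; apply/eqP/negPn/negP => phx; apply: xo.
  by have := sphi x (@subset_closure _ [set x | phi x != 0] x phx); rewrite /= in_itv.
have dp : der l phi (derive1 phi).
  apply: C1_der => // x; have := derivableP (dphi x); rewrite derive1E //.
have := (derM (ltW l0) fh dp).2 0 l (lexx _) (ltW l0) (lexx _).
rewrite (phi_out l) ?ltxx ?andbF// (phi_out 0) ?ltxx// !mulr0 subrr.
have i1 : itg 0 l (fun x => f x * derive1 phi x) by apply: itgM => //; apply: cts_itg; exact: ctsT.
have i2 : itg 0 l (fun x => phi x * h x) by apply: itgM => //; exact: der_cts dp.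
have i3 : itg 0 l (fun x => h x * phi x) by apply: eq_itg i2 => x _; rewrite mulrC.
rewrite itlD// !Rint_oo//.
rewrite (eq_itl (g := fun x => h x * phi x) (f := fun x => phi x * h x)); last by move=> x _; rewrite mulrC.
by move=> H; apply/eqP; rewrite -addr_eq0 -H.
Qed.

(** Lebesgue differentiation of the primitive of [k] extended by 0, which vanishes identically. *)
Lemma ae_eq0_itl a b k : a < b -> itg a b k ->
  (forall x, a <= x <= b -> itl a x k = 0) ->
  {ae mu, forall x, a <= x <= b -> k x = 0}.
Proof.
move=> ab ik Hk; pose K : R -> R := k \_ `[a, b].
have iK : mu.-integrable setT (EFin \o K).
  by rewrite /K -restrict_EFin; apply/integrable_restrict => //=; rewrite setTI.
have locK : locally_integrable setT K by apply: open_integrable_locally => //; exact: openT.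
have iKy y : mu.-integrable `]-oo, y]%classic (EFin \o K) by exact: integrableS iK.
have F0 y : \int[mu]_(t in `]-oo, y]%classic) K t = 0.
  rewrite /K -Rintegral_mkcondr.
  have [ya|ay] := ltP y a.
    rewrite (_ : _ `&` _ = set0) ?Rintegral_set0//; apply/seteqP; split => // t [] /=.
    rewrite !in_itv /= => ty /andP[at_ _]; move: (le_trans at_ ty); by rewrite leNgt ya.
  have [yb|by_] := leP y b.
    rewrite (_ : _ `&` _ = `[a, y]%classic); first by apply: Hk; rewrite ay.
    apply/seteqP; split => t /=; rewrite !in_itv /=; first by move=> [-> /andP[->]].
    by move=> /andP[-> ty]; rewrite ty (le_trans ty).
  rewrite (_ : _ `&` _ = `[a, b]%classic); first by apply: Hk; rewrite lexx ltW.
  apply/seteqP; split => t /=; rewrite !in_itv /=; first by move=> [].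
  by move=> /andP[-> tb]; rewrite tb (le_trans tb (ltW by_)).
have := FTC1Ny iKy locK; apply: ae_imp => x [_ + xab].
rewrite (_ : (fun y => _) = cst 0); last by apply/funext => y; exact: F0.
rewrite derive1_cst /K patchE mem_set//; by rewrite /= in_itv.
Qed.

(** On compact subintervals both derivatives have the same integrals, so they agree almost
    everywhere there; countably many of these exhaust ]0, l[. *)
Lemma weak_deriv_ae l f g h : 0 < l -> der l f h -> is_weak_deriv_real l f g ->
  {ae mu, forall x, 0 < x < l -> g x = h x}.
Proof.
move=> l0 fh wg; have cf := der_cts fh.
(* Denominators from 3 on ensure [A n < B n]. *)
pose A n : R := l / n.+3%:R; pose B n : R := l - A n.
have A0 n : 0 < A n by rewrite divr_gt0.
have AB n : A n < B n.
  have : A n * n.+3%:R = l by rewrite /A divfK.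
  have : (3 : R) <= n.+3%:R by rewrite ler_nat.
  by have := A0 n; rewrite /B; nra.
have Bl n : B n < l by rewrite /B ltrBlDr ltrDl.
have H n : {ae mu, forall x, A n <= x <= B n -> g x - h x = 0}.
  have ig : itg (A n) (B n) g by apply: (loc_itg (l := l)) => //; case: wg.
  have ih : itg (A n) (B n) h by apply: itg_sub (L2_itg fh.1) => //; exact: ltW.
  apply: ae_eq0_itl => //; first exact: itgB.
  move=> x /andP[Ax xB]; rewrite itlB; [|exact: itg_sub ig|exact: itg_sub ih].
  rewrite -(weak_deriv_diff cf wg)// ?(le_lt_trans xB)//.
  by rewrite -fh.2 ?subrr// ?(le_trans xB)// ltW.
have : {ae mu, forall x n, A n <= x <= B n -> g x - h x = 0} by apply: ae_foralln.
apply: ae_imp => x Hx /andP[x0 xl].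
pose m := Num.min x (l - x); have m0 : 0 < m by rewrite lt_min x0 subr_gt0.
have [n hn] : exists n, A n < m.
  exists (Num.trunc (l / m)); rewrite /A ltr_pdivrMr// mulrC -ltr_pdivrMr//.
  by apply: (lt_trans (truncnS_gt _)); rewrite ltr_nat.
move: hn; rewrite lt_min => /andP[h1 h2].
by apply/eqP; rewrite -subr_eq0; apply/eqP/(Hx n)/andP; split; [exact: ltW|rewrite /B; lra].
Qed.

End WeakDerivative2.

(** * Sums over the edges *)

Section Sums.
Variables (R : realType) (T : choiceType).
Implicit Types (a b : T -> R) (s : seq T) (C : R).

(** Real-valued sums as suprema over duplicate-free finite sequences, meant for nonnegative
    families; [smb] says that the sum is finite, and [esum_tsum] makes the link with the extended
    real sum. *)
Definition smb a := exists C, forall s, uniq s -> \sum_(e <- s) a e <= C.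
Definition fsums a : set R := [set x | exists2 s, uniq s & x = \sum_(e <- s) a e].
Definition tsum a : R := sup (fsums a).

Lemma fsums_sup a : smb a -> has_sup (fsums a).
Proof.
move=> [C HC]; split; first by exists 0, [::]; rewrite ?big_nil.
by exists C => _ [s us ->]; exact: HC.
Qed.

Lemma tsum_ge a s : smb a -> uniq s -> \sum_(e <- s) a e <= tsum a.
Proof. by move=> sa us; apply: ub_le_sup; [have [] := fsums_sup sa|exists s]. Qed.

Lemma tsum_ge1 a e : smb a -> a e <= tsum a.
Proof. by move=> sa; have := @tsum_ge a [:: e] sa isT; rewrite big_seq1. Qed.

Lemma tsum_le a C : (forall s, uniq s -> \sum_(e <- s) a e <= C) -> tsum a <= C.
Proof.
move=> HC; apply: ge_sup; first by exists 0, [::]; rewrite ?big_nil.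
by move=> _ [s us ->]; exact: HC.
Qed.

Lemma tsum_approx a eps : smb a -> 0 < eps ->
  exists2 s, uniq s & tsum a - eps < \sum_(e <- s) a e.
Proof.
by move=> sa e0; have [_ [s us ->] h] := sup_adherent e0 (fsums_sup sa); exists s.
Qed.

Lemma tsum_ge0 a : smb a -> 0 <= tsum a.
Proof. by move=> sa; have := @tsum_ge a [::] sa isT; rewrite big_nil. Qed.

Lemma smb_le a b : (forall e, a e <= b e) -> smb b -> smb a.
Proof. by move=> ab [C HC]; exists C => s us; apply: le_trans (HC s us); exact: ler_sum. Qed.

Lemma tsum_mono a b : (forall e, a e <= b e) -> smb b -> tsum a <= tsum b.
Proof.
move=> ab sb; apply: tsum_le => s us; apply: le_trans (tsum_ge sb us).
exact: ler_sum.
Qed.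

Lemma eq_tsum a b : (forall e, a e = b e) -> tsum a = tsum b.
Proof. by move=> ab; congr tsum; apply/funext. Qed.

Lemma smbZ c a : 0 <= c -> smb a -> smb (fun e => c * a e).
Proof. by move=> c0 [C HC]; exists (c * C) => s us; rewrite -mulr_sumr ler_wpM2l// HC. Qed.

Lemma tsumZ c a : 0 <= c -> smb a -> tsum (fun e => c * a e) = c * tsum a.
Proof.
move=> c0 sa; apply/eqP; rewrite eq_le; apply/andP; split.
  by apply: tsum_le => s us; rewrite -mulr_sumr ler_wpM2l// tsum_ge.
have [->|cn0] := eqVneq c 0.
  rewrite mul0r; apply: tsum_ge0; exists 0 => s _; rewrite big1// => i _; exact: mul0r.
have {cn0}cp : 0 < c by rewrite lt_neqAle eq_sym cn0.
rewrite mulrC -ler_pdivlMr//; apply: tsum_le => s us; rewrite ler_pdivlMr// mulrC mulr_sumr.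
by apply: tsum_ge => //; exact: smbZ.
Qed.

Lemma smbD a b : smb a -> smb b -> smb (fun e => a e + b e).
Proof.
by move=> [C HC] [D HD]; exists (C + D) => s us; rewrite big_split lerD ?HC ?HD.
Qed.

Lemma sub_sum a s t : (forall e, 0 <= a e) -> uniq s -> uniq t -> {subset s <= t} ->
  \sum_(e <- s) a e <= \sum_(e <- t) a e.
Proof.
move=> a0 us ut st; rewrite [leRHS](bigID (mem s))/=.
have -> : \sum_(e <- t | e \in s) a e = \sum_(e <- s) a e.
  rewrite -big_filter; apply: perm_big; apply: uniq_perm => //; first exact: filter_uniq.
  by move=> e; rewrite mem_filter; case: (boolP (e \in s)) => // /st ->.
by rewrite lerDl sumr_ge0.
Qed.

Lemma tsumD a b : (forall e, 0 <= a e) -> (forall e, 0 <= b e) -> smb a -> smb b ->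
  tsum (fun e => a e + b e) = tsum a + tsum b.
Proof.
move=> a0 b0 sa sb; apply/eqP; rewrite eq_le; apply/andP; split.
  by apply: tsum_le => s us; rewrite big_split lerD ?tsum_ge.
apply/ler_addgt0Pr => e e0; have e2 : 0 < e / 2 by rewrite divr_gt0.
have [s us hs] := tsum_approx sa e2; have [t ut ht] := tsum_approx sb e2.
have := tsum_ge (smbD sa sb) (undup_uniq (s ++ t)); rewrite big_split /=.
have h1 := sub_sum a0 us (undup_uniq (s ++ t)) _.
have h2 := sub_sum b0 ut (undup_uniq (s ++ t)) _.
have {}h1 : \sum_(e <- s) a e <= \sum_(e <- undup (s ++ t)) a e.
  by apply: h1 => x xs; rewrite mem_undup mem_cat xs.
have {}h2 : \sum_(e <- t) b e <= \sum_(e <- undup (s ++ t)) b e.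
  by apply: h2 => x xs; rewrite mem_undup mem_cat xs orbT.
by lra.
Qed.

Lemma tsum_inj (phi : T -> T) a : injective phi -> smb a -> smb (a \o phi) /\ tsum (a \o phi) <= tsum a.
Proof.
move=> inj sa; have H s : uniq s -> \sum_(e <- s) (a \o phi) e <= tsum a.
  move=> us; rewrite -(big_map phi predT a); apply: tsum_ge => //.
  by rewrite map_inj_uniq.
by split; [exists (tsum a)|exact: tsum_le].
Qed.

Lemma tsum_bij (phi psi : T -> T) a : cancel phi psi -> cancel psi phi -> smb a ->
  smb (a \o phi) /\ tsum (a \o phi) = tsum a.
Proof.
move=> k1 k2 sa; have [s1 l1] := tsum_inj (can_inj k1) sa; split=> //.
apply/eqP; rewrite eq_le l1 /=.
have [_] := tsum_inj (can_inj k2) s1; congr (_ <= _); congr tsum; apply/funext => x /=.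
by rewrite k2.
Qed.

Lemma tsum_supp a s : (forall x, 0 <= a x) ->
  uniq s -> (forall x, x \notin s -> a x = 0) -> smb a /\ tsum a <= \sum_(x <- s) a x.
Proof.
move=> a0 us as0; have H t : uniq t -> \sum_(x <- t) a x <= \sum_(x <- s) a x.
  move=> ut; rewrite (bigID (mem s))/= [X in _ + X]big1 ?addr0 => [|x xs]; last exact: as0.
  rewrite -big_filter; apply: sub_sum => //; first exact: filter_uniq.
  by move=> x; rewrite mem_filter => /andP[].
by split; [exists (\sum_(x <- s) a x)|exact: tsum_le].
Qed.

Lemma esum_tsum a : (forall e, 0 <= a e) -> smb a ->
  (\esum_(e in [set: T]) (a e)%:E = (tsum a)%:E)%E.
Proof.
move=> a0 sa; apply/eqP; rewrite eq_le; apply/andP; split.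
  apply: ge_ereal_sup => _ [A [fA _] <-]; rewrite fsbig_finite//= sumEFin lee_fin.
  by apply: tsum_ge => //; exact: fset_uniq.
apply/lee_addgt0Pr => e e0; have [s us hs] := tsum_approx sa e0.
apply: (@le_trans _ _ ((\sum_(i <- s) a i)%:E + e%:E)%E).
  by rewrite -EFinD lee_fin; lra.
rewrite leeD2r// -sumEFin fsbig_seq//; apply: esum_ge.
by exists [set` s].
Qed.

Lemma esum_lty_smb (b : T -> \bar R) : (forall e, 0 <= b e)%E ->
  (\esum_(e in [set: T]) b e < +oo)%E ->
  (forall e, b e \is a fin_num) /\ smb (fun e => fine (b e)).
Proof.
move=> b0 bfin.
have fn e : b e \is a fin_num.
  rewrite ge0_fin_numE//; apply: le_lt_trans bfin; apply: esum_ge.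
  by exists [set e]; rewrite ?fsbig_set1.
split=> //; exists (fine (\esum_(e in [set: T]) b e)%E) => s us.
rewrite -lee_fin fineK; last by rewrite ge0_fin_numE// esum_ge0.
apply: esum_ge; exists [set` s] => //.
rewrite -fsbig_seq// -sumEFin; apply: lee_sum => i _; by rewrite fineK.
Qed.

End Sums.

(** * Nonnegative functions on the honeycomb *)

Section Bridge.
Variables (R : realType) (l : R).
Local Notation mu := (@lebesgue_measure R).
Hypothesis l0 : 0 < l.
Implicit Types (f h : hedge -> R -> R) (u : gfun R).

(** How |u| obtains its derivative, with [r] = |u'|^2: the hypothesis bounds the grid energy cell by
    cell, and the cells add up to the integral of [r]. *)
Lemma riesz_upper (f r : R -> R) : itg 0 l r -> (forall x, 0 <= r x) ->
  (forall a b, 0 <= a -> a <= b -> b <= l -> (f b - f a) ^+ 2 <= (b - a) * itl a b r) ->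
  exists h : R -> R, der l f h /\ itl 0 l (fun x => h x ^+ 2) <= itl 0 l r.
Proof.
move=> ir r0 H; apply: riesz_criterion => //.
  apply: ucont_cts; apply: (@sqr_int_ucont _ _ _ (itl 0 l r)); first exact: itl_ge0.
  move=> x y x0 xy yl; apply: (le_trans (H _ _ x0 xy yl)).
  by rewrite ler_wpM2l ?subr_ge0//; apply: itl_mono.
move=> N; set n := (2 ^ N)%N; have n0 : (0 < n)%N by rewrite expn_gt0.
rewrite /grid_energy -[in leRHS](gpn l n0).
suff S j : (j <= n)%N -> \sum_(i < j) (f (gp l n i.+1) - f (gp l n i)) ^+ 2 / (l / n%:R) <= itl 0 (gp l n j) r.
  exact: S.
elim: j => [|j IH] jn; first by rewrite big_ord0 gp0 itl_id.
have m0 := mesh_gt0 l0 n0.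
have jl := gp_lel l0 n0 jn.
have sp : 0 <= gp l n j <= gp l n j.+1 by rewrite gp_ge0//= gp_le.
rewrite big_ord_recr /= (itl_split sp); last exact: itg_sub ir.
apply: lerD; first by apply: IH; exact: ltnW.
rewrite ler_pdivrMr// mulrC -(gpS l n j); apply: H => //; first exact: gp_ge0.
by apply: gp_le.
Qed.

Definition sqn f (e : hedge) : R := itl 0 l (fun x => f e x ^+ 2).
Definition pwn (p : R) f (e : hedge) : R := itl 0 l (fun x => f e x `^ p).

(* Since [|u|] has at most the energy of [u], the analysis takes place on nonnegative functions [f];
   [h] is the derivative of [f] through [f y - f x = itl x y h], not through test functions. *)
Definition adm f h : Prop :=
  [/\ forall e, der l (f e) (h e), forall e x, 0 <= x <= l -> 0 <= f e x,
      exists v : hvertex -> R, forall e, f e 0 = v (htail e) /\ f e l = v (hhead e),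
      smb (sqn f) & smb (sqn h)].

Definition renergy (p : R) f h : R := 2^-1 * tsum (sqn h) - p^-1 * tsum (pwn p f).

Lemma sqn_ge0 f e : 0 <= sqn f e.
Proof. by apply: itl_ge0 => x _; exact: sqr_ge0. Qed.

Lemma pwn_ge0 p f e : 0 <= pwn p f e.
Proof. by apply: itl_ge0 => x _; exact: powR_ge0. Qed.

(** [f x ^+ 2 <= 2 * f y ^+ 2 + 2 * (f x - f y) ^+ 2], with the last square bounded by the Dirichlet
    integral, averaged over [y]. *)
Lemma der_sup (f h : R -> R) x : der l f h -> 0 <= x <= l ->
  f x ^+ 2 <= 2 / l * itl 0 l (fun x => f x ^+ 2) + 2 * l * itl 0 l (fun x => h x ^+ 2).
Proof.
move=> fh /andP[x0 xl]; set D := itl 0 l (fun x => h x ^+ 2).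
have D0 : 0 <= D by apply: itl_ge0 => t _; exact: sqr_ge0.
have cf := der_cts fh.
have i2 : itg 0 l (fun x => f x ^+ 2) by apply: cts_itg; exact: ctsX.
have key y : 0 <= y <= l -> f x ^+ 2 <= 2 * f y ^+ 2 + 2 * l * D.
  move=> /andP[y0 yl].
  have d : (f x - f y) ^+ 2 <= l * D.
    have [xy|yx] := leP x y.
      have := der_sqr fh x0 xy yl; rewrite -/D => H.
      have -> : (f x - f y) ^+ 2 = (f y - f x) ^+ 2 by ring.
      apply: (le_trans H); apply: ler_wpM2r => //; clear - x0 yl; lra.
    have := der_sqr fh y0 (ltW yx) xl; rewrite -/D => H.
    apply: (le_trans H); apply: ler_wpM2r => //; clear - y0 xl; lra.
  have := sqr_ge0 (f x - 2 * f y); clear - d; nra.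
have ic : itg 0 l (fun=> 2 * l * D) by apply: cts_itg; exact: cts_cst.
have ix : itg 0 l (fun=> f x ^+ 2) by apply: cts_itg; exact: cts_cst.
have i3 : itg 0 l (fun y => 2 * f y ^+ 2) by exact: itgZ.
have iR : itg 0 l (fun y => 2 * f y ^+ 2 + 2 * l * D) by exact: itgD.
have := itl_le ix iR key.
rewrite (itlD i3 ic) (itlZ _ i2) !itl_cst ?(ltW l0)// subr0.
move=> H; rewrite -(ler_pM2r l0); apply: (le_trans H).
by rewrite le_eqVlt; apply/orP; left; apply/eqP; field; rewrite gt_eqF.
Qed.

Lemma adm_bounded f h : adm f h -> exists2 B, 0 < B & forall e x, 0 <= x <= l -> f e x <= B.
Proof.
move=> [fh f0 _ sf sh].
exists (1 + (2 / l * tsum (sqn f) + 2 * l * tsum (sqn h))).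
  by rewrite ltr_wpDr// addr_ge0// mulr_ge0 ?tsum_ge0 ?divr_ge0 ?mulr_ge0// ltW.
move=> e x xl; have := der_sup (fh e) xl.
have := tsum_ge1 e sf; have := tsum_ge1 e sh; rewrite -/(sqn f e) -/(sqn h e) => h1 h2 h3.
have l2 : 0 <= 2 / l by rewrite divr_ge0// ltW.
have h4 := ler_wpM2l l2 h2; have l3 : 0 <= 2 * l by rewrite mulr_ge0// ltW.
have h5 := ler_wpM2l l3 h1; have fx := f0 e x xl.
have : f e x ^+ 2 <= 2 / l * tsum (sqn f) + 2 * l * tsum (sqn h) by apply: (le_trans h3); exact: lerD.
by set S := _ + _; clear - fx; nra.
Qed.

Lemma adm_cts f h e : adm f h -> cts 0 l (f e).
Proof. by case=> fh _ _ _ _; exact: der_cts (fh e). Qed.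

Lemma adm_der f h : adm f h -> forall e, der l (f e) (h e).
Proof. by case. Qed.

Lemma adm_ge0 f h : adm f h -> forall e x, 0 <= x <= l -> 0 <= f e x.
Proof. by case. Qed.

Lemma adm_vertex f h : adm f h ->
  exists v : hvertex -> R, forall e, f e 0 = v (htail e) /\ f e l = v (hhead e).
Proof. by case. Qed.

Lemma adm_mass f h : adm f h -> smb (sqn f).
Proof. by case. Qed.

Lemma adm_dirichlet f h : adm f h -> smb (sqn h).
Proof. by case. Qed.

Lemma cts_lip a b (f phi : R -> R) L : cts a b f ->
  (forall x y, a <= x <= b -> a <= y <= b -> `|phi (f x) - phi (f y)| <= L * `|f x - f y|) ->
  cts a b (fun x => phi (f x)).
Proof.
move=> cf H; apply: ucont_cts => e e0.
have L0 : 0 < `|L| + 1 by rewrite ltr_wpDl.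
have [d d0 hd] := cts_ucont cf (divr_gt0 e0 L0); exists d => // x y xb yb xy.
apply: (le_lt_trans (H _ _ xb yb)); have := hd _ _ xb yb xy; rewrite ltr_pdivlMr//.
have := ler_norm L; have := normr_ge0 (f x - f y).
by clear; nra.
Qed.

(** With [r = s / t] in [0, 1] and [p <= 6]: 1 - r^p <= 1 - r^6 <= 6 (1 - r). The constant 6 thus
    serves for all exponents under consideration. *)
Lemma powR_lip (p B s t : R) : 1 <= p <= 6 -> 0 <= s -> s <= t -> t <= B ->
  0 <= t `^ p - s `^ p <= 6 * B `^ (p - 1) * (t - s).
Proof.
move=> /andP[p1 p6] s0 st tB; have p0 : 0 < p by clear -p1; lra.
have t0 := le_trans s0 st; have B0 := le_trans t0 tB.
have [tz|tn] := eqVneq t 0.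
  have sz : s = 0 by apply/eqP; rewrite eq_le s0 -tz st.
  by rewrite tz sz !subrr mulr0 lexx.
have {tn}tp : 0 < t by rewrite lt_neqAle eq_sym tn.
rewrite subr_ge0 ge0_ler_powR ?nnegrE//=; last exact: ltW.
pose r := s / t; have rs : s = r * t by rewrite /r divfK// gt_eqF.
have r0 : 0 <= r by rewrite divr_ge0.
have r1 : r <= 1 by rewrite ler_pdivrMr// mul1r.
have rp : r ^+ 6 <= r `^ p.
  have [->|rn] := eqVneq r 0; first by rewrite expr0n /= powR_ge0.
  rewrite -powR_mulrn//; apply: ger_powR => //.
  by rewrite r1 andbT lt_neqAle eq_sym rn.
rewrite rs powRM//.
have tE : t `^ p = t * t `^ (p - 1) by rewrite mulr_powRB1.
have tB1 : t `^ (p - 1) <= B `^ (p - 1).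
  by apply: ge0_ler_powR; rewrite ?nnegrE//; clear -p1; lra.
have tb0 := powR_ge0 t (p - 1).
have -> : t `^ p - r `^ p * t `^ p = (1 - r `^ p) * t `^ p by ring.
rewrite tE; have b6 : 1 - r `^ p <= 6 * (1 - r).
  have : 1 - r ^+ 6 <= 6 * (1 - r).
    have -> : 1 - r ^+ 6 = (1 - r) * (1 + r + r ^+ 2 + r ^+ 3 + r ^+ 4 + r ^+ 5) by ring.
    rewrite mulrC ler_wpM2r ?subr_ge0//.
    have e n : r ^+ n <= 1 by rewrite exprn_ile1.
    by have := e 2%N; have := e 3%N; have := e 4%N; have := e 5%N; clear -r1; lra.
  by clear -rp; lra.
apply: (@le_trans _ _ (6 * (1 - r) * (t * t `^ (p - 1)))).
  by apply: ler_wpM2r => //; exact: mulr_ge0.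
have -> : 6 * (1 - r) * (t * t `^ (p - 1)) = 6 * (t `^ (p - 1)) * (t - r * t) by ring.
apply: ler_wpM2r; first by rewrite -rs subr_ge0.
by rewrite ler_pM2l.
Qed.

Lemma powR_lipN (p B s t : R) : 1 <= p <= 6 -> 0 <= s <= B -> 0 <= t <= B ->
  `|t `^ p - s `^ p| <= 6 * B `^ (p - 1) * `|t - s|.
Proof.
move=> p16 /andP[s0 sB] /andP[t0 tB]; have [st|ts] := leP s t.
  have /andP[h1 h2] := powR_lip p16 s0 st tB.
  by rewrite ger0_norm// [`|t - s|]ger0_norm// subr_ge0.
have /andP[h1 h2] := powR_lip p16 t0 (ltW ts) sB.
by rewrite distrC [`|t - s|]distrC ger0_norm// [`|s - t|]ger0_norm// subr_ge0 ltW.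
Qed.

Lemma cts_powR p f h e : 1 <= p <= 6 -> adm f h -> cts 0 l (fun x => f e x `^ p).
Proof.
move=> p16 fh; have [B B0 hB] := adm_bounded fh.
apply: (@cts_lip 0 l (f e) (fun t => t `^ p) (6 * B `^ (p - 1))); first exact: adm_cts fh.
case: fh => _ f0 _ _ _; move=> x y xl yl; apply: powR_lipN => //.
  by rewrite f0//= hB.
by rewrite f0//= hB.
Qed.

Lemma pwn_le p f h B : 2 < p <= 6 -> adm f h -> (forall e x, 0 <= x <= l -> f e x <= B) ->
  forall e, pwn p f e <= B `^ (p - 2) * sqn f e.
Proof.
move=> /andP[p2 p6] fh hB e; have cf := adm_cts (e := e) fh.
have p16 : 1 <= p <= 6 by rewrite p6 andbT; clear -p2; lra.
rewrite /pwn /sqn -itlZ; last by apply: cts_itg; exact: ctsX.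
apply: itl_le; [by apply: cts_itg; apply: cts_powR fh|by apply: itgZ; apply: cts_itg; exact: ctsX|].
move=> x xl; case: fh => _ f0 _ _ _; have fx := f0 e x xl.
have -> : f e x `^ p = f e x `^ (p - 2) * f e x ^+ 2.
  rewrite -powR_mulrn// -powRD ?subrK//; apply/implyP => /eqP; clear -p2; lra.
apply: ler_wpM2r; first exact: sqr_ge0.
apply: ge0_ler_powR; rewrite ?nnegrE ?hB//; first by clear -p2; lra.
by rewrite (le_trans fx)// hB.
Qed.

Lemma adm_smb_pwn p f h : 2 < p <= 6 -> adm f h -> smb (pwn p f).
Proof.
move=> hp fh; have [B B0 hB] := adm_bounded fh.
apply: (@smb_le _ _ _ _ (pwn_le hp fh hB)).
by apply: smbZ; [exact: powR_ge0|case: fh].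
Qed.

End Bridge.

(** * Reduction of complex-valued functions to their moduli *)

Section Bridge2.
Variables (R : realType) (l : R).
Local Notation mu := (@lebesgue_measure R).
Local Notation normc := ComplexField.Normc.normc.
Local Notation Re := complex.Re.
Local Notation Im := complex.Im.
Hypothesis l0 : 0 < l.
Implicit Types (f h : hedge -> R -> R) (u : gfun R).

Lemma normc_sqr (z : R[i]) : normc z ^+ 2 = Re z ^+ 2 + Im z ^+ 2.
Proof. by case: z => a b /=; rewrite sqr_sqrtr// addr_ge0 ?sqr_ge0. Qed.

Lemma normc_ge0 (z : R[i]) : 0 <= normc z.
Proof. by case: z => a b /=; exact: sqrtr_ge0. Qed.

(** The reverse triangle inequality, which reduces to Cauchy-Schwarz in the plane; that in turn is
    Lagrange's identity. *)
Lemma normc_dist (z w : R[i]) :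
  (normc z - normc w) ^+ 2 <= (Re z - Re w) ^+ 2 + (Im z - Im w) ^+ 2.
Proof.
have hz := normc_sqr z; have hw := normc_sqr w.
have pz := normc_ge0 z; have pw := normc_ge0 w.
suff H : Re z * Re w + Im z * Im w <= normc z * normc w.
  by clear - hz hw H; nra.
move: hz hw pz pw; set p := normc z; set q := normc w.
set a := Re z; set b := Im z; set c := Re w; set d := Im w => hz hw pz pw.
have [s0|s0] := leP (a * c + b * d) 0.
  by apply: (le_trans s0); exact: mulr_ge0.
rewrite -(ler_pXn2r (n := 2))// ?nnegrE ?mulr_ge0 ?(ltW s0)//.
rewrite exprMn hz hw.
have -> : (a ^+ 2 + b ^+ 2) * (c ^+ 2 + d ^+ 2) = (a * c + b * d) ^+ 2 + (a * d - b * c) ^+ 2 by ring.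
by rewrite lerDl sqr_ge0.
Qed.

(** The increments of |f| are at most those of [f], which Cauchy-Schwarz bounds by the integral of
    |g|^2; [riesz_upper] then provides the derivative of |f|. *)
Lemma H1_edge (f g : R -> R[i]) : edge_continuous l f -> is_weak_deriv l f g ->
  (\int[mu]_(x in `[0%R, l]) ((normc (g x)) `^ 2)%:E < +oo)%E ->
  exists h : R -> R, der l (fun x => normc (f x)) h /\
   ((itl 0 l (fun x => h x ^+ 2))%:E <= \int[mu]_(x in `[0%R, l]) ((normc (g x)) `^ 2)%:E)%E.
Proof.
move=> [cr ci] [wr wi] fin.
have mr : measurable_fun `]0, l[ (fun x => Re (g x)) by case: wr => _ [].
have mi : measurable_fun `]0, l[ (fun x => Im (g x)) by case: wi => _ [].
pose q x := Re (g x) ^+ 2 + Im (g x) ^+ 2.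
have gq x : (normc (g x)) `^ 2 = q x by rewrite powR_mulrn ?normc_ge0// normc_sqr.
(* A weak derivative is measurable only on the open interval; extending by 0 changes no integral. *)
pose r := q \_ `]0, l[.
have q0 x : 0 <= q x by rewrite addr_ge0 ?sqr_ge0.
have r0 x : 0 <= r x by rewrite /r patchE; case: ifP.
have mq : measurable_fun `]0, l[ q by apply: measurable_funD; exact: measurable_funX.
have mr' : measurable_fun `[0, l] r.
  apply/measurable_restrict => //; rewrite setIidr//; exact: subset_itv_oo_cc.
have rE : (\int[mu]_(x in `[0%R, l]) ((normc (g x)) `^ 2)%:E = \int[mu]_(x in `[0%R, l]) (r x)%:E)%E.
  have mn : measurable_fun `]0, l[ (fun x => (normc (g x)) `^ 2).
    by rewrite (_ : (fun x => _) = q)//; apply/funext.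
  rewrite integral_itv_bndoo; last exact/measurable_EFinP.
  rewrite [RHS]integral_itv_bndoo; last first.
    apply/measurable_EFinP; apply: measurable_funS mr' => //; exact: subset_itv_oo_cc.
  by apply: eq_integral => x xi; rewrite gq /r patchE xi.
rewrite rE in fin *.
have ir : itg 0 l r.
  apply/integrableP; split; first exact/measurable_EFinP.
  by under eq_integral do rewrite /= ger0_norm//.
rewrite EFin_itl//.
suff H a b : 0 <= a -> a <= b -> b <= l -> (normc (f b) - normc (f a)) ^+ 2 <= (b - a) * itl a b r.
  by have [h [dh hr]] := riesz_upper l0 ir r0 H; exists h; rewrite lee_fin.
move=> a0 ab bl; apply: (le_trans (normc_dist _ _)).
have inner x y : 0 < x -> x <= y -> y < l ->
    (Re (f y) - Re (f x)) ^+ 2 + (Im (f y) - Im (f x)) ^+ 2 <= (y - x) * itl x y r.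
  move=> x0 xy yl.
  rewrite (weak_deriv_diff cr wr x0 xy yl) (weak_deriv_diff ci wi x0 xy yl).
  have sub : `[x, y]%classic `<=` (`]0, l[%classic : set R).
    by move=> t; rewrite itv_in /= in_itv /= => /andP[t1 t2]; rewrite (lt_le_trans x0 t1) (le_lt_trans t2 yl).
  have irxy : itg x y r by apply: itg_sub ir; exact: ltW.
  have qr t : x <= t <= y -> q t = r t.
    by move=> txy; rewrite /r patchE mem_set//; apply: sub; rewrite itv_in.
  have L2u (v : R -> R) : measurable_fun `]0, l[ v -> (forall t, v t ^+ 2 <= q t) -> L2 x y v.
    move=> mv vq; have mv' : measurable_fun `[x, y] v by apply: measurable_funS mv.
    split=> //; apply: le_itg irxy; first exact: measurable_funX.
    by move=> t txy; rewrite ger0_norm ?sqr_ge0// -qr.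
  have Lr : L2 x y (fun t => Re (g t)) by apply: L2u => // t; rewrite lerDl sqr_ge0.
  have Li : L2 x y (fun t => Im (g t)) by apply: L2u => // t; rewrite lerDr sqr_ge0.
  have -> : itl x y r = itl x y (fun t => Re (g t) ^+ 2) + itl x y (fun t => Im (g t) ^+ 2).
    rewrite -itlD; [|exact: Lr.2|exact: Li.2].
    by apply: eq_itl => t txy; rewrite -qr.
  by rewrite mulrDr lerD// itl_CS.
apply/ler_addgt0Pr => e e0.
have [ba|{}ab] := leP b a.
  have -> : b = a by apply/eqP; rewrite eq_le ab ba.
  by rewrite !subrr mul0r expr0n /= !addr0 add0r ltW.
(* [inner] holds at interior points only; the case of [a] and [b] follows by letting [s] tend to 0
   in the increments between [a + s] and [b - s]. *)
pose F s := (Re (f (b - s)) - Re (f (a + s))) ^+ 2 + (Im (f (b - s)) - Im (f (a + s))) ^+ 2.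
have cF : cts 0 ((b - a) / 2) F.
  have cc (v w k : R -> R) : cts 0 l v -> (forall s t, `|w s - w t| = `|s - t|) -> k = v \o w ->
     (forall s, 0 <= s <= (b - a) / 2 -> 0 <= w s <= l) -> cts 0 ((b - a) / 2) k.
    move=> cv hw -> wl; apply: ucont_cts => e1 e10; have [d d0 hd] := cts_ucont cv e10.
    exists d => // s t sb tb st; apply: hd; [exact: wl|exact: wl|by rewrite hw].
  have cB (v : R -> R) : cts 0 l v -> cts 0 ((b - a) / 2) (fun s => v (b - s) - v (a + s)).
    move=> cv; apply: ctsD.
      apply: (cc v (fun s => b - s)) => //.
      - by move=> s t; rewrite (_ : b - s - (b - t) = - (s - t)) ?normrN//; ring.
      - by move=> s /andP[s1 s2]; clear - s1 s2 ab a0 bl; apply/andP; split; lra.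
    apply: (@cts_comp _ _ _ (fun z => - z)); first exact: opp_continuous.
    apply: (cc v (fun s => a + s)) => //.
    - by move=> s t; rewrite (_ : a + s - (a + t) = s - t)//; ring.
    - by move=> s /andP[s1 s2]; clear - s1 s2 ab a0 bl; apply/andP; split; lra.
  exact: ctsD (ctsX (n := 2) (cB _ cr)) (ctsX (n := 2) (cB _ ci)).
have ba0 : 0 < (b - a) / 2 by clear - ab; lra.
have [d d0 hd] := cts_ucont cF e0.
pose s := Num.min (d / 2) ((b - a) / 2).
have s0 : 0 < s by rewrite lt_min ba0 divr_gt0.
have sd : s < d by rewrite /s gt_min; apply/orP; left; clear - d0; lra.
have sb : s <= (b - a) / 2 by rewrite /s ge_min lexx orbT.
have h1 : `|F 0 - F s| < e.
  apply: hd; rewrite ?lexx ?(ltW s0) ?(ltW ba0) ?sb//.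
  by rewrite sub0r normrN gtr0_norm.
have h2 : F s <= (b - a) * itl a b r.
  have i1 : 0 < a + s by clear -a0 s0; lra.
  have i2 : a + s <= b - s by clear -sb; lra.
  have i3 : b - s < l by clear -bl s0; lra.
  apply: (le_trans (inner _ _ i1 i2 i3)).
  apply: (@le_trans _ _ ((b - a) * itl (a + s) (b - s) r)).
    by apply: ler_wpM2r; [exact: itl_ge0|clear -s0; lra].
  apply: ler_wpM2l; first by clear -ab; lra.
  apply: itl_mono => //; try by clear -s0; lra.
  by apply: itg_sub ir.
have -> : (Re (f b) - Re (f a)) ^+ 2 + (Im (f b) - Im (f a)) ^+ 2 = F 0 by rewrite /F subr0 addr0.
by move: h1; rewrite ltr_norml => /andP[_ h1]; clear - h1 h2; lra.
Qed.

(** Whichever weak derivative [gderiv] picks, it agrees almost everywhere with [h] in its real part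
    and with 0 in its imaginary part. *)
Lemma real_edge (f h : R -> R) (g : R -> R[i]) : der l f h ->
  is_weak_deriv l (fun x => Complex (f x) 0) g ->
  (\int[mu]_(x in `[0%R, l]) ((normc (g x)) `^ 2)%:E = (itl 0 l (fun x => h x ^+ 2))%:E)%E.
Proof.
move=> fh [wr wi].
have mr : measurable_fun `]0, l[ (fun x => Re (g x)) by case: wr => _ [].
have mi : measurable_fun `]0, l[ (fun x => Im (g x)) by case: wi => _ [].
have z0 : der l (fun=> 0) (fun=> 0).
  split; first by apply: cts_L2; exact: cts_cst.
  by move=> x y _ xy _; rewrite itl_cst// mul0r subrr.
have aer := weak_deriv_ae l0 fh wr; have aei := weak_deriv_ae l0 z0 wi.
have gq x : (normc (g x)) `^ 2 = Re (g x) ^+ 2 + Im (g x) ^+ 2.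
  by rewrite powR_mulrn ?normc_ge0// normc_sqr.
have mq : measurable_fun `]0, l[ (fun x => (normc (g x)) `^ 2).
  rewrite (_ : (fun x => _) = (fun x => Re (g x) ^+ 2 + Im (g x) ^+ 2)); last exact/funext.
  by apply: measurable_funD; exact: measurable_funX.
have mh : measurable_fun `]0, l[ (fun x => h x ^+ 2).
  apply: measurable_funX; apply: measurable_funS (fh.1).1 => //; exact: subset_itv_oo_cc.
rewrite -EFin_itl; last exact: fh.1.2.
rewrite [LHS]integral_itv_bndoo; last exact/measurable_EFinP.
rewrite [RHS]integral_itv_bndoo; last exact/measurable_EFinP.
apply: ae_eq_integral => //; [exact/measurable_EFinP|exact/measurable_EFinP|].
have : {ae mu, forall x, (0 < x < l -> Re (g x) = h x) /\ (0 < x < l -> Im (g x) = 0)}.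
  by move: aer aei; apply: filterS2; [exact: (ae_filter_ringOfSetsType mu)|split].
apply: ae_imp => x [h1 h2] /=; rewrite in_itv /= => xl.
by rewrite gq h1// h2// expr0n addr0.
Qed.

End Bridge2.

Section Levels.
Variables (R : realType) (l : R).
Local Notation mu := (@lebesgue_measure R).
Local Notation normc := ComplexField.Normc.normc.
Hypothesis l0 : 0 < l.
Implicit Types (f h : hedge -> R -> R) (u : gfun R).

Lemma pwn2 f e : (forall x, 0 <= x <= l -> 0 <= f e x) -> pwn l 2 f e = sqn l f e.
Proof. by move=> f0; apply: eq_itl => x /f0 fx; rewrite powR_mulrn. Qed.

Lemma gintegral_pwn q u f : (forall e x, 0 <= x <= l -> normc (u e x) = f e x) ->
  (forall e, cts 0 l (fun x => f e x `^ q)) -> smb (pwn l q f) ->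
  gintegral l q u = (tsum (pwn l q f))%:E.
Proof.
move=> uf cq sq; rewrite -esum_tsum//; last by move=> e; exact: pwn_ge0.
apply: eq_esum => e _; rewrite -EFin_itl; last exact: cts_itg.
by apply: eq_integral => x; rewrite inE itv_in => xl; rewrite uf.
Qed.

Lemma gint_ge0 q (u : gfun R) e : (0 <= \int[mu]_(x in `[0%R, l]) ((normc (u e x)) `^ q)%:E)%E.
Proof. by apply: integral_ge0 => x _; rewrite lee_fin powR_ge0. Qed.

Lemma H1_to_adm u : H1 l u -> exists f h, [/\ adm l f h,
  forall e x, f e x = normc (u e x) &
  ((tsum (sqn l h))%:E <= gintegral l 2 (gderiv l u))%E].
Proof.
move=> [[ce [v hv]] wd fin2 find].
have wg e : is_weak_deriv l (u e) (gderiv l u e) by apply: (@xgetPex _ _ [set g | is_weak_deriv l (u e) g]); exact: wd.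
have [fd sd] := esum_lty_smb (gint_ge0 2 (gderiv l u)) find.
have /choice[h hP] : forall e, exists h : R -> R, der l (fun x => normc (u e x)) h /\
   ((itl 0 l (fun x => h x ^+ 2))%:E <= \int[mu]_(x in `[0%R, l]) ((normc (gderiv l u e x)) `^ 2)%:E)%E.
  move=> e; apply: H1_edge => //.
  by rewrite -ge0_fin_numE// gint_ge0.
pose f e x := normc (u e x).
exists f, h.
have cf e : cts 0 l (f e) by apply: (der_cts (hP e).1).
have pE e : (\int[mu]_(x in `[0%R, l]) ((normc (u e x)) `^ 2)%:E = (sqn l f e)%:E)%E.
  rewrite /sqn -EFin_itl; last by apply: cts_itg; exact: ctsX.
  by apply: eq_integral => x _; rewrite powR_mulrn ?normc_ge0.
have sh : smb (sqn l h).
  apply: (@smb_le _ _ _ _ _ sd) => e.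
  by rewrite -lee_fin [X in (_ <= X)%E]fineK; [exact: (hP e).2|exact: fd].
split=> //.
- split=> //.
  + by move=> e; exact: (hP e).1.
  + by move=> e x _; exact: normc_ge0.
  + by exists (fun w => normc (v w)) => e; rewrite /f; have [-> ->] := hv e.
  + have [_] := esum_lty_smb (gint_ge0 2 u) fin2.
    by apply: smb_le => e; rewrite pE.
- rewrite -esum_tsum//; last by move=> e; exact: sqn_ge0.
  by apply: le_esum => e _; exact: (hP e).2.
Qed.

Lemma adm_to_H1 f h : adm l f h -> let u : gfun R := fun e x => Complex (f e x) 0 in
  H1 l u /\ gintegral l 2 (gderiv l u) = (tsum (sqn l h))%:E.
Proof.
move=> fh u; case: (fh) => dfh f0 [v hv] sf sh.
have nu e x : 0 <= x <= l -> normc (u e x) = f e x.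
  by move=> /(f0 e) fx; rewrite /u /= expr0n addr0 sqrtr_sqr ger0_norm.
have z0 : der l (fun=> 0) (fun=> 0).
  split; first by apply: cts_L2; exact: cts_cst.
  by move=> x y _ xy _; rewrite itl_cst// mul0r subrr.
have wd e : exists g, is_weak_deriv l (u e) g.
  exists (fun x => Complex (h e x) 0); split; first exact: der_weak_deriv (dfh e).
  exact: der_weak_deriv z0.
have wg e : is_weak_deriv l (u e) (gderiv l u e) by apply: (@xgetPex _ _ [set g | is_weak_deriv l (u e) g]); exact: wd.
have gE : gintegral l 2 (gderiv l u) = (tsum (sqn l h))%:E.
  rewrite -esum_tsum//; last by move=> e; exact: sqn_ge0.
  by apply: eq_esum => e _; exact: (real_edge l0 (dfh e) (wg e)).
have p2 e : pwn l 2 f e = sqn l f e by apply: pwn2; exact: f0.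
have fE : gintegral l 2 u = (tsum (pwn l 2 f))%:E.
  apply: gintegral_pwn => //; last by apply: (@smb_le _ _ _ _ _ sf) => e; rewrite p2.
  by move=> e; apply: (@cts_powR _ l l0 _ f h) => //; apply/andP; split; lra.
split=> //; split=> //; last 2 first.
- by rewrite fE ltry.
- by rewrite gE ltry.
split.
  by move=> e; split; [exact: der_cts (dfh e)|exact: cts_cst].
by exists (fun w => Complex (v w) 0) => e; rewrite /u; have [-> ->] := hv e.
Qed.

Variable p : R.
Hypothesis hp : 2 < p <= 6.

Let p16 : 1 <= p <= 6.
Proof. by case/andP: hp => p2 ->; rewrite andbT (le_trans _ (ltW p2))// ler1n. Qed.

Lemma H1_mass_to_adm m u : H1_mass l m u -> exists f h, [/\ adm l f h,
  tsum (sqn l f) = m & ((renergy l p f h)%:E <= energy l p u)%E].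
Proof.
move=> [Hu um]; have [f [h [fh fu dh]]] := H1_to_adm Hu; exists f, h.
have nu e x : 0 <= x <= l -> normc (u e x) = f e x by rewrite fu.
have f0 e x : 0 <= x <= l -> 0 <= f e x by case: fh => _ + _ _ _; apply.
have sf : smb (sqn l f) by case: fh.
have p2 e : pwn l 2 f e = sqn l f e by apply: pwn2; exact: f0.
split=> //.
  apply: EFin_inj; rewrite -um (@gintegral_pwn 2 u f)//.
  - by congr (_%:E); congr tsum; apply/funext => e; rewrite p2.
  - by move=> e; apply: (@cts_powR _ l l0 _ f h) => //; apply/andP; split; lra.
  - by apply: (@smb_le _ _ _ _ _ sf) => e; rewrite p2.
rewrite /energy (@gintegral_pwn p u f)//.
- rewrite -EFinM /renergy EFinB; apply: leeD2r.
  by rewrite EFinM lee_pmul2l// lte_fin invr_gt0.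
- by move=> e; exact: (cts_powR l0 p16 fh).
- exact: adm_smb_pwn fh.
Qed.

Lemma adm_to_H1_mass f h : adm l f h -> exists2 u, H1_mass l (tsum (sqn l f)) u &
  energy l p u = (renergy l p f h)%:E.
Proof.
move=> fh; have [Hu gE] := adm_to_H1 fh; exists (fun e x => Complex (f e x) 0).
all: case: (fh) => dfh f0 _ sf sh.
all: have nu e x : 0 <= x <= l -> normc (Complex (f e x) 0) = f e x
  by move=> /(f0 e) fx; rewrite /= expr0n addr0 sqrtr_sqr ger0_norm.
- split=> //; have p2 e : pwn l 2 f e = sqn l f e by apply: pwn2; exact: f0.
  rewrite (@gintegral_pwn 2 _ f)//.
  - by congr (_%:E); congr tsum; apply/funext => e; rewrite p2.
  - by move=> e; apply: (@cts_powR _ l l0 _ f h) => //; apply/andP; split; lra.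
  - by apply: (@smb_le _ _ _ _ _ sf) => e; rewrite p2.
- rewrite /energy gE (@gintegral_pwn p _ f)//.
  - by move=> e; exact: (cts_powR l0 p16 fh).
  - exact: adm_smb_pwn fh.
Qed.

Lemma level_ge c m : (forall f h, adm l f h -> tsum (sqn l f) = m -> c <= renergy l p f h) ->
  (c%:E <= energy_level l p m)%E.
Proof.
move=> H; apply: le_ereal_inf_tmp => _ [u Hu <-].
have [f [h [fh fm fe]]] := H1_mass_to_adm Hu.
by apply: le_trans fe; rewrite lee_fin; exact: H.
Qed.

Lemma level_le f h m : adm l f h -> tsum (sqn l f) = m ->
  (energy_level l p m <= (renergy l p f h)%:E)%E.
Proof.
move=> fh fm; have [u Hu <-] := adm_to_H1_mass fh; apply: ereal_inf_lbound.
by exists u => //; rewrite -fm.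
Qed.

Lemma ground_state_adm m u : ground_state l p m u -> exists f h, [/\ adm l f h,
  tsum (sqn l f) = m & ((renergy l p f h)%:E <= energy_level l p m)%E].
Proof. by move=> [Hu <-]; exact: H1_mass_to_adm. Qed.

Lemma adm_ground_state m f h : adm l f h -> tsum (sqn l f) = m ->
  (forall f' h', adm l f' h' -> tsum (sqn l f') = m -> renergy l p f h <= renergy l p f' h') ->
  exists u, ground_state l p m u.
Proof.
move=> fh fm H; have [u Hu uE] := adm_to_H1_mass fh; exists u; rewrite -fm; split=> //.
apply/eqP; rewrite eq_le; apply/andP; split.
  by rewrite uE; apply: level_ge; rewrite fm.
by rewrite uE; exact: level_le.
Qed.

End Levels.

(** * Gagliardo-Nirenberg inequalities *)

Section Graph.
Variable R : realType.
Implicit Types (v : int * int) (e : hedge) (k : 'I_3).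

Definition k0 : 'I_3 := @Ordinal 3 0 isT.
Definition k1 : 'I_3 := @Ordinal 3 1 isT.
Definition k2 : 'I_3 := @Ordinal 3 2 isT.

Lemma ord3P k : [\/ k = k0, k = k1 | k = k2].
Proof.
case: k => [[|[|[|//]]] ik]; [apply: Or31|apply: Or32|apply: Or33]; exact: val_inj.
Qed.

(* The lines of the honeycomb: a_v is joined by the edges (v, 0) and
   (shift k 1 v, k) to a_(shift k 1 v), for k = 1, 2. *)
Definition shift k (j : int) v : int * int :=
  if k == k1 then (v.1 + j, v.2) else (v.1, v.2 + j).

Lemma shift0 k v : shift k 0 v = v.
Proof. by rewrite /shift; case: v => a b; case: ifP => _ /=; rewrite addr0. Qed.

Lemma shiftD k i j v : shift k i (shift k j v) = shift k (j + i) v.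
Proof. by rewrite /shift; case: (k == k1) => /=; rewrite -addrA. Qed.

Lemma shift_inj k v : injective (fun j => shift k j v).
Proof. by move=> i j; rewrite /shift; case: ifP => _ [] /addrI. Qed.

Lemma hhead_k0 v : hhead (v, k0) = inr v.
Proof. by case: v. Qed.

Lemma hhead_shift k v : k != k0 -> hhead (shift k 1 v, k) = inr v.
Proof.
case: (ord3P k) => -> // _; case: v => a b; rewrite /shift /=; by rewrite addrK.
Qed.

(** Otherwise infinitely many distinct terms would be at least [eps], and their finite sums would
    exceed any bound. *)
Lemma smb_small (T : choiceType) (G : T -> R) (phi : nat -> T) eps N : injective phi ->
  smb G -> 0 < eps -> exists2 n, (N <= n)%N & G (phi n) < eps.
Proof.
move=> inj [C HC] e0; apply/not_exists2P => H.
have H1 n : (N <= n)%N -> eps <= G (phi n).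
  by move=> Nn; rewrite leNgt; apply/negP => h; case: (H n).
pose K := (Num.trunc (C / eps)).+1.
have := HC (map phi (iota N K)); rewrite map_inj_uniq// iota_uniq big_map => /(_ isT).
apply/negP; rewrite -ltNge.
apply: (@lt_le_trans _ _ (\sum_(i <- iota N K) eps)).
  rewrite big_const_seq count_predT size_iota iter_addr_0 -mulr_natl.
  by rewrite -ltr_pdivrMr// truncnS_gt.
rewrite big_seq [leRHS]big_seq; apply: ler_sum => i; rewrite mem_iota => /andP[Ni _].
exact: H1.
Qed.

Section Lines.
Variables (psi : hvertex -> R) (W : hedge -> R).
Hypothesis psiW : forall e, `|psi (htail e) - psi (hhead e)| <= W e.

Lemma edge_weight_ge0 e : 0 <= W e.
Proof. exact: le_trans (psiW e). Qed.

Lemma line_up k v N : k != k0 -> psi (inl v) <= psi (inl (shift k N%:Z v)) +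
  \sum_(j < N) (W (shift k j%:Z v, k0) + W (shift k (j.+1)%:Z v, k)).
Proof.
move=> kn; elim: N => [|N IH]; first by rewrite big_ord0 addr0 shift0.
rewrite big_ord_recr /=; apply: (le_trans IH).
have := psiW (shift k N%:Z v, k0); have := psiW (shift k N.+1%:Z v, k).
have -> : shift k N.+1%:Z v = shift k 1 (shift k N%:Z v) by rewrite shiftD -addn1 PoszD.
rewrite hhead_shift// hhead_k0 /htail /= !ler_norml => /andP[h1 h2] /andP[h3 h4].
by clear - h1 h2 h3 h4; lra.
Qed.

Lemma line_down k v N : k != k0 -> psi (inl v) <= psi (inl (shift k (- N%:Z) v)) +
  \sum_(j < N) (W (shift k (- j%:Z) v, k) + W (shift k (- (j.+1)%:Z) v, k0)).
Proof.
move=> kn; elim: N => [|N IH]; first by rewrite big_ord0 addr0 oppr0 shift0.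
rewrite big_ord_recr /=; apply: (le_trans IH).
have := psiW (shift k (- N.+1%:Z) v, k0); have := psiW (shift k (- N%:Z) v, k).
have {1 2}-> : shift k (- N%:Z) v = shift k 1 (shift k (- N.+1%:Z) v).
  by rewrite shiftD; congr shift; rewrite -addn1 PoszD opprD addrNK.
rewrite hhead_shift// hhead_k0 /htail /=.
have -> : shift k 1 (shift k (- N.+1%:Z) v) = shift k (- N%:Z) v.
  by rewrite shiftD; congr shift; rewrite -addn1 PoszD opprD addrNK.
rewrite !ler_norml => /andP[h1 h2] /andP[h3 h4].
by clear - h1 h2 h3 h4; lra.
Qed.

End Lines.

(** Each edge has exactly one endpoint of type a, so the stars partition the edges and sums over
    edges become sums over Z^2. *)
Definition star (V : hedge -> R) v : R := \sum_(k < 3) V (v, k).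

Lemma star_sum (V : hedge -> R) : (forall e, 0 <= V e) -> smb V ->
  smb (star V) /\ tsum (star V) <= tsum V.
Proof.
move=> V0 sV; have H s : uniq s -> \sum_(v <- s) star V v <= tsum V.
  move=> us; have -> : \sum_(v <- s) star V v = \sum_(e <- [seq (v, k) | v <- s, k <- enum 'I_3]) V e.
    by rewrite big_allpairs; apply: eq_bigr => v _; rewrite /star big_enum.
  apply: tsum_ge => //; apply: allpairs_uniq => //; first exact: enum_uniq.
  by move=> [? ?] [? ?] _ _ [-> ->].
by split; [exists (tsum V)|exact: tsum_le].
Qed.

Lemma star_ge (V : hedge -> R) v k : (forall e, 0 <= V e) -> V (v, k) <= star V v.
Proof. by move=> V0; rewrite /star (bigD1 k)//= lerDl sumr_ge0. Qed.

Lemma edge_sum_star (G : int * int -> R) (s : seq hedge) : (forall v, 0 <= G v) -> uniq s ->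
  \sum_(e <- s) G e.1 <= 3 * \sum_(v <- undup (map fst s)) G v.
Proof.
move=> G0 us.
have -> : 3 * \sum_(v <- undup (map fst s)) G v =
   \sum_(e <- [seq (v, k) | v <- undup (map fst s), k <- enum 'I_3]) G e.1.
  rewrite big_allpairs mulr_sumr; apply: eq_bigr => v _ /=.
  by rewrite big_enum /= sumr_const card_ord mulr_natl.
apply: (@sub_sum _ _ (fun e : hedge => G e.1)) => //.
  apply: allpairs_uniq; [exact: undup_uniq|exact: enum_uniq|].
  by move=> [? ?] [? ?] _ _ [-> ->].
move=> [v k] vs; apply/allpairsP; exists (v, k); split=> //=.
  by rewrite mem_undup; apply/mapP; exists (v, k).
exact: mem_enum.
Qed.

Lemma tsum_fiber (T1 T2 : choiceType) (F : T1 * T2 -> R) : (forall x, 0 <= F x) -> smb F ->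
  (forall m, smb (fun n => F (m, n))) /\
  (smb (fun m => tsum (fun n => F (m, n))) /\ tsum (fun m => tsum (fun n => F (m, n))) <= tsum F).
Proof.
move=> F0 sF.
have s1 m : smb (fun n => F (m, n)).
  exists (tsum F) => s us; rewrite -(big_map (fun n => (m, n)) predT F).
  by apply: tsum_ge => //; rewrite map_inj_uniq// => x y [].
split=> //.
have H s : uniq s -> \sum_(m <- s) tsum (fun n => F (m, n)) <= tsum F.
  move=> us; rewrite -lee_fin -esum_tsum// -sumEFin.
  rewrite (eq_bigr (fun m => (\esum_(n in [set: T2]) (F (m, n))%:E)%E)); last first.
    by move=> m _; rewrite esum_tsum.
  have -> : (\esum_(x in [set: T1 * T2]) (F x)%:E = \esum_(m in [set: T1]) \esum_(n in [set: T2]) (F (m, n))%:E)%E.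
    rewrite esum_esum//; last by move=> *; rewrite lee_fin.
    rewrite (_ : [set: T1] `*`` (fun=> [set: T2]) = [set: T1 * T2]); last by apply/seteqP; split.
    by apply: eq_esum => -[].
  rewrite fsbig_seq//; apply: esum_ge.
  by exists [set` s].
by split; [exists (tsum F)|exact: tsum_le].
Qed.

Lemma tsum_snd (T1 T2 : choiceType) (F : T1 * T2 -> R) : (forall x, 0 <= F x) -> smb F ->
  (forall n, smb (fun m => F (m, n))) /\
  (smb (fun n => tsum (fun m => F (m, n))) /\ tsum (fun n => tsum (fun m => F (m, n))) <= tsum F).
Proof.
move=> F0 sF; pose G (x : T2 * T1) := F (x.2, x.1).
have sG s : uniq s -> \sum_(x <- s) G x <= tsum F.
  move=> us; rewrite -(big_map (fun x => (x.2, x.1)) predT F); apply: tsum_ge => //.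
  by rewrite map_inj_uniq// => -[? ?] [? ?] [-> ->].
have [h1 [h2 h3]] := @tsum_fiber _ _ G (fun=> F0 _) (ex_intro _ _ sG).
by split=> //; split=> //; apply: (le_trans h3); exact: tsum_le.
Qed.

(* The two-dimensional Gagliardo-Nirenberg inequality: [S v ^+ 2] is at most the product of the
   totals of [F] on the two lines through [v], and the sum of these products factorizes. *)
Lemma sum_sqr_lines (S F : int * int -> R) s : (forall v, 0 <= F v) -> smb F ->
  (forall v, 0 <= S v) ->
  (forall v, S v <= tsum (fun n => F (v.1, n))) ->
  (forall v, S v <= tsum (fun m => F (m, v.2))) -> uniq s ->
  \sum_(v <- s) S v ^+ 2 <= tsum F ^+ 2.
Proof.
move=> F0 sF S0 SA SB us.
have [a1 [a2 a3]] := tsum_fiber F0 sF; have [b1 [b2 b3]] := tsum_snd F0 sF.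
pose A m := tsum (fun n => F (m, n)); pose B n := tsum (fun m => F (m, n)).
have A0 m : 0 <= A m by exact: tsum_ge0.
have B0 n : 0 <= B n by exact: tsum_ge0.
apply: (@le_trans _ _ (\sum_(v <- s) A v.1 * B v.2)).
  by apply: ler_sum => v _; rewrite expr2 ler_pM.
pose s1 := undup (map fst s); pose s2 := undup (map snd s).
apply: (@le_trans _ _ (\sum_(v <- [seq (m, n) | m <- s1, n <- s2]) A v.1 * B v.2)).
  apply: (@sub_sum _ _ (fun v => A v.1 * B v.2)) => //.
  - by move=> v; exact: mulr_ge0.
  - by apply: allpairs_uniq; rewrite ?undup_uniq// => -[? ?] [? ?] _ _ [-> ->].
  - move=> [m n] mns; apply/allpairsP; exists (m, n); split=> //=; rewrite mem_undup.
      by apply/mapP; exists (m, n).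
    by apply/mapP; exists (m, n).
rewrite big_allpairs /=.
under eq_bigr do rewrite -mulr_sumr.
rewrite -mulr_suml expr2; apply: ler_pM.
- exact: sumr_ge0.
- exact: sumr_ge0.
- by apply: le_trans a3; apply: tsum_ge => //; exact: undup_uniq.
- by apply: le_trans b3; apply: tsum_ge => //; exact: undup_uniq.
Qed.

End Graph.

Section GagliardoNirenberg.
Variables (R : realType) (l : R).
Hypothesis l0 : 0 < l.
Implicit Types (f h : hedge -> R -> R) (e : hedge).

(** Going up the line, the value at the start is bounded by the weights met plus a value far away,
    which is arbitrarily small. *)
Lemma line_sum (psi : hvertex -> R) (W : hedge -> R) k v :
  (forall e, `|psi (htail e) - psi (hhead e)| <= W e) -> smb W -> k != k0 ->
  (forall eps, 0 < eps -> exists N : nat, psi (inl (shift k N%:Z v)) < eps) ->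
  smb (fun j => star W (shift k j v)) /\ psi (inl v) <= tsum (fun j => star W (shift k j v)).
Proof.
move=> pW sW kn tail; have W0 := edge_weight_ge0 pW.
have [sS _] := star_sum W0 sW.
have sL : smb (fun j => star W (shift k j v)).
  exists (tsum (star W)) => s us; rewrite -(big_map (fun j => shift k j v) predT (star W)).
  by apply: tsum_ge => //; rewrite map_inj_uniq//; exact: shift_inj.
split=> //; apply/ler_addgt0Pr => eps e0; have [N hN] := tail _ e0.
apply: (le_trans (line_up pW v N kn)); rewrite addrC; apply: lerD; last exact: ltW.
(* N steps need N + 1 stars: the edge reached with the vertex of index j + 1 belongs to the star of
   that vertex. *)
apply: (@le_trans _ _ (\sum_(j < N.+1) star W (shift k j%:Z v))); last first.
  have := @tsum_ge _ _ (fun j => star W (shift k j v)) (map Posz (iota 0 N.+1)) sL.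
  rewrite map_inj_uniq ?iota_uniq; last by move=> ? ? [].
  by move=> /(_ isT); rewrite big_map -[iota 0 N.+1]/(index_iota 0 N.+1) big_mkord.
have hs w : W (w, k0) + W (w, k) <= star W w.
  rewrite /star (bigD1 k0)//= lerD2l (bigD1 k)//= lerDl.
  by apply: sumr_ge0 => *; exact: W0.
apply: (@le_trans _ _ (\sum_(j < N.+1) (W (shift k j%:Z v, k0) + W (shift k j%:Z v, k)))); last first.
  by apply: ler_sum => j _; exact: hs.
rewrite !big_split /=; apply: lerD.
  by rewrite [leRHS]big_ord_recr /= lerDl; exact: W0.
by rewrite [leRHS]big_ord_recl /= lerDr; exact: W0.
Qed.

Variables (f h : hedge -> R -> R).
Hypothesis fh : adm l f h.

(** Bounds the variation of [f^2] on the edge, since (f^2)' = 2 f f'. *)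
Definition var2 e : R := itl 0 l (fun x => 2 * f e x * `|h e x|).

Lemma itg_var2 e : itg 0 l (fun x => 2 * f e x * `|h e x|).
Proof.
apply: itgM; last by apply: itg_norm; apply: L2_itg; exact: (adm_der fh e).1.
by apply: ctsM; [exact: cts_cst|exact: adm_cts fh].
Qed.

Lemma var2_fun_ge0 e x : 0 <= x <= l -> 0 <= 2 * f e x * `|h e x|.
Proof. by move=> xl; rewrite !mulr_ge0// (adm_ge0 fh). Qed.

Lemma sq_var e x y : 0 <= x <= l -> 0 <= y <= l -> `|f e x ^+ 2 - f e y ^+ 2| <= var2 e.
Proof.
wlog xy : x y / x <= y.
  move=> H xl yl; have [xy|yx] := leP x y; first exact: H.
  by rewrite distrC; apply: H => //; exact: ltW.
move=> xl yl; have [B B0 hB] := adm_bounded l0 fh.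
have := @der_chain R l (f e) (h e) 0 B (fun t => t ^+ 2) (fun t => 2 * t) (ltW l0) (adm_der fh e).
case/andP: (xl) => x0 xl'; case/andP: (yl) => y0 yl'.
move=> /(_ _ _ _ _ _ x y x0 xy yl') H; rewrite distrC; apply: le_trans (H _ _ _ _ _) _.
- by move=> t tl; rewrite (adm_ge0 fh)//= hB.
- by apply: ctsM; [exact: cts_cst|apply: ctsT => t; exact: cvg_id].
- by move=> t /andP[t0 _]; rewrite mulr_ge0.
- move=> s t s0 st tB; exists t; first by rewrite st lexx.
  rewrite (_ : t ^+ 2 - s ^+ 2 = (t - s) * (t + s)); last by ring.
  rewrite ger0_norm; last by apply: mulr_ge0; clear - s0 st; lra.
  by rewrite mulrC; apply: ler_wpM2r; clear - s0 st; lra.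
- by apply: ctsM; [exact: cts_cst|exact: adm_cts fh].
- by apply: itl_mono => //; [exact: itg_var2|move=> t; exact: var2_fun_ge0].
Qed.

Lemma var2_ge0 e : 0 <= var2 e. Proof. by apply: itl_ge0 => x; exact: var2_fun_ge0. Qed.

Lemma var2_le t e : 0 < t -> var2 e <= t * sqn l f e + t^-1 * sqn l h e.
Proof.
move=> t0; have i1 : itg 0 l (fun x => f e x ^+ 2) by apply: cts_itg; apply: ctsX; exact: adm_cts fh.
have i2 := (adm_der fh e).1.2.
rewrite /sqn -itlZ// -itlZ// -itlD; [|exact: itgZ|exact: itgZ].
apply: itl_le; [exact: itg_var2|by apply: itgD; exact: itgZ|].
move=> x xl; rewrite -[h e x ^+ 2]real_normK ?num_real//.
set a := f e x; set b := `|h e x|.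
rewrite -subr_ge0 (_ : _ - _ = t^-1 * (t * a - b) ^+ 2); last by field; rewrite gt_eqF.
by rewrite mulr_ge0 ?sqr_ge0// invr_ge0 ltW.
Qed.

Lemma smb_var2 : smb var2.
Proof.
apply: (@smb_le _ _ _ _ (fun e => @var2_le 1 e ltr01)).
by apply: smbD; apply: smbZ; rewrite ?invr1//; [exact: adm_mass fh|exact: adm_dirichlet fh].
Qed.

Lemma var2_sum t : 0 < t -> tsum var2 <= t * tsum (sqn l f) + t^-1 * tsum (sqn l h).
Proof.
move=> t0; have sf := adm_mass fh; have sh := adm_dirichlet fh; have t1 : 0 <= t^-1 by rewrite invr_ge0 ltW.
have t0' := ltW t0.
rewrite -!tsumZ// -tsumD//; [|..]; try by move=> e; rewrite mulr_ge0// sqn_ge0.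
- apply: tsum_mono; first by move=> e; exact: var2_le.
  by apply: smbD; exact: smbZ.
- exact: smbZ.
- exact: smbZ.
Qed.

(** Cauchy-Schwarz on the whole graph, obtained by optimizing the free parameter of Young's
    inequality [var2_sum]. *)
Lemma var2_sqr : tsum var2 ^+ 2 <= 4 * (tsum (sqn l f) * tsum (sqn l h)).
Proof.
set W := tsum var2; set m := tsum _; set D := tsum _.
have sf := adm_mass fh; have sh := adm_dirichlet fh.
have W0 : 0 <= W by apply: tsum_ge0 smb_var2.
have m0 : 0 <= m by exact: tsum_ge0.
have D0 : 0 <= D by exact: tsum_ge0.
have key t : 0 < t -> t * W <= t ^+ 2 * m + D.
  move=> t0; have -> : t ^+ 2 * m + D = t * (t * m + t^-1 * D) by field; rewrite gt_eqF.
  by rewrite ler_pM2l//; exact: var2_sum.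
have [Wz|Wn] := eqVneq W 0; first by rewrite Wz expr0n /= mulr_ge0// mulr_ge0.
have {Wn W0}Wp : 0 < W by rewrite lt_neqAle eq_sym Wn.
move: m0; rewrite le_eqVlt => /orP[/eqP mz|mp].
  (* If the mass is 0, then t W <= D for every t > 0, which fails at this value. *)
  have t0 : 0 < (D + 1) / W by rewrite divr_gt0// ltr_wpDl.
  have := key _ t0; rewrite -mz mulr0 add0r divfK ?gt_eqF//.
  by clear; lra.
(* The minimizer of t^2 m - t W. *)
have t0 : 0 < W / (2 * m) by rewrite divr_gt0// mulr_gt0.
have := key _ t0.
have -> : W / (2 * m) * W = W ^+ 2 / (2 * m) by field; rewrite gt_eqF.
have -> : (W / (2 * m)) ^+ 2 * m = W ^+ 2 / (4 * m) by field; rewrite gt_eqF.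
have -> : W ^+ 2 / (2 * m) = W ^+ 2 / (4 * m) * 2 by field; rewrite gt_eqF.
move=> H; have : W ^+ 2 / (4 * m) <= D by clear - H; lra.
by rewrite ler_pdivrMr ?mulr_gt0// => H1; apply: (le_trans H1); rewrite mulrC mulrA.
Qed.

Lemma edge_small (phi : nat -> hedge) eps : injective phi -> 0 < eps -> forall N0,
  exists2 N, (N0 <= N)%N & forall x, 0 <= x <= l -> f (phi N) x ^+ 2 < eps.
Proof.
move=> inj e0 N0; have sf := adm_mass fh; have sh := adm_dirichlet fh.
have sG : smb (fun e => 2 / l * sqn l f e + 2 * l * sqn l h e).
  by apply: smbD; apply: smbZ => //; [rewrite divr_ge0// ltW|rewrite mulr_ge0// ltW].
have [N hN1 hN] := smb_small N0 inj sG e0; exists N => // x xl.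
exact: le_lt_trans (der_sup l0 (adm_der fh _) xl) hN.
Qed.

Definition star_sup v : R := f (v, k0) 0 ^+ 2 + star var2 v.

Lemma star_supP v k x : 0 <= x <= l -> f (v, k) x ^+ 2 <= star_sup v.
Proof.
move=> xl; have [vx hv] := adm_vertex fh.
have z0 : 0 <= (0 : R) <= l by rewrite lexx ltW.
have := sq_var (v, k) xl z0.
rewrite /star_sup (hv (v, k)).1 (hv (v, k0)).1 /htail /= => H.
have := star_ge v k var2_ge0; move: H; rewrite ler_norml => /andP[_ h1] h2.
by clear - h1 h2; lra.
Qed.

Lemma line_star_sup k v : k != k0 -> smb (fun j => star var2 (shift k j v)) /\
  star_sup v <= tsum (fun j => 2 * star var2 (shift k j v)).
Proof.
move=> kn; have [vx hv] := adm_vertex fh.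
have z0 : 0 <= (0 : R) <= l by rewrite lexx ltW.
have zl : 0 <= l <= l by rewrite lexx andbT ltW.
have pW e : `|vx (htail e) ^+ 2 - vx (hhead e) ^+ 2| <= var2 e.
  by have [<- <-] := hv e; exact: sq_var.
have tail eps : 0 < eps -> exists N : nat, vx (inl (shift k N%:Z v)) ^+ 2 < eps.
  move=> e0; have inj : injective (fun j : nat => (shift k j%:Z v, k0) : hedge).
    by move=> i j [] /shift_inj [].
  have [N _ hN] := edge_small inj e0 0; exists N.
  by have := hN 0 z0; rewrite (hv _).1.
have [s1 l1] := @line_sum (fun w => vx w ^+ 2) var2 k v pW smb_var2 kn tail.
split=> //; rewrite tsumZ// /star_sup (hv _).1 /htail /=.
have := tsum_ge1 0 s1; rewrite shift0; move: l1 => /=; clear; lra.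
Qed.

Lemma star_var2 : smb (star var2) /\ tsum (star var2) <= tsum var2.
Proof. exact: star_sum var2_ge0 smb_var2. Qed.

Lemma star_sup_le v : star_sup v <= 2 * tsum var2.
Proof.
have [s1 l1] := @line_star_sup k1 v isT; apply: (le_trans l1); rewrite tsumZ//.
rewrite ler_pM2l//; apply: le_trans star_var2.2; apply: tsum_le => s us.
rewrite -(big_map (fun j => shift k1 j v) predT (star var2)).
by apply: tsum_ge; [exact: star_var2.1|rewrite map_inj_uniq//; exact: shift_inj].
Qed.

Lemma sup_le_var2 e x : 0 <= x <= l -> f e x ^+ 2 <= 2 * tsum var2.
Proof. by case: e => v k xl; apply: le_trans (star_supP v k xl) (star_sup_le v). Qed.

Definition pw4 e : R := itl 0 l (fun x => f e x ^+ 4).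

Lemma star_ge0 v : 0 <= star var2 v.
Proof. by apply: sumr_ge0 => *; exact: var2_ge0. Qed.

(** On the star of v, [f^4] is at most [star_sup v ^+ 2], and [sum_sqr_lines] sums these over v.
    With W the total of [var2], three edges per star and twice the variation give 12 l W^2, and W^2
    is at most 4 times mass times Dirichlet integral: hence 48. *)
Lemma gn4 : smb pw4 /\ tsum pw4 <= 48 * l * (tsum (sqn l f) * tsum (sqn l h)).
Proof.
have S0 v : 0 <= star_sup v by rewrite addr_ge0 ?sqr_ge0 ?star_ge0.
have H s : uniq s -> \sum_(e <- s) pw4 e <= 12 * l * tsum var2 ^+ 2.
  move=> us; apply: (@le_trans _ _ (\sum_(e <- s) l * star_sup e.1 ^+ 2)).
    apply: ler_sum => -[v k] _; rewrite /pw4 mulrC -[X in _ * X]subr0 -itl_cst ?(ltW l0)//.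
    apply: itl_le => [||x xl]; [by apply: cts_itg; apply: ctsX; exact: adm_cts fh|by apply: cts_itg; exact: cts_cst|].
    rewrite (_ : f (v, k) x ^+ 4 = (f (v, k) x ^+ 2) ^+ 2); last by rewrite -exprM.
    by rewrite lerXn2r ?nnegrE ?sqr_ge0// star_supP.
  have g0 v : 0 <= l * star_sup v ^+ 2 by rewrite mulr_ge0 ?sqr_ge0// ltW.
  apply: (le_trans (edge_sum_star g0 us)).
  pose F v := 2 * star var2 v.
  have F0 v : 0 <= F v by rewrite mulr_ge0// star_ge0.
  have sF : smb F by apply: smbZ => //; exact: star_var2.1.
  have ft : tsum F <= 2 * tsum var2 by rewrite tsumZ//; [rewrite ler_pM2l//; exact: star_var2.2|exact: star_var2.1].
  have tF0 : 0 <= tsum F by exact: tsum_ge0.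
  have [a1 _] := tsum_fiber F0 sF; have [b1 _] := tsum_snd F0 sF.
  have SA v : star_sup v <= tsum (fun n => F (v.1, n)).
     have [s1 l1] := @line_star_sup k2 v isT; apply: (le_trans l1).
    have := @tsum_le _ _ (fun j => 2 * star var2 (shift k2 j v)); apply => t ut.
    rewrite -(big_map (fun j => v.2 + j) predT (fun n => F (v.1, n))).
    by apply: tsum_ge; [exact: a1|rewrite map_inj_uniq// => ? ? /addrI].
  have SB v : star_sup v <= tsum (fun m => F (m, v.2)).
     have [s1 l1] := @line_star_sup k1 v isT; apply: (le_trans l1).
    have := @tsum_le _ _ (fun j => 2 * star var2 (shift k1 j v)); apply => t ut.
    rewrite -(big_map (fun j => v.1 + j) predT (fun n => F (n, v.2))).
    by apply: tsum_ge; [exact: b1|rewrite map_inj_uniq// => ? ? /addrI].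
  have main := sum_sqr_lines F0 sF S0 SA SB (undup_uniq (map fst s)).
  rewrite -mulr_sumr.
  have main2 : tsum F ^+ 2 <= (2 * tsum var2) ^+ 2.
    by rewrite lerXn2r ?nnegrE// (le_trans tF0).
  have := le_trans main main2; rewrite -(ler_pM2l l0); clear; lra.
have main : 12 * l * tsum var2 ^+ 2 <= 48 * l * (tsum (sqn l f) * tsum (sqn l h)).
  by have := var2_sqr; rewrite -(ler_pM2l l0); lra.
by split; [exists (12 * l * tsum var2 ^+ 2)|apply: le_trans main; exact: tsum_le].
Qed.

End GagliardoNirenberg.

(** * Scaling and coercivity *)

Section Energy.
Variables (R : realType) (l : R).
Hypothesis l0 : 0 < l.
Implicit Types (f h : hedge -> R -> R) (e : hedge) (p a : R).

Definition scale a f : hedge -> R -> R := fun e x => a * f e x.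

Lemma sqn_scale a f h e : adm l f h -> sqn l (scale a f) e = a ^+ 2 * sqn l f e.
Proof.
move=> fh; rewrite /sqn -itlZ; last by apply: cts_itg; apply: ctsX; exact: adm_cts fh.
by apply: eq_itl => x _; rewrite /scale exprMn.
Qed.

Lemma sqn_scale_der a f h e : adm l f h -> sqn l (scale a h) e = a ^+ 2 * sqn l h e.
Proof.
move=> fh; rewrite /sqn -itlZ; last exact: (adm_der fh e).1.2.
by apply: eq_itl => x _; rewrite /scale exprMn.
Qed.

Lemma adm_scale a f h : 0 <= a -> adm l f h -> adm l (scale a f) (scale a h).
Proof.
move=> a0 fh; split.
- move=> e; have [Lh dh] := adm_der fh e; split; first exact: L2Z.
  move=> x y x0 xy yl; rewrite /scale -mulrBr dh// itlZ//.
  by apply: L2_itg; exact: L2_sub Lh.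
- by move=> e x xl; rewrite mulr_ge0// (adm_ge0 fh).
- have [v hv] := adm_vertex fh; exists (fun w => a * v w) => e.
  by rewrite /scale; have [-> ->] := hv e.
- rewrite (_ : sqn l _ = fun e => a ^+ 2 * sqn l f e); last by apply/funext => e; exact: sqn_scale fh.
  by apply: smbZ; [exact: sqr_ge0|exact: adm_mass fh].
- rewrite (_ : sqn l _ = fun e => a ^+ 2 * sqn l h e); last by apply/funext => e; exact: sqn_scale_der fh.
  by apply: smbZ; [exact: sqr_ge0|exact: adm_dirichlet fh].
Qed.

Lemma mass_scale a f h : adm l f h -> tsum (sqn l (scale a f)) = a ^+ 2 * tsum (sqn l f).
Proof.
move=> fh; rewrite -tsumZ ?sqr_ge0//; last exact: adm_mass fh.
by apply: eq_tsum => e; exact: sqn_scale fh.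
Qed.

Lemma dirichlet_scale a f h : adm l f h -> tsum (sqn l (scale a h)) = a ^+ 2 * tsum (sqn l h).
Proof.
move=> fh; rewrite -tsumZ ?sqr_ge0//; last exact: adm_dirichlet fh.
by apply: eq_tsum => e; exact: sqn_scale_der fh.
Qed.

Lemma pwn_scale p a f h : 2 < p <= 6 -> 0 <= a -> adm l f h ->
  tsum (pwn l p (scale a f)) = a `^ p * tsum (pwn l p f).
Proof.
move=> hp a0 fh; rewrite -tsumZ ?powR_ge0//; last exact: adm_smb_pwn fh.
have p16 : 1 <= p <= 6 by case/andP: hp => p2 ->; rewrite andbT (le_trans _ (ltW p2))// ler1n.
apply: eq_tsum => e; rewrite /pwn -itlZ; last by apply: cts_itg; exact: cts_powR fh.
by apply: eq_itl => x xl; rewrite /scale powRM// (adm_ge0 fh).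
Qed.

Lemma renergy_scale p a f h : 2 < p <= 6 -> 0 <= a -> adm l f h ->
  renergy l p (scale a f) (scale a h) =
  2^-1 * (a ^+ 2 * tsum (sqn l h)) - p^-1 * (a `^ p * tsum (pwn l p f)).
Proof.
move=> hp a0 fh; rewrite /renergy.
by congr (_ * _ - _ * _); [exact: (dirichlet_scale a fh)|exact: (pwn_scale hp a0 fh)].
Qed.

(** If the Dirichlet integral vanishes, so does the variation of [f^2], which bounds [f^2]. *)
Lemma mass_pos_dirichlet f h : adm l f h -> 0 < tsum (sqn l f) -> 0 < tsum (sqn l h).
Proof.
move=> fh m0; rewrite lt_neqAle tsum_ge0 ?andbT; last exact: adm_dirichlet fh.
apply/negP => /eqP D0; move: m0; apply/negP; rewrite -leNgt.
have W0 : tsum (var2 l f h) ^+ 2 <= 0 by have := var2_sqr fh; rewrite -D0 !mulr0.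
have Wz : tsum (var2 l f h) = 0.
  by apply/eqP; rewrite -sqrf_eq0 eq_le W0 sqr_ge0.
apply: tsum_le => s _; rewrite big1// => e _.
rewrite /sqn (eq_itl (g := fun=> 0)); first by rewrite itl_cst ?mul0r// ltW.
move=> x xl; have := sup_le_var2 l0 fh e xl; rewrite Wz mulr0 => H.
by apply/eqP; rewrite eq_le H sqr_ge0.
Qed.

Lemma pwn_ge0_tsum p f h : 2 < p <= 6 -> adm l f h -> 0 <= tsum (pwn l p f).
Proof. by move=> hp fh; apply: tsum_ge0; exact: adm_smb_pwn fh. Qed.

Lemma pwn_gt0 p f h : 2 < p <= 6 -> adm l f h -> 0 < tsum (sqn l f) -> 0 < tsum (pwn l p f).
Proof.
move=> hp fh m0; rewrite lt_neqAle (pwn_ge0_tsum hp fh) andbT; apply/negP => /eqP P0.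
have sP := adm_smb_pwn l0 hp fh.
have p16 : 1 <= p <= 6 by case/andP: hp => p2 ->; rewrite andbT (le_trans _ (ltW p2))// ler1n.
have pe0 e : pwn l p f e = 0.
  by apply/eqP; rewrite eq_le pwn_ge0 andbT [leRHS]P0 tsum_ge1.
suff z e x : 0 <= x <= l -> f e x = 0.
  move: m0; rewrite (_ : tsum _ = 0) ?ltxx//; apply/eqP; rewrite eq_le tsum_ge0 ?andbT; last exact: adm_mass fh.
  apply: tsum_le => s _; rewrite big1// => e _.
  rewrite /sqn (eq_itl (g := fun=> 0)); first by rewrite itl_cst ?mul0r// ltW.
  by move=> x xl; rewrite z// expr0n.
move=> xl; apply/eqP/negPn/negP => fn.
have fx : 0 < f e x by rewrite lt_neqAle eq_sym fn (adm_ge0 fh).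
have gx : 0 < f e x `^ p / 2 by rewrite divr_gt0// powR_gt0.
have cp := cts_powR l0 p16 fh (e := e).
have [d d0 hd] := cts_ucont cp gx.
(* A neighbourhood of [x] truncated to the edge, still of positive length, on which [f^p] is at
   least half its value at [x]. *)
pose c := Num.max 0 (x - d / 2); pose b := Num.min l (x + d / 2).
case/andP: (xl) => x0 xl'.
have d2 : 0 < d / 2 by rewrite divr_gt0.
have c0 : 0 <= c by rewrite le_max lexx.
have bl : b <= l by rewrite ge_min lexx.
have cx : c <= x by rewrite ge_max x0 gerBl ltW.
have xb : x <= b by rewrite le_min xl' lerDl ltW.
have cb : c < b.
  have [xz|xn] := eqVneq x 0.
    by apply: (le_lt_trans cx); rewrite lt_min ltrDl d2 xz l0.
  by apply: lt_le_trans xb; rewrite gt_max gtrBl d2 andbT lt_neqAle eq_sym xn.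
have : itl c b (fun=> f e x `^ p / 2) <= pwn l p f e.
  apply: (@le_trans _ _ (itl c b (fun x => f e x `^ p))); last first.
    by apply: itl_mono; rewrite ?(ltW cb)//; [exact: cts_itg|move=> t _; exact: powR_ge0].
  apply: itl_le; [by apply: cts_itg; exact: cts_cst|by apply: itg_sub (cts_itg cp)|].
  move=> t /andP[ct tb].
  have tl : 0 <= t <= l by rewrite (le_trans c0 ct) (le_trans tb bl).
  have xt : `|x - t| < d.
    have h1 : x - d / 2 <= c by rewrite le_max lexx orbT.
    have h2 : b <= x + d / 2 by rewrite ge_min lexx orbT.
    by rewrite ltr_norml; apply/andP; split; lra.
  have := hd _ _ xl tl xt; rewrite ltr_norml => /andP[_ h1]; lra.
rewrite pe0 itl_cst ?(ltW cb)// leNgt => /negP; apply.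
by rewrite mulr_gt0// subr_gt0.
Qed.

(* [f^p <= f^4 + f^6], where [f^4] is handled by [gn4] and [f^6] by the supremum of [f]. *)
Lemma gn_small p f h : 4 <= p <= 6 -> adm l f h ->
  tsum (pwn l p f) <= (48 * l * tsum (sqn l f) + 16 * tsum (sqn l f) ^+ 2) * tsum (sqn l h).
Proof.
move=> /andP[p4 p6] fh; set m := tsum (sqn l f); set D := tsum (sqn l h).
have [s4 g4] := gn4 l0 fh; have W2 := var2_sqr fh.
have p16 : 1 <= p <= 6 by rewrite p6 andbT; lra.
have sf := adm_mass fh; set W := tsum (var2 l f h) in W2.
have W0 : 0 <= W by apply: tsum_ge0 (smb_var2 fh).
have pe e : pwn l p f e <= pw4 l f e + 4 * W ^+ 2 * sqn l f e.
  have cf := adm_cts fh (e := e).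
  have i2 : itg 0 l (fun x => f e x ^+ 2) by apply: cts_itg; exact: ctsX.
  have i4 : itg 0 l (fun x => f e x ^+ 4) by apply: cts_itg; exact: ctsX.
  rewrite /sqn /pw4 -itlZ// -itlD//; last exact: itgZ.
  apply: itl_le; [by apply: cts_itg; exact: cts_powR fh|by apply: itgD => //; exact: itgZ|].
  move=> x xl; have fx := adm_ge0 fh e xl.
  have := sup_le_var2 l0 fh e xl; rewrite -/W => fW.
  have [f1|f1] := leP (f e x) 1.
    have t1 : f e x `^ p <= f e x ^+ 4.
      rewrite -powR_mulrn//; have [->|fn] := eqVneq (f e x) 0.
        by rewrite !powR0//; lra.
      by apply: ger_powR => //; rewrite f1 andbT lt_neqAle eq_sym fn.
    by apply: (le_trans t1); rewrite lerDl !mulr_ge0 ?sqr_ge0.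
  have t1 : f e x `^ p <= f e x ^+ 6 by rewrite -powR_mulrn//; apply: ler_powR => //; exact: ltW.
  apply: (le_trans t1).
  have -> : f e x ^+ 6 = (f e x ^+ 2) ^+ 2 * f e x ^+ 2 by rewrite -exprM -exprD.
  have : (f e x ^+ 2) ^+ 2 * f e x ^+ 2 <= 4 * W ^+ 2 * f e x ^+ 2.
    rewrite ler_wpM2r ?sqr_ge0// (_ : 4 * W ^+ 2 = (2 * W) ^+ 2); last by ring.
    by rewrite lerXn2r ?nnegrE ?sqr_ge0// mulr_ge0.
  have : 0 <= f e x ^+ 4 by rewrite exprn_ge0.
  lra.
have W4 : 0 <= 4 * W ^+ 2 by rewrite mulr_ge0// sqr_ge0.
have sZ : smb (fun e => 4 * W ^+ 2 * sqn l f e) by exact: smbZ.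
(* The second term stems from f^6 <= (2 W)^2 f^2 with W^2 <= 4 m D. *)
have -> : (48 * l * m + 16 * m ^+ 2) * D = 48 * l * (m * D) + 4 * (4 * (m * D)) * m by ring.
apply: (@le_trans _ _ (tsum (pw4 l f) + 4 * W ^+ 2 * m)).
  rewrite -tsumZ// -tsumD//.
  - by apply: tsum_mono => //; exact: smbD.
  - by move=> e; apply: itl_ge0 => x xl; rewrite exprn_ge0// (adm_ge0 fh).
  - by move=> e; rewrite mulr_ge0// sqn_ge0.
apply: lerD => //; apply: ler_wpM2r; first exact: tsum_ge0.
by rewrite ler_pM2l.
Qed.

Lemma sup_bound f h e x : adm l f h -> 0 <= x <= l ->
  f e x <= Num.sqrt (2 * tsum (var2 l f h)).
Proof.
move=> fh xl; have fx := adm_ge0 fh e xl.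
have -> : f e x = Num.sqrt (f e x ^+ 2) by rewrite sqrtr_sqr ger0_norm.
by apply: ler_wsqrtr; exact: sup_le_var2.
Qed.

(** The threshold [s] solves eps * s^(4 - q) = 1: above it [M^q] is at most [eps * M^4], below it at
    most [s^q]. *)
Lemma powR_absorb (q eps : R) : 0 < q < 4 -> 0 < eps ->
  exists2 C, 0 <= C & forall M, 0 <= M -> M `^ q <= eps * M ^+ 4 + C.
Proof.
move=> /andP[q0 q4] e0; have r0 : 0 < 4 - q by lra.
pose s := (eps^-1) `^ ((4 - q)^-1).
have s0 : 0 < s by rewrite powR_gt0// invr_gt0.
exists (s `^ q); first exact: powR_ge0.
move=> M M0; have [Ms|sM] := leP M s.
  apply: (@le_trans _ _ (s `^ q)).
    by apply: ge0_ler_powR => //; rewrite ?nnegrE// ltW.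
  by rewrite lerDr mulr_ge0 ?exprn_ge0// ltW.
have Mp : 0 < M by exact: lt_trans sM.
apply: (@le_trans _ _ (eps * M ^+ 4)); last by rewrite lerDl powR_ge0.
have -> : M ^+ 4 = M `^ q * M `^ (4 - q).
  rewrite -powR_mulrn// -powRD; last by apply/implyP => _; rewrite gt_eqF.
  by congr (_ `^ _); ring.
rewrite mulrCA ler_pMr ?powR_gt0//.
have : s `^ (4 - q) <= M `^ (4 - q) by apply: ge0_ler_powR => //; rewrite ?nnegrE ltW.
rewrite /s -powRrM mulVf ?gt_eqF// powRr1 ?invr_ge0 ?(ltW e0)// => H.
by rewrite -(ler_pM2l e0) divff ?gt_eqF// in H.
Qed.

Lemma coercive p (m : R) : 4 <= p < 6 -> 0 < m -> exists C, forall f h, adm l f h ->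
  tsum (sqn l f) = m -> tsum (sqn l h) <= 4 * renergy l p f h + C.
Proof.
move=> /andP[p4 p6] m0; have hp : 2 < p <= 6 by apply/andP; split; lra.
have q04 : 0 < p - 2 < 4 by apply/andP; split; lra.
(* The potential term is at most B^(p-2) m / p with B^4 <= 16 m D and p - 2 < 4; this epsilon makes
   the share of D in it exactly D / 4. *)
have eps0 : 0 < p / (64 * m ^+ 2) by rewrite divr_gt0 ?mulr_gt0 ?exprn_gt0//; lra.
have [C C0 HC] := powR_absorb q04 eps0.
exists (4 * (p^-1 * (C * m))) => f h fh fm.
set D := tsum (sqn l h); pose B := Num.sqrt (2 * tsum (var2 l f h)).
have D0 : 0 <= D by apply: tsum_ge0; exact: adm_dirichlet fh.
have W2 := var2_sqr fh; rewrite fm -/D in W2.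
have B4 : B ^+ 4 <= 16 * (m * D).
  have W0 : 0 <= tsum (var2 l f h) by apply: tsum_ge0 (smb_var2 fh).
  rewrite (_ : B ^+ 4 = (B ^+ 2) ^+ 2); last by rewrite -exprM.
  rewrite sqr_sqrtr ?mulr_ge0// exprMn; lra.
have P1 : tsum (pwn l p f) <= B `^ (p - 2) * m.
  rewrite -fm -tsumZ ?powR_ge0//; last exact: adm_mass fh.
  apply: tsum_mono; last by apply: smbZ; [exact: powR_ge0|exact: adm_mass fh].
  by apply: (pwn_le l0 hp fh) => e x; exact: sup_bound.
have P2 := HC B (sqrtr_ge0 _).
have p0 : 0 < p by lra.
rewrite /renergy -/D.
have : p^-1 * tsum (pwn l p f) <= 4^-1 * D + p^-1 * (C * m).
  apply: (@le_trans _ _ (p^-1 * ((p / (64 * m ^+ 2) * (16 * (m * D)) + C) * m))).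
    rewrite ler_pM2l ?invr_gt0//; apply: (le_trans P1); rewrite ler_pM2r//.
    by apply: (le_trans P2); rewrite lerD2r ler_pM2l.
  rewrite le_eqVlt; apply/orP; left; apply/eqP; field.
  by rewrite !gt_eqF.
lra.
Qed.

End Energy.

(** * Localization and existence of minimizers *)

Section Localization.
Variables (R : realType) (l : R).
Hypothesis l0 : 0 < l.
Implicit Types (f h : hedge -> R -> R) (e : hedge) (p a : R).

Local Lemma localization_arith (sd d1 d2 d km pp P P1 P2 PX PT X : R) :
  d1 + d2 <= d + km -> sd <= d1 -> pp * P1 <= pp * PT ->
  pp * P <= pp * P1 + pp * P2 + pp * PX -> X <= 2^-1 * d2 - pp * P2 ->
  2^-1 * sd - pp * PT - pp * PX + X - 2^-1 * km <= 2^-1 * d - pp * P.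
Proof. lra. Qed.

Variable th : hvertex -> R.
Hypothesis th01 : forall w, 0 <= th w <= pi / 2.

Definition thslope e : R := (th (hhead e) - th (htail e)) / l.
Definition thf e (x : R) : R := th (htail e) + x * thslope e.

Lemma thf_0 e : thf e 0 = th (htail e).
Proof. by rewrite /thf mul0r addr0. Qed.

Lemma thf_l e : thf e l = th (hhead e).
Proof. by rewrite /thf /thslope mulrC divfK ?gt_eqF//; ring. Qed.

Lemma thf01 e x : 0 <= x <= l -> 0 <= thf e x <= pi / 2.
Proof.
move=> /andP[x0 xl]; have /andP[a0 a1] := th01 (htail e); have /andP[b0 b1] := th01 (hhead e).
have -> : thf e x = (1 - x / l) * th (htail e) + x / l * th (hhead e).
  by rewrite /thf /thslope; field; rewrite gt_eqF.
have t0 : 0 <= x / l by rewrite divr_ge0// ltW.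
have t1 : x / l <= 1 by rewrite ler_pdivrMr// mul1r.
set t := x / l in t0 t1 *; set a := th _ in a0 a1 *; set b := th _ in b0 b1 *.
by apply/andP; split; nra.
Qed.

Lemma thf_cst e c x : th (htail e) = c -> th (hhead e) = c -> thf e x = c /\ thslope e = 0.
Proof. by move=> ta tb; rewrite /thf /thslope ta tb subrr mul0r mulr0 addr0. Qed.

Lemma is_derive_thf e x : is_derive x (1 : R) (thf e) (thslope e).
Proof.
apply: (@is_derive_quad _ _ _ _ 0) => k; rewrite mul0r /thf.
by rewrite (_ : _ - _ = 0) ?normr0//; ring.
Qed.

Lemma continuous_thf e : continuous (thf e).
Proof.
move=> x; apply: differentiable_continuous; apply/derivable1_diffP.
by have [] := is_derive_thf e x.
Qed.

Lemma der_cos_thf e : der l (fun x => cos (thf e x)) (fun x => - sin (thf e x) * thslope e).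
Proof.
apply: C1_der.
  move=> x; have := @is_derive1_comp R cos (thf e) x _ _ (is_derive_cos _) (is_derive_thf e x).
  by [].
move=> x; apply: cvgMl; apply: cvgN.
by apply: (@continuous_comp _ _ _ (thf e) sin); [exact: continuous_thf|exact: continuous_sin].
Qed.

Lemma der_sin_thf e : der l (fun x => sin (thf e x)) (fun x => cos (thf e x) * thslope e).
Proof.
apply: C1_der.
  move=> x; have := @is_derive1_comp R sin (thf e) x _ _ (is_derive_sin _) (is_derive_thf e x).
  by [].
move=> x; apply: cvgMl.
by apply: (@continuous_comp _ _ _ (thf e) cos); [exact: continuous_thf|exact: continuous_cos].
Qed.

Definition cut1 f : hedge -> R -> R := fun e x => cos (thf e x) * f e x.
Definition cut2 f : hedge -> R -> R := fun e x => sin (thf e x) * f e x.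
Definition cutd1 f h : hedge -> R -> R :=
  fun e x => cos (thf e x) * h e x + f e x * (- sin (thf e x) * thslope e).
Definition cutd2 f h : hedge -> R -> R :=
  fun e x => sin (thf e x) * h e x + f e x * (cos (thf e x) * thslope e).

Lemma cos_thf01 e x : 0 <= x <= l -> 0 <= cos (thf e x) <= 1.
Proof.
move=> xl; have /andP[t0 t1] := thf01 e xl; rewrite cos_le1 andbT.
by apply: cos_ge0_pihalf; rewrite t1 andbT (le_trans _ t0)// oppr_le0 divr_ge0// pi_ge0.
Qed.

Lemma sin_thf01 e x : 0 <= x <= l -> 0 <= sin (thf e x) <= 1.
Proof.
move=> xl; have /andP[t0 t1] := thf01 e xl; rewrite sin_le1 andbT.
apply: sin_ge0_pi; rewrite t0 (le_trans t1)// ler_pdivrMr// ler_peMr ?pi_ge0//.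
by rewrite ler1n.
Qed.

Variables (f h : hedge -> R -> R) (kappa : R).
Hypothesis fh : adm l f h.
Hypothesis hk : forall e, thslope e ^+ 2 <= kappa.

(** At each point the two derivatives are the vector (f', th' f) rotated by the angle th. *)
Lemma cutd_sum e : sqn l (cutd1 f h) e + sqn l (cutd2 f h) e = sqn l h e + thslope e ^+ 2 * sqn l f e.
Proof.
have c1 := der_cts (der_cos_thf e); have c2 := der_cts (der_sin_thf e).
have cf := adm_cts fh (e := e); have [Lh _] := adm_der fh e.
have s1 : L2 0 l (fun x => - sin (thf e x) * thslope e) by case: (der_cos_thf e).
have s2 : L2 0 l (fun x => cos (thf e x) * thslope e) by case: (der_sin_thf e).
have L1 : L2 0 l (cutd1 f h e) by apply: L2D; exact: L2Ml.
have LL2 : L2 0 l (cutd2 f h e) by apply: L2D; exact: L2Ml.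
rewrite /sqn -itlD; [|exact: L1.2|exact: LL2.2].
rewrite -itlZ; last by apply: cts_itg; exact: ctsX.
rewrite -itlD; [|exact: Lh.2|by apply: itgZ; apply: cts_itg; exact: ctsX].
apply: eq_itl => x _; rewrite /cutd1 /cutd2.
have cs := cos2Dsin2 (thf e x); set c := cos _ in cs *; set s := sin _ in cs *.
have -> : h e x ^+ 2 + thslope e ^+ 2 * f e x ^+ 2 = (c ^+ 2 + s ^+ 2) * (h e x ^+ 2 + thslope e ^+ 2 * f e x ^+ 2).
  by rewrite cs mul1r.
by ring.
Qed.

Lemma cut_sum e : sqn l (cut1 f) e + sqn l (cut2 f) e = sqn l f e.
Proof.
have c1 := der_cts (der_cos_thf e); have c2 := der_cts (der_sin_thf e).
have cf := adm_cts fh (e := e).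
rewrite /sqn -itlD; [|by apply: cts_itg; apply: ctsX; exact: ctsM|by apply: cts_itg; apply: ctsX; exact: ctsM].
apply: eq_itl => x _; rewrite /cut1 /cut2.
have cs := cos2Dsin2 (thf e x); set c := cos _ in cs *; set s := sin _ in cs *.
have -> : f e x ^+ 2 = (c ^+ 2 + s ^+ 2) * f e x ^+ 2 by rewrite cs mul1r.
by ring.
Qed.

Lemma smb_cutd : smb (fun e => sqn l h e + kappa * sqn l f e) .
Proof.
have k0' : 0 <= kappa by apply: le_trans (hk ((0, 0), k0)); exact: sqr_ge0.
by apply: smbD; [exact: adm_dirichlet fh|apply: smbZ => //; exact: adm_mass fh].
Qed.

Lemma cutd_le e : sqn l (cutd1 f h) e + sqn l (cutd2 f h) e <= sqn l h e + kappa * sqn l f e.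
Proof. by rewrite cutd_sum lerD2l ler_wpM2r// sqn_ge0. Qed.

Lemma adm_cut1 : adm l (cut1 f) (cutd1 f h).
Proof.
have [v hv] := adm_vertex fh; split.
- by move=> e; apply: derM; [exact: ltW|exact: der_cos_thf|exact: adm_der fh e].
- by move=> e x xl; rewrite mulr_ge0 ?(adm_ge0 fh)//; case/andP: (cos_thf01 e xl).
- exists (fun w => cos (th w) * v w) => e; rewrite /cut1 thf_0 thf_l.
  by have [-> ->] := hv e.
- apply: smb_le (adm_mass fh) => e; rewrite -cut_sum lerDl; exact: sqn_ge0.
- apply: smb_le smb_cutd => e; apply: le_trans (cutd_le e); rewrite lerDl; exact: sqn_ge0.
Qed.

Lemma adm_cut2 : adm l (cut2 f) (cutd2 f h).
Proof.
have [v hv] := adm_vertex fh; split.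
- by move=> e; apply: derM; [exact: ltW|exact: der_sin_thf|exact: adm_der fh e].
- by move=> e x xl; rewrite mulr_ge0 ?(adm_ge0 fh)//; case/andP: (sin_thf01 e xl).
- exists (fun w => sin (th w) * v w) => e; rewrite /cut2 thf_0 thf_l.
  by have [-> ->] := hv e.
- apply: smb_le (adm_mass fh) => e; rewrite -cut_sum lerDr; exact: sqn_ge0.
- apply: smb_le smb_cutd => e; apply: le_trans (cutd_le e); rewrite lerDr; exact: sqn_ge0.
Qed.

Lemma dirichlet_cut : tsum (sqn l (cutd1 f h)) + tsum (sqn l (cutd2 f h)) <=
  tsum (sqn l h) + kappa * tsum (sqn l f).
Proof.
have k0' : 0 <= kappa by apply: le_trans (hk ((0, 0), k0)); exact: sqr_ge0.
have sf := adm_mass fh; have sh := adm_dirichlet fh.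
have s1 := adm_dirichlet adm_cut1; have s2 := adm_dirichlet adm_cut2.
rewrite -tsumZ// -!tsumD//; try (by move=> e; exact: sqn_ge0).
- by apply: tsum_mono; [exact: cutd_le|exact: smb_cutd].
- by move=> e; rewrite mulr_ge0// sqn_ge0.
- exact: smbZ.
Qed.

Lemma mass_cut : tsum (sqn l (cut1 f)) + tsum (sqn l (cut2 f)) = tsum (sqn l f).
Proof.
rewrite -tsumD; [|by move=> e; exact: sqn_ge0|by move=> e; exact: sqn_ge0|exact: adm_mass adm_cut1|exact: adm_mass adm_cut2].
by apply: eq_tsum => e; exact: cut_sum.
Qed.

(** Scaling up to mass [m] by a factor a >= 1 multiplies the energy by at most a^2, because a^p >=
    a^2. A function without mass has nonnegative energy. *)
Lemma energy_share p (e0 m : R) (g k : hedge -> R -> R) : 4 <= p <= 6 -> 0 < m -> e0 <= 0 ->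
  (forall g k, adm l g k -> tsum (sqn l g) = m -> e0 <= renergy l p g k) ->
  adm l g k -> tsum (sqn l g) <= m -> tsum (sqn l g) / m * e0 <= renergy l p g k.
Proof.
move=> /andP[p4 p6] m0 e00 He0 gk gm; have hp : 2 < p <= 6 by apply/andP; split; lra.
have pp : 0 < p^-1 by rewrite invr_gt0; lra.
set n := tsum (sqn l g); have n0 : 0 <= n by apply: tsum_ge0; exact: adm_mass gk.
set D := tsum (sqn l k); have D0 : 0 <= D by apply: tsum_ge0; exact: adm_dirichlet gk.
set P := tsum (pwn l p g); have P0 : 0 <= P by exact: (pwn_ge0_tsum l0 hp gk).
have [nz|nn] := eqVneq n 0.
  have [B B0 hB] := adm_bounded l0 gk.
  have : P <= B `^ (p - 2) * n.
    rewrite -tsumZ ?powR_ge0//; last exact: adm_mass gk.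
    apply: tsum_mono; first exact: (pwn_le l0 hp gk hB).
    by apply: smbZ; [exact: powR_ge0|exact: adm_mass gk].
  rewrite nz mulr0 => P00; have Pz : P = 0 by apply/eqP; rewrite eq_le P00.
  by rewrite !mul0r /renergy -/P -/D Pz mulr0 subr0 mulr_ge0// invr_ge0.
have np : 0 < n by rewrite lt_neqAle eq_sym nn.
pose a := Num.sqrt (m / n).
have a2 : a ^+ 2 = m / n by rewrite sqr_sqrtr// divr_ge0// ltW.
have a1 : 1 <= a by rewrite -sqrtr1 ler_wsqrtr// ler_pdivlMr// mul1r.
have a0 : 0 <= a by exact: le_trans a1.
have := He0 _ _ (adm_scale a0 gk); rewrite (mass_scale a gk) a2 -/n divfK// => /(_ erefl).
rewrite (renergy_scale l0 hp a0 gk) -/P -/D => H.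
have ap : a ^+ 2 <= a `^ p by rewrite -powR_mulrn//; apply: ler_powR => //; lra.
have H2 : e0 <= a ^+ 2 * renergy l p g k.
  apply: (le_trans H); rewrite /renergy -/P -/D.
  have : p^-1 * (a ^+ 2 * P) <= p^-1 * (a `^ p * P) by rewrite ler_pM2l// ler_wpM2r.
  by move=> ?; lra.
have nm : 0 <= n / m by rewrite divr_ge0// ltW.
have := ler_wpM2l nm H2; rewrite a2 mulrA.
by rewrite (_ : n / m * (m / n) = 1) ?mul1r//; field; rewrite !gt_eqF.
Qed.

(* The cut-offs [cos th * f] and [sin th * f] split the mass exactly and the Dirichlet integral up to
   [th'^2 f^2]; the far part is bounded below by its share of the level [e0]. *)
Lemma localized_energy p (e0 m : R) (S T : seq hedge) : 4 <= p <= 6 -> 0 < m -> e0 <= 0 ->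
  (forall g k, adm l g k -> tsum (sqn l g) = m -> e0 <= renergy l p g k) ->
  tsum (sqn l f) = m -> uniq S -> uniq T ->
  (forall e, e \in S -> th (htail e) = 0 /\ th (hhead e) = 0) ->
  (forall e, e \notin T -> th (htail e) = pi / 2 /\ th (hhead e) = pi / 2) ->
  2^-1 * \sum_(e <- S) sqn l h e - p^-1 * \sum_(e <- T) pwn l p f e
   - p^-1 * \sum_(e <- T | e \notin S) pwn l p f e
   + (1 - (\sum_(e <- S) sqn l f e) / m) * e0 - 2^-1 * kappa * m <= renergy l p f h.
Proof.
move=> hp m0 e00 He0 fm uS uT S0 T0.
have /andP[p4 p6] := hp; have hp2 : 2 < p <= 6 by apply/andP; split; lra.
have p16 : 1 <= p <= 6 by apply/andP; split; lra.
have pp : 0 < p^-1 by rewrite invr_gt0; lra.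
have a1 := adm_cut1; have a2 := adm_cut2.
have sP := adm_smb_pwn l0 hp2 fh.
have DE := dirichlet_cut; rewrite fm in DE.
have mE := mass_cut; rewrite fm in mE.
have D1 : \sum_(e <- S) sqn l h e <= tsum (sqn l (cutd1 f h)).
  rewrite big_seq (eq_bigr (fun e => sqn l (cutd1 f h) e)); last first.
    move=> e eS; have [t1 t2] := S0 _ eS; apply: eq_itl => x _.
    by have [tx ts] := thf_cst x t1 t2; rewrite /cutd1 tx ts cos0 mulr0 mulr0 addr0 mul1r.
  by rewrite -big_seq; apply: tsum_ge => //; exact: adm_dirichlet a1.
have M1 : \sum_(e <- S) sqn l f e <= tsum (sqn l (cut1 f)).
  rewrite big_seq (eq_bigr (fun e => sqn l (cut1 f) e)); last first.
    move=> e eS; have [t1 t2] := S0 _ eS; apply: eq_itl => x _.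
    by have [tx ts] := thf_cst x t1 t2; rewrite /cut1 tx cos0 mul1r.
  by rewrite -big_seq; apply: tsum_ge => //; exact: adm_mass a1.
have n2 : 0 <= tsum (sqn l (cut1 f)) by apply: tsum_ge0; exact: adm_mass a1.
have E2 : tsum (sqn l (cut2 f)) / m * e0 <= renergy l p (cut2 f) (cutd2 f h).
  by apply: energy_share => //; rewrite -mE lerDr.
(* The far part has mass at most [m] minus that on [S]; the sign of [e0] reverses the inequality. *)
have E2' : (1 - (\sum_(e <- S) sqn l f e) / m) * e0 <= tsum (sqn l (cut2 f)) / m * e0.
  apply: ler_wnM2r => //; rewrite ler_pdivrMr// mulrBl mul1r divfK ?gt_eqF//.
  by rewrite lerBrDr -mE addrC lerD2r.
have c1le e x : 0 <= x <= l -> cut1 f e x <= f e x.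
  by move=> xl; rewrite ler_piMl ?(adm_ge0 fh)//; case/andP: (cos_thf01 e xl).
have P1e e : pwn l p (cut1 f) e <= pwn l p f e.
  apply: itl_le; [by apply: cts_itg; exact: cts_powR a1|by apply: cts_itg; exact: cts_powR fh|].
  move=> x xl; apply: ge0_ler_powR; rewrite ?nnegrE ?(adm_ge0 fh) ?(adm_ge0 a1) ?c1le// (le_trans _ p4)//.
have P1 : tsum (pwn l p (cut1 f)) <= \sum_(e <- T) pwn l p f e.
  have z e : e \notin T -> pwn l p (cut1 f) e = 0.
    move=> eT; have [t1 t2] := T0 _ eT; rewrite /pwn (eq_itl (g := fun=> 0)).
      by rewrite itl_cst ?mul0r// ltW.
    move=> x _; have [tx _] := thf_cst x t1 t2; rewrite /cut1 tx cos_pihalf mul0r powR0//.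
    by rewrite gt_eqF// -invr_gt0.
  have [_ h1] := tsum_supp (fun e => pwn_ge0 l p (cut1 f) e) uT z.
  by apply: (le_trans h1); apply: ler_sum => e _.
(* On [S] the near part is all of [f], outside [T] the far part is; the transition edges are paid
   for in full. *)
have P : tsum (pwn l p f) <= tsum (pwn l p (cut1 f)) + tsum (pwn l p (cut2 f)) +
    \sum_(e <- T | e \notin S) pwn l p f e.
  pose T' := [seq e <- T | e \notin S].
  pose G e := if e \in T' then pwn l p f e else 0.
  have G0 e : 0 <= G e by rewrite /G; case: ifP => // _; exact: pwn_ge0.
  have [sG GT] := @tsum_supp _ _ G T' G0 (filter_uniq _ uT) (fun e he => ifN _ _ he).
  have -> : \sum_(e <- T | e \notin S) pwn l p f e = \sum_(e <- T') G e.
    rewrite /T' [RHS]big_filter [LHS]big_seq_cond [RHS]big_seq_cond; apply: eq_bigr => e /andP[eT eS].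
    by rewrite /G mem_filter eS eT.
  apply: (@le_trans _ _ (tsum (pwn l p (cut1 f)) + tsum (pwn l p (cut2 f)) + tsum G)); last by rewrite lerD2l.
  have s1 := adm_smb_pwn l0 hp2 a1; have s2 := adm_smb_pwn l0 hp2 a2.
  have pw1 : forall e, 0 <= pwn l p (cut1 f) e by move=> e; exact: pwn_ge0.
  have pw2 : forall e, 0 <= pwn l p (cut2 f) e by move=> e; exact: pwn_ge0.
  have pw12 : forall e, 0 <= pwn l p (cut1 f) e + pwn l p (cut2 f) e by move=> e; rewrite addr_ge0.
  rewrite -(tsumD pw1 pw2 s1 s2) -(tsumD pw12 G0 (smbD s1 s2) sG).
  - apply: tsum_mono; last by apply: smbD => //; exact: smbD.
    move=> e; have [eS|eS] := boolP (e \in S).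
      have [t1 t2] := S0 _ eS; have -> : pwn l p (cut1 f) e = pwn l p f e.
        by apply: eq_itl => x _; have [tx _] := thf_cst x t1 t2; rewrite /cut1 tx cos0 mul1r.
      by rewrite -addrA lerDl addr_ge0// pwn_ge0.
    have [eT|eT] := boolP (e \in T).
      rewrite /G mem_filter eS eT lerDr addr_ge0// pwn_ge0//.
    have [t1 t2] := T0 _ eT; have -> : pwn l p (cut2 f) e = pwn l p f e.
      by apply: eq_itl => x _; have [tx _] := thf_cst x t1 t2; rewrite /cut2 tx sin_pihalf mul1r.
    by rewrite addrAC lerDr addr_ge0// pwn_ge0.
have := E2; rewrite /renergy => {}E2.
have Q1 := ler_wpM2l (ltW pp) P1; have Q := ler_wpM2l (ltW pp) P.
rewrite !mulrDr in Q.
by rewrite -(mulrA 2^-1 kappa m); exact: localization_arith DE D1 Q1 Q (le_trans E2' E2).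
Qed.

End Localization.

(* Limits along an ultrafilter exist simultaneously at all points of all edges, so that no
   diagonal extraction is needed. *)
Section UltraLimits.
Variables (R : realType) (U : set_system nat).
Hypothesis UU : UltraFilter U.

Let PU : ProperFilter U. Proof. exact: ultra_proper. Qed.
Existing Instance PU.

Lemma ulim_ex (u : nat -> R) B : (forall n, `|u n| <= B) -> cvg (u n @[n --> U]).
Proof.
move=> uB; have /(_ (u @ U)) := @segment_compact R (- B) B.
move=> /(_ _ _)[|x [_ cx]].
  change (U [set n | `[- B, B]%classic (u n)]); apply: filterE => n.
  by rewrite /= in_itv /= -ler_norml; exact: uB.
apply/cvg_ex; exists x => V nV; rewrite /nbhs /=.
have [//|nU] := in_ultra_setVsetC (u @^-1` V) UU.
have : (u @ U) (~` V) by [].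
by move=> /cx /(_ nV) [y [/[apply]]].
Qed.

Lemma cvg_sum_seq (T : Type) (s : seq T) (P : pred T) (a : nat -> T -> R) (b : T -> R) :
  (forall e, P e -> a n e @[n --> U] --> b e) ->
  \sum_(e <- s | P e) a n e @[n --> U] --> \sum_(e <- s | P e) b e.
Proof.
move=> ab; elim: s => [|e s IH].
  rewrite big_nil; under eq_fun do rewrite big_nil; exact: cvg_cst.
rewrite big_cons; under eq_fun do rewrite big_cons.
by case: ifP => // Pe; apply: cvgD => //; exact: ab.
Qed.

Variable l : R.
Hypothesis l0 : 0 < l.

Lemma holder_lim (g : nat -> R -> R) (f : R -> R) C :
  (forall n x y, 0 <= x -> x <= y -> y <= l -> (g n y - g n x) ^+ 2 <= (y - x) * C) ->
  (forall x, 0 <= x <= l -> g n x @[n --> U] --> f x) ->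
  forall x y, 0 <= x -> x <= y -> y <= l -> (f y - f x) ^+ 2 <= (y - x) * C.
Proof.
move=> gC gf x y x0 xy yl.
have gx : g n x @[n --> U] --> f x by apply: gf; rewrite x0 (le_trans xy).
have gy : g n y @[n --> U] --> f y by apply: gf; rewrite yl (le_trans x0).
have : (g n y - g n x) ^+ 2 @[n --> U] --> (f y - f x) ^+ 2.
  by rewrite expr2; under eq_fun do rewrite expr2; apply: cvgM; exact: cvgB.
by move/cvgr_to_le; apply; apply: nearW => n; exact: gC.
Qed.

(** Arzela-Ascoli along a filter: finitely many nodes converge simultaneously, and between nodes the
    common Hoelder bound controls both the sequence and its limit. *)
Lemma equi_unif (g : nat -> R -> R) (f : R -> R) C : 0 <= C ->
  (forall n x y, 0 <= x -> x <= y -> y <= l -> (g n y - g n x) ^+ 2 <= (y - x) * C) ->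
  (forall x, 0 <= x <= l -> g n x @[n --> U] --> f x) ->
  forall eps, 0 < eps -> \forall n \near U, forall x, 0 <= x <= l -> `|g n x - f x| <= eps.
Proof.
move=> C0 gC gf eps e0; have e3 : 0 < eps / 3 by rewrite divr_gt0.
have fC := holder_lim gC gf.
have C1 : 0 < C + 1 by rewrite ltr_wpDl.
have dlt0 : 0 < (eps / 3) ^+ 2 / (C + 1) by rewrite divr_gt0 ?exprn_gt0.
pose N := (Num.trunc (l / ((eps / 3) ^+ 2 / (C + 1)))).+1.
have N0 : (0 < N)%N by [].
have mesh : l / N%:R * (C + 1) < (eps / 3) ^+ 2.
  rewrite -ltr_pdivlMr// ltr_pdivrMr ?ltr0n// mulrC -ltr_pdivrMr//.
  exact: truncnS_gt.
have osc (k : R -> R) : (forall x y, 0 <= x -> x <= y -> y <= l -> (k y - k x) ^+ 2 <= (y - x) * C) ->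
    forall x y, 0 <= x -> x <= y -> y <= l -> y - x <= l / N%:R -> `|k y - k x| <= eps / 3.
  move=> kC x y x0 xy yl yx.
  rewrite -(ler_pXn2r (n := 2)) ?nnegrE ?(ltW e3) ?normr_ge0// real_normK ?num_real//.
  apply: (le_trans (kC _ _ x0 xy yl)); apply: le_trans (ltW mesh).
  apply: (@le_trans _ _ (l / N%:R * C)); first by rewrite ler_wpM2r.
  by rewrite ler_wpM2l ?divr_ge0 ?(ltW l0)// lerDl.
have : \forall n \near U, forall i : 'I_N.+1, `|g n (gp l N i) - f (gp l N i)| <= eps / 3.
  apply: filter_forall => i.
  have gi : 0 <= gp l N i <= l by rewrite (gp_ge0 l0)//= (gp_lel l0)// -ltnS.
  have /cvgrPdist_le/(_ _ e3) := gf _ gi; apply: filterS => n.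
  by rewrite distrC.
apply: filterS => n Hn x /andP[x0 xl].
have m0 := mesh_gt0 l0 N0.
pose i := Num.trunc (x / (l / N%:R)).
have ix : gp l N i <= x by rewrite /gp -ler_pdivlMr// truncn_le// divr_ge0// ltW.
have xi : x - gp l N i <= l / N%:R.
  rewrite lerBlDr -{1}(gpS l N i) subrK ltW// /gp -ltr_pdivrMr// truncnS_gt//.
have iN : (i < N.+1)%N.
  rewrite ltnS -(ler_nat R) -(ler_pM2r m0) -/(gp _ _) (le_trans ix)//.
  by rewrite mulrC divfK// pnatr_eq0 -lt0n.
have h1 := Hn (Ordinal iN); rewrite /= in h1.
have h2 := osc _ (gC n) _ _ (gp_ge0 l0 i N0) ix xl xi.
have h3 := osc _ fC _ _ (gp_ge0 l0 i N0) ix xl xi.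
have -> : g n x - f x = (g n x - g n (gp l N i)) + (g n (gp l N i) - f (gp l N i)) - (f x - f (gp l N i)) by ring.
apply: (le_trans (ler_normB _ _)); apply: (@le_trans _ _ ((eps / 3 + eps / 3) + eps / 3)).
  by apply: lerD => //; apply: (le_trans (ler_normD _ _)); exact: lerD.
by rewrite le_eqVlt; apply/orP; left; apply/eqP; field.
Qed.

Lemma pwn_cvg (q B : R) (g : nat -> R -> R) (f : R -> R) : 1 <= q <= 6 ->
  (forall n, cts 0 l (g n)) -> cts 0 l f ->
  (forall n x, 0 <= x <= l -> 0 <= g n x <= B) -> (forall x, 0 <= x <= l -> 0 <= f x <= B) ->
  (forall eps, 0 < eps -> \forall n \near U, forall x, 0 <= x <= l -> `|g n x - f x| <= eps) ->
  itl 0 l (fun x => g n x `^ q) @[n --> U] --> itl 0 l (fun x => f x `^ q).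
Proof.
move=> q16 cg cf gB fB unif; apply/cvgrPdist_le => eps e0.
have b0 : 0 <= 6 * B `^ (q - 1) by rewrite mulr_ge0// powR_ge0.
set L := 6 * B `^ (q - 1) in b0.
have d0 : 0 < eps / ((L + 1) * l) by rewrite divr_gt0// mulr_gt0// ltr_wpDl.
have cp (k : R -> R) : cts 0 l k -> (forall x, 0 <= x <= l -> 0 <= k x <= B) -> itg 0 l (fun x => k x `^ q).
  move=> ck kB; apply: cts_itg; apply: (@cts_lip _ 0 l k (fun t => t `^ q) L) => // x y xl yl.
  by apply: powR_lipN => //; exact: kB.
have i2 := cp _ cf fB.
have := unif _ d0; apply: filterS => n Hn.
have i1 := cp _ (cg n) (gB n).
rewrite -itlB//; have iB : itg 0 l (fun x => f x `^ q - g n x `^ q) by exact: itgB.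
apply: (le_trans (itl_norm iB)).
apply: (@le_trans _ _ (itl 0 l (fun=> L * (eps / ((L + 1) * l))))).
  apply: itl_le; [exact: itg_norm|by apply: cts_itg; exact: cts_cst|].
  move=> x xl; apply: (le_trans (powR_lipN q16 (gB n x xl) (fB x xl))).
  by rewrite ler_wpM2l// distrC Hn.
rewrite itl_cst ?(ltW l0)// subr0.
have -> : L * (eps / ((L + 1) * l)) * l = eps * (L / (L + 1)).
  by field; rewrite !gt_eqF// ltr_wpDl.
by rewrite ler_piMr ?(ltW e0)// ler_pdivrMr ?ltr_wpDl// mul1r lerDl.
Qed.

End UltraLimits.

(** * Translations of the honeycomb *)

Section Translation.
Variables (R : realType) (l : R).
Implicit Types (f h : hedge -> R -> R).

Definition trv (w v : int * int) : int * int := (v.1 + w.1, v.2 + w.2).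
Definition tre w (e : hedge) : hedge := (trv w e.1, e.2).
Definition tr w f : hedge -> R -> R := fun e => f (tre w e).

Lemma trvK w : cancel (trv w) (trv (- w.1, - w.2)).
Proof. by move=> [a b]; rewrite /trv /= !addrK. Qed.

Lemma trvVK w : cancel (trv (- w.1, - w.2)) (trv w).
Proof. by move=> [a b]; rewrite /trv /= !addrNK. Qed.

Lemma treK w : cancel (tre w) (tre (- w.1, - w.2)).
Proof. by move=> [v k]; rewrite /tre /= trvK. Qed.

Lemma treVK w : cancel (tre (- w.1, - w.2)) (tre w).
Proof. by move=> [v k]; rewrite /tre /= trvVK. Qed.

Lemma tsum_tr w (a : hedge -> R) : smb a -> smb (fun e => a (tre w e)) /\ tsum (fun e => a (tre w e)) = tsum a.
Proof. exact: (tsum_bij (treK w) (treVK w)). Qed.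

Lemma hhead_tre w e : hhead (tre w e) = match hhead e with inl v => inl v | inr v => inr (trv w v) end.
Proof.
case: e => v k; case: (ord3P k) => ->; case: v => a b; rewrite /tre /trv /hhead /=; congr (inr (_, _)); ring.
Qed.

Lemma adm_tr w f h : adm l f h -> adm l (tr w f) (tr w h).
Proof.
move=> fh; have [v hv] := adm_vertex fh; split.
- by move=> e; exact: adm_der fh _.
- by move=> e; exact: adm_ge0 fh _.
- exists (fun x => match x with inl y => v (inl (trv w y)) | inr y => v (inr (trv w y)) end) => e.
  rewrite /tr; have [-> ->] := hv (tre w e); rewrite hhead_tre; split=> //.
  by case: e => -[a b] k.
- exact: (tsum_tr w (adm_mass fh)).1.
- exact: (tsum_tr w (adm_dirichlet fh)).1.
Qed.

End Translation.

(** * Cut-off angles and finite boxes *)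

Section Cutoff.
Variable R : realType.

(** A substitute for the graph distance, sharing with it what matters: variation at most 1 along an
    edge and finite balls. *)
Definition hdist (w : hvertex) : nat :=
  match w with inl v | inr v => (`|v.1|%N + `|v.2|%N)%N end.

Lemma hdist_adj e : (hdist (hhead e) <= hdist (htail e) + 1)%N /\ (hdist (htail e) <= hdist (hhead e) + 1)%N.
Proof.
case: e => v k; case: (ord3P k) => ->; case: v => a b; rewrite /hhead /htail /=; split; lia.
Qed.

Definition clamp01 (x : R) : R := Num.max 0 (Num.min 1 x).

Lemma clamp01_itv x : 0 <= clamp01 x <= 1.
Proof. by rewrite /clamp01 le_max lexx /= ge_max ler01 ge_min lexx. Qed.

Lemma clamp01_lip x y : `|clamp01 x - clamp01 y| <= `|x - y|.
Proof.
wlog xy : x y / x <= y.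
  move=> H; have [xy|yx] := leP x y; first exact: H.
  by rewrite distrC [leRHS]distrC; apply: H; exact: ltW.
rewrite distrC [leRHS]distrC [leRHS]ger0_norm ?subr_ge0// ler_norml.
rewrite /clamp01; case: (leP 1 x) => x1; case: (leP 1 y) => y1;
case: (leP 0 (1 : R)) => z0; case: (leP 0 x) => x0; case: (leP 0 y) => y0;
  by apply/andP; split; lra.
Qed.

(** The angle rises from 0 at distance N + 1 to pi / 2 at distance 2 (N + 1), so its slope is of
    order 1 / N. *)
Definition cutoff (N : nat) (w : hvertex) : R :=
  pi / 2 * clamp01 (((hdist w)%:R - N.+1%:R) / N.+1%:R).

Lemma cutoff01 N w : 0 <= cutoff N w <= pi / 2.
Proof.
have /andP[c0 c1] := clamp01_itv (((hdist w)%:R - N.+1%:R) / N.+1%:R).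
have p0 : 0 <= pi / 2 :> R by rewrite divr_ge0// pi_ge0.
by rewrite /cutoff mulr_ge0//= ler_piMr.
Qed.

Lemma cutoff_near N w : (hdist w <= N)%N -> cutoff N w = 0.
Proof.
move=> wN; rewrite /cutoff /clamp01; have : ((hdist w)%:R - N.+1%:R) / N.+1%:R <= 0 :> R.
  by rewrite pmulr_lle0 ?invr_gt0 ?ltr0n// subr_le0 ler_nat (leq_trans wN).
move=> c0; rewrite (_ : Num.max _ _ = 0) ?mulr0//; apply/max_idPl.
by rewrite ge_min c0 orbT.
Qed.

Lemma cutoff_far N w : (2 * N.+1 <= hdist w)%N -> cutoff N w = pi / 2.
Proof.
move=> wN; rewrite /cutoff /clamp01; have : 1 <= ((hdist w)%:R - N.+1%:R) / N.+1%:R :> R.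
  by rewrite ler_pdivlMr ?ltr0n// mul1r lerBrDr -natrD ler_nat addnn -mul2n.
move=> c1; rewrite (_ : Num.max _ _ = 1) ?mulr1//.
by rewrite (_ : Num.min _ _ = 1); [apply/max_idPr|apply/min_idPl].
Qed.

Lemma cutoff_slope (l : R) N e : 0 < l -> thslope l (cutoff N) e ^+ 2 <= (2 / (N.+1%:R * l)) ^+ 2.
Proof.
move=> l0; rewrite -[_ ^+ 2 in leLHS]real_normK ?num_real// lerXn2r ?nnegrE ?divr_ge0 ?mulr_ge0 ?(ltW l0)//.
rewrite /thslope normrM normfV (gtr0_norm l0) ler_pdivrMr//.
have -> : 2 / (N.+1%:R * l) * l = 2 * N.+1%:R^-1 :> R by rewrite invfM -!mulrA mulVf ?gt_eqF// mulr1.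
rewrite /cutoff -mulrBr normrM.
have p2 : `|pi / 2| <= 2 :> R.
  by rewrite ger0_norm ?divr_ge0 ?pi_ge0// ltW// pihalf_lt2.
apply: ler_pM => //; apply: (le_trans (clamp01_lip _ _)).
rewrite -mulrBl normrM normfV [`|N.+1%:R|]ger0_norm// ler_piMl ?invr_ge0//.
have -> : (hdist (hhead e))%:R - N.+1%:R - ((hdist (htail e))%:R - N.+1%:R) =
  (hdist (hhead e))%:R - (hdist (htail e))%:R :> R by ring.
have [h1 h2] := hdist_adj e; rewrite ler_norml.
have {}h1 : (hdist (hhead e))%:R <= (hdist (htail e))%:R + 1 :> R by rewrite natr1 -addn1 ler_nat.
have {}h2 : (hdist (htail e))%:R <= (hdist (hhead e))%:R + 1 :> R by rewrite natr1 -addn1 ler_nat.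
by apply/andP; split; lra.
Qed.

(** 0 occurs in both halves, hence [undup]. *)
Definition int_box (K : nat) : seq int := undup (map Posz (iota 0 K.+1) ++ map (fun i => - Posz i) (iota 0 K.+1)).

Lemma mem_int_box K i : (`|i| <= K)%N -> i \in int_box K.
Proof.
move=> iK; rewrite mem_undup mem_cat; case: i iK => [n|n] nK.
  by rewrite map_f// mem_iota.
apply/orP; right; apply/mapP; exists n.+1; first by rewrite mem_iota.
by rewrite NegzE.
Qed.

Definition edge_box (K : nat) : seq hedge :=
  [seq (v, k) | v <- [seq (i, j) | i <- int_box K, j <- int_box K], k <- enum 'I_3].

Lemma edge_box_uniq K : uniq (edge_box K).
Proof.
apply: allpairs_uniq; last by move=> [? ?] [? ?] _ _ [-> ->].
  apply: allpairs_uniq; rewrite ?undup_uniq//; by move=> [? ?] [? ?] _ _ [-> ->].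
exact: enum_uniq.
Qed.

Lemma edge_box_far N e : e \notin edge_box (2 * N.+1) ->
  cutoff N (htail e) = pi / 2 /\ cutoff N (hhead e) = pi / 2.
Proof.
move=> eb; suff H : (2 * N.+1 < hdist (htail e))%N.
  split; apply: cutoff_far; first exact: ltnW.
  by have [_ h2] := hdist_adj e; have := leq_trans H h2; rewrite addn1 ltnS.
rewrite ltnNge; apply/negP => H; move/negP: eb; apply.
case: e H => -[a b] k; rewrite /htail /= => H.
apply/allpairsP; exists ((a, b), k); split=> //=; last exact: mem_enum.
by apply/allpairsP; exists (a, b); split=> //=; apply: mem_int_box; rewrite (leq_trans _ H)// ?leq_addr ?leq_addl.
Qed.

Lemma cutoff_on (S : seq hedge) : exists N0, forall N, (N0 <= N)%N ->
  forall e, e \in S -> cutoff N (htail e) = 0 /\ cutoff N (hhead e) = 0.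
Proof.
(* The sum dominates each of the distances involved. *)
exists (\sum_(e <- S) (hdist (htail e) + hdist (hhead e)))%N => N NN e eS.
have : (hdist (htail e) + hdist (hhead e) <= N)%N.
  by apply: leq_trans NN; rewrite (big_rem e)//= leq_addr.
move=> h; split; apply: cutoff_near; apply: leq_trans h; [exact: leq_addr|exact: leq_addl].
Qed.

End Cutoff.

(** * Existence of a minimizer for a nonvanishing minimizing sequence *)

Section Existence.
Variables (R : realType) (l : R).
Hypothesis l0 : 0 < l.
Implicit Types (f h : hedge -> R -> R) (e : hedge).

(** Cauchy-Schwarz on each cell. The left-hand side involves finitely many values of [f], so the
    bound passes to pointwise limits. *)
Lemma grid_energy_le (f h : R -> R) n : (0 < n)%N -> der l f h ->
  grid_energy l f n <= itl 0 l (fun x => h x ^+ 2).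
Proof.
move=> n0 fh; rewrite /grid_energy -[in leRHS](gpn l n0).
suff S j : (j <= n)%N -> \sum_(i < j) (f (gp l n i.+1) - f (gp l n i)) ^+ 2 / (l / n%:R) <=
    itl 0 (gp l n j) (fun x => h x ^+ 2) by exact: S.
elim: j => [|j IH] jn; first by rewrite big_ord0 gp0 itl_id.
have m0 := mesh_gt0 l0 n0; have jl := gp_lel l0 n0 jn.
have sp : 0 <= gp l n j <= gp l n j.+1 by rewrite gp_ge0//= gp_le.
rewrite big_ord_recr /= (itl_split sp); last exact: itg_sub fh.1.2.
apply: lerD; first by apply: IH; exact: ltnW.
rewrite ler_pdivrMr// mulrC -(gpS l n j); apply: (der_CS fh) => //; first exact: gp_ge0.
exact: gp_le.
Qed.

Lemma sup_pos_mass f h e x : adm l f h -> 0 <= x <= l -> f e x != 0 -> 0 < tsum (sqn l f).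
Proof.
move=> fh xl fx; rewrite lt_neqAle tsum_ge0 ?andbT; last exact: adm_mass fh.
apply/negP => /eqP mz; move/eqP: fx; apply.
have W2 := var2_sqr fh; rewrite -mz mul0r mulr0 in W2.
have Wz : tsum (var2 l f h) = 0 by apply/eqP; rewrite -sqrf_eq0 eq_le W2 sqr_ge0.
have := sup_le_var2 l0 fh e xl; rewrite Wz mulr0 => H.
by apply/eqP; rewrite -sqrf_eq0 eq_le H sqr_ge0.
Qed.

(** The limit [f] is nonzero with mass nu <= m, and the localized inequality gives E(f) <= (nu / m)
    e0. Rescaling [f] to mass [m] would beat the lower bound [e0] unless nu = m. *)
Theorem minimizer_exists (p m e0 C c : R) (F H : nat -> hedge -> R -> R) :
  4 <= p <= 6 -> 0 < m -> e0 <= 0 -> 0 < c ->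
  (forall g k, adm l g k -> tsum (sqn l g) = m -> e0 <= renergy l p g k) ->
  (forall n, adm l (F n) (H n)) -> (forall n, tsum (sqn l (F n)) = m) ->
  (forall n, tsum (sqn l (H n)) <= C) ->
  renergy l p (F n) (H n) @[n --> \oo] --> e0 ->
  (forall n, exists e, exists2 x, 0 <= x <= l & c <= F n e x) ->
  exists f h, [/\ adm l f h, tsum (sqn l f) = m & renergy l p f h <= e0].
Proof.
move=> hp m0 e00 c0 He0.
(* By translation invariance the points where [F n >= c] may be moved to the three edges leaving
   a_(0,0). *)
wlog : F H / forall n, exists k, exists2 x, 0 <= x <= l & c <= F n ((0, 0), k) x.
  move=> W aFH mF dH EF sF.
  have /choice[w hw] : forall n, exists w : int * int, exists k, exists2 x, 0 <= x <= l & c <= F n (w, k) x.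
    by move=> n; have [[v k] [x xl cx]] := sF n; exists v, k, x.
  have /andP[p4 p6] := hp; have hp2 : 2 < p <= 6 by apply/andP; split; lra.
  have sm n := tsum_tr (w n) (adm_mass (aFH n)); have sd n := tsum_tr (w n) (adm_dirichlet (aFH n)).
  have sp n := tsum_tr (w n) (adm_smb_pwn l0 hp2 (aFH n)).
  apply: (W (fun n => tr (w n) (F n)) (fun n => tr (w n) (H n))).
  - move=> n; have [k [x xl cx]] := hw n; exists k, x => //.
    by rewrite /tr /tre /trv /= !add0r -surjective_pairing.
  - by move=> n; exact: adm_tr.
  - by move=> n; rewrite -(mF n) -(sm n).2.
  - by move=> n; apply: le_trans (dH n); rewrite -(sd n).2.
  - have -> : (fun n => renergy l p (tr (w n) (F n)) (tr (w n) (H n))) = (fun n => renergy l p (F n) (H n)).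
      apply/funext => n; rewrite /renergy.
      have -> : tsum (sqn l (tr (w n) (H n))) = tsum (sqn l (H n)) by exact: (sd n).2.
      by have -> : tsum (pwn l p (tr (w n) (F n))) = tsum (pwn l p (F n)) by exact: (sp n).2.
    exact: EF.
  - move=> n; have [k [x xl cx]] := hw n; exists ((0, 0), k), x => //.
    by rewrite /tr /tre /trv /= !add0r -surjective_pairing.
move=> near0 aFH mF dH EF _.
have /andP[p4 p6] := hp; have hp2 : 2 < p <= 6 by apply/andP; split; lra.
have p16 : 1 <= p <= 6 by apply/andP; split; lra.
have pp : 0 < p^-1 by rewrite invr_gt0; lra.
have [U [UU sU]] := ultraFilterLemma eventually_filter.
have PU : ProperFilter U by exact: ultra_proper.
have EFU : renergy l p (F n) (H n) @[n --> U] --> e0 by apply: cvg_trans EF => A; exact: sU.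
have C0 : 0 <= C by apply: le_trans (dH 0%N); apply: tsum_ge0; exact: adm_dirichlet (aFH 0%N).
pose B := Num.sqrt (2 * Num.sqrt (4 * (m * C))).
have FB n e x : 0 <= x <= l -> 0 <= F n e x <= B.
  move=> xl; rewrite (adm_ge0 (aFH n))//=; apply: (le_trans (sup_bound l0 e (aFH n) xl)).
  apply: ler_wsqrtr; rewrite ler_pM2l//.
  have W0 : 0 <= tsum (var2 l (F n) (H n)) by apply: tsum_ge0 (smb_var2 (aFH n)).
  rewrite -[leLHS]ger0_norm// -sqrtr_sqr; apply: ler_wsqrtr.
  apply: (le_trans (var2_sqr (aFH n))); rewrite mF ler_pM2l// ler_pM2l//; exact: dH.
have He n e : sqn l (H n) e <= C.
  by apply: le_trans (dH n); apply: tsum_ge1; exact: adm_dirichlet (aFH n).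
have Hol n e x y : 0 <= x -> x <= y -> y <= l -> (F n e y - F n e x) ^+ 2 <= (y - x) * C.
  move=> x0 xy yl; apply: (le_trans (der_sqr (adm_der (aFH n) e) x0 xy yl)).
  by rewrite ler_wpM2l ?subr_ge0//; exact: He.
pose f e x := lim (F n e x @[n --> U]).
have Ff e x : 0 <= x <= l -> F n e x @[n --> U] --> f e x.
  move=> xl; apply: (@ulim_ex _ _ UU _ B) => n; have /andP[a b] := FB n e x xl.
  by rewrite ger0_norm.
pose d e := lim (sqn l (H n) e @[n --> U]).
have Hd e : sqn l (H n) e @[n --> U] --> d e.
  by apply: (@ulim_ex _ _ UU _ C) => n; rewrite ger0_norm ?sqn_ge0.
have fHol e : forall x y, 0 <= x -> x <= y -> y <= l -> (f e y - f e x) ^+ 2 <= (y - x) * C.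
  by apply: (holder_lim UU) => [n|]; [exact: Hol|exact: Ff].
have cf e : cts 0 l (f e) by apply: ucont_cts; exact: sqr_int_ucont C0 (fHol e).
have fB e x : 0 <= x <= l -> 0 <= f e x <= B.
  move=> xl; apply/andP; split.
    by move/cvgr_to_ge: (Ff e x xl); apply; apply: nearW => n; case/andP: (FB n e x xl).
  by move/cvgr_to_le: (Ff e x xl); apply; apply: nearW => n; case/andP: (FB n e x xl).
have /choice[h hP] : forall e, exists h : R -> R, der l (f e) h /\ itl 0 l (fun x => h x ^+ 2) <= d e.
  move=> e; apply: riesz_criterion => // N; set n := (2 ^ N)%N.
  have n0 : (0 < n)%N by rewrite expn_gt0.
  have : grid_energy l (F k e) n @[k --> U] --> grid_energy l (f e) n.
    apply: (@cvg_sum_seq _ _ UU) => i _; apply: cvgMl.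
    rewrite expr2; under eq_fun do rewrite expr2.
    have q1 : 0 <= gp l n i <= l by rewrite gp_ge0//= gp_lel// ltnW.
    have q2 : 0 <= gp l n i.+1 <= l by rewrite gp_ge0//= gp_lel.
    by apply: cvgM; apply: cvgB; exact: Ff.
  move=> /ler_cvg_to /(_ (Hd e)); apply; apply: nearW => k.
  by apply: grid_energy_le => //; exact: adm_der.
have unif e := equi_unif UU l0 C0 (fun n => Hol n e) (Ff e).
have Fpwn q e : 1 <= q <= 6 -> pwn l q (F n) e @[n --> U] --> pwn l q f e.
  move=> q16; apply: (@pwn_cvg _ _ UU l l0 q B) => //.
  - by move=> n; exact: adm_cts (aFH n).
  - by move=> n; exact: FB.
  - exact: fB.
  - exact: unif.
have Fsqn e : sqn l (F n) e @[n --> U] --> sqn l f e.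
  rewrite -pwn2; last by move=> x xl; case/andP: (fB e x xl).
  have -> : (fun n => sqn l (F n) e) = (fun n => pwn l 2 (F n) e).
    by apply/funext => n; rewrite pwn2//; exact: adm_ge0.
  by apply: Fpwn; apply/andP; split; lra.
have sumf s : uniq s -> \sum_(e <- s) sqn l f e <= m.
  move=> us; have : \sum_(e <- s) sqn l (F n) e @[n --> U] --> \sum_(e <- s) sqn l f e.
    by apply: (@cvg_sum_seq _ _ UU) => e _; exact: Fsqn.
  move/cvgr_to_le; apply; apply: nearW => n; rewrite -(mF n).
  by apply: tsum_ge => //; exact: adm_mass (aFH n).
have sumh s : uniq s -> \sum_(e <- s) sqn l h e <= C.
  move=> us; apply: (@le_trans _ _ (\sum_(e <- s) d e)); first by apply: ler_sum => e _; exact: (hP e).2.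
  have : \sum_(e <- s) sqn l (H n) e @[n --> U] --> \sum_(e <- s) d e.
    by apply: (@cvg_sum_seq _ _ UU) => e _; exact: Hd.
  move/cvgr_to_le; apply; apply: nearW => n; apply: le_trans (dH n).
  by apply: tsum_ge => //; exact: adm_dirichlet (aFH n).
have fh : adm l f h.
  split.
  - by move=> e; exact: (hP e).1.
  - by move=> e x xl; case/andP: (fB e x xl).
  - have /choice[v hv] : forall n, exists v : hvertex -> R, forall e, F n e 0 = v (htail e) /\ F n e l = v (hhead e).
      by move=> n; exact: adm_vertex (aFH n).
    exists (fun w => lim (v n w @[n --> U])) => e; rewrite /f; split; congr (lim (_ @ U)).
      by apply/funext => n; have [] := hv n e.
    by apply/funext => n; have [] := hv n e.
  - by exists m.
  - by exists C.
have sm := adm_mass fh; have sd := adm_dirichlet fh; have sP := adm_smb_pwn l0 hp2 fh.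
set P := tsum (pwn l p f); set D := tsum (sqn l h); set nu := tsum (sqn l f).
have local (S : seq hedge) eps : uniq S -> 0 < eps ->
    2^-1 * \sum_(e <- S) sqn l h e - p^-1 * P - p^-1 * (P - \sum_(e <- S) pwn l p f e)
    - (\sum_(e <- S) sqn l f e) / m * e0 <= eps.
  move=> uS eps0; have [N0 hN0] := cutoff_on R S.
  (* So large that the Dirichlet cost of the cut-off is at most [eps]. *)
  pose N := maxn N0 (Num.trunc (2 * m / (l ^+ 2 * eps))).
  have hS := hN0 N (leq_maxl _ _).
  set T := edge_box (2 * N.+1); have uT : uniq T by exact: edge_box_uniq.
  set K := (2 / (N.+1%:R * l)) ^+ 2.
  have Keps : 2^-1 * K * m <= eps.
    have l2 : 0 < l ^+ 2 by rewrite exprn_gt0.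
    have n0 : (0 : R) < N.+1%:R by rewrite ltr0n.
    have n1 : (1 : R) <= N.+1%:R by rewrite ler1n.
    have -> : 2^-1 * K * m = (2 * m / l ^+ 2) / N.+1%:R ^+ 2.
      by rewrite /K exprMn exprVn exprMn; field; rewrite !gt_eqF.
    rewrite ler_pdivrMr ?exprn_gt0// ler_pdivrMr//.
    have : 2 * m / (l ^+ 2 * eps) < N.+1%:R.
      by apply: (lt_le_trans (truncnS_gt _)); rewrite ler_nat ltnS leq_maxr.
    rewrite ltr_pdivrMr ?mulr_gt0// => /ltW h1; apply: (le_trans h1).
    have h2 : N.+1%:R <= N.+1%:R ^+ 2 :> R by rewrite expr2 ler_peMr// ltW.
    have h3 : 0 <= l ^+ 2 * eps by rewrite mulr_ge0// ltW.
    by have := ler_wpM2r h3 h2; clear; lra.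
  have loc n := localized_energy l0 (cutoff01 R N) (aFH n) (fun e => cutoff_slope N e l0) hp m0 e00 He0 (mF n) uS uT hS (@edge_box_far R N).
  have LL := @ler_cvg_to _ _ _ _ _ _ _ _ _ EFU (nearW _ loc).
  have main : 2^-1 * \sum_(e <- S) d e - p^-1 * \sum_(e <- T) pwn l p f e
   - p^-1 * \sum_(e <- T | e \notin S) pwn l p f e
   + (1 - (\sum_(e <- S) sqn l f e) / m) * e0 - 2^-1 * K * m <= e0.
    apply: LL; apply: cvgB; last exact: cvg_cst.
    apply: cvgD; last first.
      apply: cvgMl; apply: cvgB; first exact: cvg_cst.
      by apply: cvgMl; apply: (@cvg_sum_seq _ _ UU) => e _; exact: Fsqn.
    apply: cvgB; first apply: cvgB.
    - by apply: cvgMr; apply: (@cvg_sum_seq _ _ UU) => e _; exact: Hd.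
    - by apply: cvgMr; apply: (@cvg_sum_seq _ _ UU) => e _; exact: Fpwn.
    - by apply: cvgMr; apply: (@cvg_sum_seq _ _ UU) => e _; exact: Fpwn.
  have h1 : \sum_(e <- S) sqn l h e <= \sum_(e <- S) d e by apply: ler_sum => e _; exact: (hP e).2.
  have h2 : p^-1 * \sum_(e <- T) pwn l p f e <= p^-1 * P by rewrite ler_pM2l//; exact: tsum_ge.
  have h3 : p^-1 * \sum_(e <- T | e \notin S) pwn l p f e <= p^-1 * (P - \sum_(e <- S) pwn l p f e).
    rewrite ler_pM2l// lerBrDr addrC.
    have -> : \sum_(e <- S) pwn l p f e + \sum_(e <- T | e \notin S) pwn l p f e =
        \sum_(e <- S ++ [seq e <- T | e \notin S]) pwn l p f e by rewrite big_cat big_filter.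
    apply: tsum_ge => //.
    rewrite cat_uniq uS filter_uniq// andbT; apply/hasPn => e.
    by rewrite mem_filter => /andP[].
  move: main h1 h2 h3 Keps; clear; lra.
have E1 : renergy l p f h <= nu / m * e0.
  apply/ler_addgt0Pr => eps eps0.
  have q0 : 0 < 2 + p^-1 + `|e0| / m.
    by have := divr_ge0 (normr_ge0 e0) (ltW m0); move: pp; clear; lra.
  pose ep := eps / (2 + p^-1 + `|e0| / m); have ep0 : 0 < ep by rewrite divr_gt0.
  have [s1 us1 hs1] := tsum_approx sm ep0; have [s2 us2 hs2] := tsum_approx sd ep0.
  have [s3 us3 hs3] := tsum_approx sP ep0.
  (* One finite set of edges captures mass, Dirichlet integral and potential up to [ep]. *)
  pose S := undup (s1 ++ s2 ++ s3); have uS : uniq S by exact: undup_uniq.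
  have g1 : nu - ep <= \sum_(e <- S) sqn l f e.
    apply: (le_trans (ltW hs1)); apply: sub_sum => //; first by move=> e; exact: sqn_ge0.
    by move=> e es; rewrite mem_undup !mem_cat es.
  have g2 : D - ep <= \sum_(e <- S) sqn l h e.
    apply: (le_trans (ltW hs2)); apply: sub_sum => //; first by move=> e; exact: sqn_ge0.
    by move=> e es; rewrite mem_undup !mem_cat es orbT.
  have g3 : P - ep <= \sum_(e <- S) pwn l p f e.
    apply: (le_trans (ltW hs3)); apply: sub_sum => //; first by move=> e; exact: pwn_ge0.
    by move=> e es; rewrite mem_undup !mem_cat es !orbT.
  have := local S ep uS ep0; rewrite /renergy -/P -/D.
  have g1' : (\sum_(e <- S) sqn l f e) / m * e0 <= nu / m * e0 + ep * (`|e0| / m).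
    rewrite (ler0_norm e00).
    have -> : nu / m * e0 + ep * (- e0 / m) = (nu - ep) / m * e0 by field; rewrite gt_eqF.
    by apply: ler_wnM2r => //; rewrite ler_pM2r ?invr_gt0.
  have g3' : p^-1 * (P - \sum_(e <- S) pwn l p f e) <= p^-1 * ep by rewrite ler_pM2l//; move: g3; clear; lra.
  have epE : eps = ep * (2 + p^-1 + `|e0| / m) by rewrite /ep divfK// gt_eqF.
  rewrite epE; move: g1' g2 g3' ep0; clear; lra.
(* If [f] vanished on the three edges at the origin, uniform convergence there would contradict
   [F n >= c]. *)
have nu0 : 0 < nu.
  have [[k [x [xl fx]]]|nz] := pselect (exists k, exists x, 0 <= x <= l /\ f ((0, 0), k) x != 0).
    exact: (sup_pos_mass fh xl fx).
  have c2 : 0 < c / 2 by rewrite divr_gt0.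
  have : \forall n \near U, forall k : 'I_3, forall x, 0 <= x <= l -> `|F n ((0, 0), k) x - f ((0, 0), k) x| <= c / 2.
    by apply: filter_forall => k; exact: unif.
  move/filter_ex => [n Hn]; have [k [x xl cx]] := near0 n.
  have fz : f ((0, 0), k) x = 0 by apply/eqP/negPn/negP => fx; apply: nz; exists k, x.
  have := Hn k x xl; rewrite fz subr0 => /(le_trans (ler_norm _)) => h1.
  by move: (le_trans cx h1) c0; clear; lra.
have P0 : 0 < P by exact: (pwn_gt0 l0 hp2 fh nu0).
have num : nu <= m by exact: tsum_le.
pose a := Num.sqrt (m / nu).
have a2 : a ^+ 2 = m / nu by rewrite sqr_sqrtr// divr_ge0// ltW.
have a1 : 1 <= a by rewrite -sqrtr1 ler_wsqrtr// ler_pdivlMr// mul1r.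
have a0 : 0 <= a by exact: le_trans a1.
have := He0 _ _ (adm_scale a0 fh); rewrite (mass_scale a fh) a2 -/nu divfK ?gt_eqF// => /(_ erefl).
rewrite (renergy_scale l0 hp2 a0 fh) -/P -/D => H2.
have E2 : a ^+ 2 * renergy l p f h <= e0.
  have := ler_wpM2l (sqr_ge0 a) E1; rewrite {2}a2 mulrA.
  by rewrite (_ : m / nu * (nu / m) = 1) ?mul1r//; field; rewrite !gt_eqF.
(* The energy of the rescaled [f] is at least [e0], hence at least a^2 E(f). The Dirichlet terms
   cancel, and P > 0 leaves a^p <= a^2, which forces a = 1. *)
have ap : a `^ p <= a ^+ 2.
  have : p^-1 * (a `^ p * P) <= p^-1 * (a ^+ 2 * P).
    by move: H2 E2; rewrite /renergy -/P -/D; clear; lra.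
  by rewrite ler_pM2l// ler_pM2r.
have aE : a = 1.
  apply/eqP; rewrite eq_le a1 andbT leNgt; apply/negP => a1'.
  move: ap; apply/negP; rewrite -ltNge.
  have -> : a `^ p = a ^+ 2 * a `^ (p - 2).
    by rewrite -powR_mulrn// -powRD; [congr (_ `^ _); ring|apply/implyP => _; rewrite gt_eqF// (lt_trans _ a1')].
  rewrite ltr_pMr ?exprn_gt0// ?(lt_trans _ a1')//.
  apply: (lt_le_trans a1'); rewrite -[leLHS]powRr1//; apply: ler_powR => //.
  by move: p4; clear; lra.
exists f, h; split=> //; last by rewrite aE expr1n mul1r in E2.
by move: a2; rewrite aE expr1n => a2'; rewrite -[LHS]mul1r a2' divfK// gt_eqF.
Qed.

End Existence.

(** * Spreading and the critical mass *)

Section Spreading.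
Variable R : realType.

Lemma geo_box (r : R) K : 0 <= r < 1 -> \sum_(i <- int_box K) r ^+ `|i|%N <= 2 / (1 - r).
Proof.
move=> /andP[r0 r1]; have r1' : 0 < 1 - r by rewrite subr_gt0.
have geo n : \sum_(i <- iota 0 n) r ^+ i <= (1 - r)^-1.
  have -> : iota 0 n = index_iota 0 n by rewrite /index_iota subn0.
  rewrite big_mkord.
  rewrite -[leRHS]mul1r ler_pdivlMr// mulrC -[X in X * _]opprB mulNr -subrX1 opprB.
  by rewrite lerBlDr lerDl exprn_ge0.
set s := map Posz (iota 0 K.+1) ++ map (fun i => - Posz i) (iota 0 K.+1).
have H (t : seq int) : \sum_(i <- undup t) r ^+ `|i|%N <= \sum_(i <- t) r ^+ `|i|%N.
  elim: t => // x t IH /=; case: ifP => _; rewrite ?big_cons.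
    by apply: (le_trans IH); rewrite lerDr exprn_ge0.
  by rewrite lerD2l.
apply: (le_trans (H s)); rewrite /s big_cat !big_map.
have -> : 2 / (1 - r) = (1 - r)^-1 + (1 - r)^-1 by field; rewrite gt_eqF.
apply: lerD; first exact: geo.
by under eq_bigr do rewrite abszN; exact: geo.
Qed.

Lemma geo_smb (r : R) : 0 <= r < 1 -> smb (fun v : int * int => r ^+ `|v.1|%N * r ^+ `|v.2|%N).
Proof.
move=> r01; have /andP[r0 r1] := r01; exists ((2 / (1 - r)) ^+ 2) => s us.
pose K := (\sum_(v <- s) (`|v.1| + `|v.2|))%N.
apply: (@le_trans _ _ (\sum_(v <- [seq (i, j) | i <- int_box K, j <- int_box K]) r ^+ `|v.1|%N * r ^+ `|v.2|%N)).
  apply: (@sub_sum _ _ (fun v : int * int => r ^+ `|v.1|%N * r ^+ `|v.2|%N)) => //.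
  - by move=> v; rewrite mulr_ge0// exprn_ge0.
  - by apply: allpairs_uniq; rewrite ?undup_uniq// => -[? ?] [? ?] _ _ [-> ->].
  - move=> [i j] ijs; have ijK : (`|i| + `|j| <= K)%N by rewrite /K (big_rem _ ijs)/= leq_addr.
    by apply/allpairsP; exists (i, j); split=> //=; apply: mem_int_box; rewrite (leq_trans _ ijK)// ?leq_addr ?leq_addl.
rewrite big_allpairs /=; under eq_bigr do rewrite -mulr_sumr.
have G0 : 0 <= \sum_(i <- int_box K) r ^+ `|i|%N by apply: sumr_ge0 => *; exact: exprn_ge0.
by rewrite -mulr_suml expr2 ler_pM ?geo_box.
Qed.

Variable l : R.
Hypothesis l0 : 0 < l.

(** The profile (1 + s)^(- distance), interpolated along edges: on an edge its slope is at most s /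
    l times its minimum, so the Dirichlet integral is at most (s / l)^2 times the mass. The value of
    [s] makes this [eps] after normalization. *)
Lemma spread (m eps : R) : 0 < m -> 0 < eps -> exists f h,
  [/\ adm l f h, tsum (sqn l f) = m & tsum (sqn l h) <= eps].
Proof.
move=> m0 eps0; pose s := l * Num.sqrt (eps / m).
have s0 : 0 < s by rewrite mulr_gt0// sqrtr_gt0 divr_gt0.
pose r := (1 + s)^-1; have s1 : 0 < 1 + s by rewrite addr_gt0.
have r0 : 0 < r by rewrite invr_gt0.
have r1 : r < 1 by rewrite invf_lt1// ltrDl.
have rs : r * (1 + s) = 1 by rewrite mulVf// gt_eqF.
pose v w := r ^+ hdist w.
have v0 w : 0 < v w by rewrite exprn_gt0.
have vstep w w' : (hdist w <= hdist w' + 1)%N -> v w' <= v w * (1 + s).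
  move=> ww; have : v w' * r <= v w.
    rewrite /v -exprSr; apply: ler_wiXn2l; [exact: ltW|exact: ltW|by rewrite -addn1].
  move=> h1; have := ler_wpM2r (ltW s1) h1; rewrite -mulrA rs mulr1//.
pose f : hedge -> R -> R := thf l v; pose h : hedge -> R -> R := fun e _ => thslope l v e.
have dfh e : der l (f e) (h e).
  by apply: C1_der => [x|x]; [exact: is_derive_thf|exact: cvg_cst].
pose mn e := Num.min (v (htail e)) (v (hhead e)).
have mn0 e : 0 < mn e by rewrite lt_min !v0.
have fmn e x : 0 <= x <= l -> mn e <= f e x <= (1 + s) * mn e.
  move=> /andP[x0 xl]; have [h1 h2] := hdist_adj e.
  have {}h1 := vstep _ _ h1; have {}h2 := vstep _ _ h2.
  have -> : f e x = (1 - x / l) * v (htail e) + x / l * v (hhead e).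
    by rewrite /f /thf /thslope; field; rewrite gt_eqF.
  have t0 : 0 <= x / l by rewrite divr_ge0// ltW.
  have t1 : x / l <= 1 by rewrite ler_pdivrMr// mul1r.
  have p1 := v0 (htail e); have p2 := v0 (hhead e).
  rewrite /mn; move: t0 t1 h1 h2 p1 p2 s0; set t := x / l; set a := v _; set b := v _.
  case: (leP a b) => ab; clear -ab => t0 t1 h1 h2 p1 p2 s0; apply/andP; split.
  - by nra.
  - by apply: (@le_trans _ _ b); [nra|rewrite mulrC].
  - by nra.
  - by apply: (@le_trans _ _ a); [nra|rewrite mulrC].
have slope_le e : thslope l v e ^+ 2 <= (s / l * mn e) ^+ 2.
  have [h1 h2] := hdist_adj e; have {}h1 := vstep _ _ h1; have {}h2 := vstep _ _ h2.
  have sl0 : 0 <= s / l * mn e by rewrite mulr_ge0 ?divr_ge0 ?(ltW l0) ?(ltW s0) ?(ltW (mn0 e)).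
  rewrite -[_ ^+ 2 in leLHS]real_normK ?num_real// lerXn2r ?nnegrE ?normr_ge0//.
  rewrite /thslope normrM normfV (gtr0_norm l0) mulrAC ler_pM2r ?invr_gt0//.
  rewrite ler_norml /mn; move: h1 h2; set a := v (htail e); set b := v (hhead e).
  by case: (leP a b) => ab; clear -ab s0; move=> h1 h2; apply/andP; split; lra.
have sqf e : l * mn e ^+ 2 <= sqn l f e <= l * ((1 + s) * mn e) ^+ 2.
  have cf : cts 0 l (fun x => f e x ^+ 2) by apply: ctsX; exact: der_cts (dfh e).
  have ic (c : R) : itg 0 l (fun=> c) by apply: cts_itg; exact: cts_cst.
  rewrite -[X in X * _ <= _]subr0 -[X in _ <= X * _]subr0 ![(l - 0) * _]mulrC -!itl_cst ?(ltW l0)//.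
  apply/andP; split; apply: itl_le => //; try exact: cts_itg.
  - move=> x /(fmn e) /andP[h1 _]; rewrite lerXn2r ?nnegrE ?(ltW (mn0 e))//.
    by rewrite (le_trans _ h1)// ltW.
  - move=> x /(fmn e) /andP[h1 h2]; rewrite lerXn2r ?nnegrE// ?mulr_ge0 ?(ltW s1) ?(ltW (mn0 e))//.
    by rewrite (le_trans _ h1)// ltW.
have sqh e : sqn l h e <= (s / l) ^+ 2 * sqn l f e.
  have -> : sqn l h e = thslope l v e ^+ 2 * l by rewrite /sqn /h itl_cst ?(ltW l0)// subr0.
  apply: (@le_trans _ _ ((s / l * mn e) ^+ 2 * l)); first by rewrite ler_wpM2r ?(ltW l0).
  rewrite exprMn -mulrA; apply: ler_wpM2l; first exact: sqr_ge0.
  by rewrite mulrC; case/andP: (sqf e).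
have rr : 0 <= r ^+ 2 < 1 by rewrite exprn_ge0 ?(ltW r0)//= exprn_ilt1// ltW.
have smf : smb (sqn l f).
  have [C HC] := geo_smb rr; exists (l * (1 + s) ^+ 2 * (3 * C)) => t ut.
  pose G (w : int * int) := (r ^+ 2) ^+ `|w.1|%N * (r ^+ 2) ^+ `|w.2|%N.
  have G0 w : 0 <= G w by rewrite mulr_ge0// exprn_ge0// exprn_ge0// ltW.
  apply: (@le_trans _ _ (\sum_(e <- t) l * (1 + s) ^+ 2 * G e.1)).
    apply: ler_sum => e _; case/andP: (sqf e) => _ /le_trans; apply.
    rewrite exprMn mulrA (ler_wpM2l (mulr_ge0 (ltW l0) (sqr_ge0 _)))//.
    have -> : G e.1 = v (htail e) ^+ 2 by rewrite /G /v /htail /hdist -!exprM -exprD -mulnDr mulnC.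
    by rewrite lerXn2r ?nnegrE ?(ltW (mn0 e)) ?(ltW (v0 _))// ge_min lexx.
  rewrite -mulr_sumr (ler_wpM2l (mulr_ge0 (ltW l0) (sqr_ge0 _)))//.
  apply: (le_trans (edge_sum_star G0 ut)); rewrite ler_pM2l//.
  by apply: HC; exact: undup_uniq.
have fh : adm l f h.
  split=> //.
  - by move=> e x /(fmn e) /andP[h1 _]; rewrite (le_trans _ h1)// ltW.
  - by exists v => e; rewrite /f thf_0 thf_l.
  - by apply: (@smb_le _ _ _ _ sqh); apply: smbZ => //; exact: sqr_ge0.
have xl0 : 0 <= (0 : R) <= l by rewrite lexx ltW.
have f0 : f ((0, 0), k0) 0 != 0.
  by rewrite gt_eqF//; case/andP: (fmn ((0, 0), k0) 0 xl0) => h1 _; exact: lt_le_trans h1.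
have M0 := sup_pos_mass l0 fh xl0 f0.
set M := tsum (sqn l f) in M0.
pose a := Num.sqrt (m / M); have a0 : 0 <= a by exact: sqrtr_ge0.
have a2 : a ^+ 2 = m / M by rewrite sqr_sqrtr// divr_ge0// ltW.
exists (scale a f), (scale a h); split; first exact: adm_scale.
  by rewrite (mass_scale a fh) a2 divfK// gt_eqF.
rewrite (dirichlet_scale a fh) a2.
apply: (@le_trans _ _ (m / M * ((s / l) ^+ 2 * M))).
  rewrite ler_wpM2l ?divr_ge0 ?(ltW m0) ?(ltW M0)// -tsumZ ?sqr_ge0//.
  by apply: tsum_mono => //; apply: smbZ => //; exact: sqr_ge0.
have -> : s / l = Num.sqrt (eps / m) by rewrite /s mulrC mulKf// gt_eqF.
rewrite sqr_sqrtr ?divr_ge0 ?(ltW m0) ?(ltW eps0)//.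
by rewrite le_eqVlt; apply/orP; left; apply/eqP; field; rewrite !gt_eqF.
Qed.

End Spreading.

(** * The critical mass *)

Section CriticalMass.
Variables (R : realType) (l p : R).
Hypothesis l0 : 0 < l.
Hypothesis p46 : 4 <= p <= 6.
Implicit Types (f h : hedge -> R -> R) (e : hedge).

Let p26 : 2 < p <= 6. Proof. by case/andP: p46 => h1 ->; rewrite andbT; lra. Qed.
Let p0 : 0 < p. Proof. by case/andP: p26 => h1 _; lra. Qed.

Definition nonneg_energy (m : R) := forall f h, adm l f h -> tsum (sqn l f) = m ->
  0 <= renergy l p f h.
Definition neg_energy (m : R) := exists f h, [/\ adm l f h, tsum (sqn l f) = m &
  renergy l p f h < 0].

Lemma not_neg_energy m : ~ neg_energy m -> nonneg_energy m.
Proof. by move=> nE f h fh fm; rewrite leNgt; apply/negP => E0; apply: nE; exists f, h. Qed.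

Lemma level_le0 m : 0 < m -> (energy_level l p m <= 0)%E.
Proof.
move=> m0; apply/lee_addgt0Pr => eps e0; rewrite add0e.
have [f [h [fh fm hD]]] := spread l0 m0 e0.
apply: (le_trans (level_le l0 p26 fh fm)); rewrite lee_fin /renergy.
have P0 := pwn_ge0_tsum l0 p26 fh; have D0 := tsum_ge0 (adm_dirichlet fh).
have : 0 <= p^-1 * tsum (pwn l p f) by rewrite mulr_ge0// invr_ge0 ltW.
lra.
Qed.

Lemma level_eq0 m : 0 < m -> nonneg_energy m -> energy_level l p m = 0%E.
Proof.
move=> m0 gm; apply/eqP; rewrite eq_le level_le0//=.
exact: (level_ge l0 p26).
Qed.

(** With a^2 factored out, the sign depends on [a] only through a^(p-2). *)
Lemma renergy_scaleE a f h : 0 < a -> adm l f h ->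
  renergy l p (scale a f) (scale a h) =
  a ^+ 2 * (2^-1 * tsum (sqn l h) - a `^ (p - 2) * (p^-1 * tsum (pwn l p f))).
Proof.
move=> a0 fh; rewrite (renergy_scale l0 p26 (ltW a0) fh).
have -> : a `^ p = a ^+ 2 * a `^ (p - 2).
  rewrite -powR_mulrn ?(ltW a0)// -powRD; last by apply/implyP => _; rewrite gt_eqF.
  by congr (_ `^ _); ring.
by ring.
Qed.

Lemma scale_to_mass m' f h : 0 <= m' -> adm l f h -> 0 < tsum (sqn l f) ->
  tsum (sqn l (scale (Num.sqrt (m' / tsum (sqn l f))) f)) = m'.
Proof.
move=> m0 fh fm; rewrite (mass_scale _ fh) sqr_sqrtr ?divr_ge0 ?(ltW fm)//.
by rewrite divfK// gt_eqF.
Qed.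

Lemma potential_gt0 f h : adm l f h -> 0 < tsum (sqn l f) -> 0 < p^-1 * tsum (pwn l p f).
Proof. by move=> fh fm; rewrite mulr_gt0 ?invr_gt0// (pwn_gt0 l0 p26 fh). Qed.

Lemma neg_energy_up m m' : 0 < m -> m <= m' -> neg_energy m -> neg_energy m'.
Proof.
move=> m0 mm' [f [h [fh fm E0]]].
have fm0 : 0 < tsum (sqn l f) by rewrite fm.
pose a := Num.sqrt (m' / m); have m'0 := lt_le_trans m0 mm'.
have a0 : 0 < a by rewrite sqrtr_gt0 divr_gt0.
have a1 : 1 <= a by rewrite -[1]sqrtr1 ler_wsqrtr// ler_pdivlMr// mul1r.
exists (scale a f), (scale a h); split; first by apply: adm_scale => //; exact: ltW.
  by rewrite /a -fm; apply: (scale_to_mass _ fh fm0); exact: ltW.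
rewrite renergy_scaleE//.
have a2 : 1 <= a `^ (p - 2) by rewrite -[leLHS](powRr0 a) ler_powR//; case/andP: p26 => ? ?; lra.
rewrite pmulr_rlt0 ?exprn_gt0//; apply: le_lt_trans E0.
by rewrite /renergy lerD2l lerN2 ler_peMl// ltW// (potential_gt0 fh).
Qed.

Lemma energy_gt0 m m' f h : nonneg_energy m -> m' < m -> 0 < m' ->
  adm l f h -> tsum (sqn l f) = m' -> 0 < renergy l p f h.
Proof.
move=> gm mm m0 fh fm; have fm0 : 0 < tsum (sqn l f) by rewrite fm.
pose a := Num.sqrt (m / m'); have mp := lt_trans m0 mm.
have a0 : 0 < a by rewrite sqrtr_gt0 divr_gt0.
have a1 : 1 < a by rewrite -[1]sqrtr1 ltr_sqrt ?divr_gt0// ltr_pdivlMr// mul1r.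
have : 0 <= renergy l p (scale a f) (scale a h).
  apply: gm; first by apply: adm_scale => //; exact: ltW.
  by rewrite /a -fm; apply: (scale_to_mass _ fh fm0); exact: ltW.
rewrite renergy_scaleE// pmulr_rge0 ?exprn_gt0// subr_ge0 => H.
rewrite /renergy subr_gt0; apply: lt_le_trans H; rewrite ltr_pMl ?(potential_gt0 fh)//.
rewrite [ltLHS](_ : 1 = 1 `^ (p - 2)); last by rewrite powR1.
by apply: gt0_ltr_powR; rewrite ?nnegrE ?(ltW a0)//; case/andP: p26 => ? ?; lra.
Qed.

Lemma neg_energy_down m : 0 < m -> neg_energy m -> exists m', [/\ 0 < m', m' < m & neg_energy m'].
Proof.
move=> m0 [f [h [fh fm E0]]]; have fm0 : 0 < tsum (sqn l f) by rewrite fm.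
have D0 := mass_pos_dirichlet l0 fh fm0; have P0 := potential_gt0 fh fm0.
move: E0; rewrite /renergy subr_lt0; set q := p^-1 * _ in P0 *; set d := 2^-1 * _ => dq.
have d0 : 0 < d by rewrite mulr_gt0.
(* Negativity survives a small decrease of mass: d / q = 1 - 8 t, while b^(p-2) >= b^4 > 1 - 8 t
   because p <= 6. *)
pose t := (1 - d / q) / 8.
have dq1 : d / q < 1 by rewrite ltr_pdivrMr// mul1r.
have dq0 : 0 < d / q by exact: divr_gt0.
have t0 : 0 < t by rewrite /t; lra.
have t1 : t < 8^-1 by rewrite /t; lra.
pose b := 1 - t; have b0 : 0 < b by rewrite /b; lra.
have b1 : b < 1 by rewrite /b; lra.
exists (b ^+ 2 * m); split; first by rewrite mulr_gt0 ?exprn_gt0.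
  by rewrite gtr_pMl// exprn_ilt1// ltW.
exists (scale b f), (scale b h); split; first by apply: adm_scale => //; exact: ltW.
  by rewrite (mass_scale _ fh) fm.
rewrite renergy_scaleE// pmulr_rlt0 ?exprn_gt0// subr_lt0 -/q -/d -ltr_pdivrMr//.
apply: (@lt_le_trans _ _ (b ^+ 4)).
  rewrite /b; have -> : d / q = 1 - 8 * t by rewrite /t; lra.
  by move: t0 t1; clear; nra.
rewrite -powR_mulrn ?(ltW b0)//; apply: ger_powR; first by rewrite b0 ltW.
by case/andP: p26 => ? ?; lra.
Qed.

Theorem critical_mass : exists2 mup, 0 < mup &
  (forall m, 0 < m -> m <= mup -> nonneg_energy m) /\ (forall m, mup < m -> neg_energy m).
Proof.
pose A : set R := [set m | 0 < m /\ nonneg_energy m].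
(* At this mass, which is at most 1, [gn_small] bounds the potential integral by the Dirichlet
   integral, and p >= 4 makes the energy nonnegative. *)
pose m1 := (48 * l + 16)^-1.
have l16 : 1 < 48 * l + 16 by rewrite ltr_wpDl ?mulr_ge0 ?(ltW l0)// ltr1n.
have l160 := lt_trans ltr01 l16.
have m10 : 0 < m1 by rewrite invr_gt0.
have m11 : m1 <= 1 by rewrite invf_le1// ltW.
have Am1 : A m1.
  split=> // f h fh fm; have := gn_small l0 p46 fh; rewrite fm => H.
  have D0 := tsum_ge0 (adm_dirichlet fh).
  have H1 : 48 * l * m1 + 16 * m1 ^+ 2 <= 1.
    have e1 : m1 * (48 * l + 16) = 1 by rewrite mulVf// gt_eqF.
    have : m1 ^+ 2 <= m1 by rewrite expr2 ler_piMl// ltW.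
    lra.
  have H2 : tsum (pwn l p f) <= tsum (sqn l h).
    by apply: (le_trans H); rewrite ler_piMl.
  rewrite /renergy subr_ge0; apply: (@le_trans _ _ (4^-1 * tsum (pwn l p f))).
    rewrite ler_wpM2r ?(pwn_ge0_tsum l0 p26 fh)// lef_pV2 ?posrE//.
    by case/andP: p46.
  lra.
have [m2 m20 bm2] : exists2 m2, 0 < m2 & neg_energy m2.
  have [f [h [fh fm hD]]] := spread l0 (@ltr01 R) (@ltr01 R).
  have fm0 : 0 < tsum (sqn l f) by rewrite fm.
  have P0 := potential_gt0 fh fm0; have D0 := tsum_ge0 (adm_dirichlet fh).
  (* Since p - 2 >= 2, the factor a^(p-2) is at least [a2], and [a2] times the potential term
     exceeds the Dirichlet integral. *)
  pose a2 := 1 + tsum (sqn l h) / (p^-1 * tsum (pwn l p f)).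
  have a20 : 1 <= a2 by rewrite lerDl divr_ge0// ltW.
  have a2p : 0 < a2 by lra.
  pose a := Num.sqrt a2; have a0 : 0 < a by rewrite sqrtr_gt0.
  have a1 : 1 <= a by rewrite -[1]sqrtr1 ler_wsqrtr.
  have aa : a ^+ 2 = a2 by rewrite sqr_sqrtr// ltW.
  exists a2 => //; exists (scale a f), (scale a h); split; first by apply: adm_scale => //; exact: ltW.
    by rewrite (mass_scale _ fh) fm mulr1.
  rewrite renergy_scaleE// pmulr_rlt0 ?exprn_gt0// subr_lt0.
  apply: (@lt_le_trans _ _ (a2 * (p^-1 * tsum (pwn l p f)))); last first.
    rewrite ler_pM2r// -aa -powR_mulrn ?(ltW a0)// ler_powR//.
    by case/andP: p46 => ? ?; lra.
  rewrite /a2 mulrDl mul1r divfK ?gt_eqF//.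
  by move: P0 D0; lra.
have ubA : ubound A m2.
  move=> m [mp gm]; rewrite leNgt; apply/negP => mm.
  have [f [h [fh fm]]] := neg_energy_up m20 (ltW mm) bm2.
  by rewrite ltNge (gm _ _ fh fm).
have sA : has_sup A by split; [exists m1|exists m2].
have lower m : 0 < m -> m < sup A -> nonneg_energy m.
  move=> mp msup; apply: not_neg_energy => bm.
  have [m' [m'0 gm'] mm'] := sup_gt sA.1 msup.
  have [f [h [fh fm]]] := neg_energy_up mp (ltW mm') bm.
  by rewrite ltNge (gm' _ _ fh fm).
have supA0 : 0 < sup A by apply: (lt_le_trans m10); apply: sup_upper_bound.
exists (sup A) => //; split.
  (* At the supremum itself a negative energy would persist at a slightly smaller mass. *)
  move=> m mp; rewrite le_eqVlt => /orP[/eqP->|]; last exact: lower.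
  apply: not_neg_energy => /(neg_energy_down supA0)[m' [m'0 mm' [f [h [fh fm]]]]].
  by rewrite ltNge (lower _ m'0 mm' _ _ fh fm).
move=> m mm; apply: contrapT => /not_neg_energy gm.
suff : m <= sup A by rewrite leNgt mm.
by apply: sup_upper_bound => //; split=> //; exact: lt_trans mm.
Qed.

Lemma no_ground_state_below m mup : nonneg_energy mup -> 0 < m -> m < mup ->
  ~ exists u, ground_state l p m u.
Proof.
move=> gm m0 mm [u] /(ground_state_adm l0 p26)[f [h [fh fm]]].
rewrite level_eq0//; last by move=> f' h' fh' fm'; apply: ltW; exact: (energy_gt0 gm mm m0 fh' fm').
by rewrite lee_fin leNgt (energy_gt0 gm mm m0 fh fm).
Qed.

End CriticalMass.

(** * Ground states below the critical exponent *)

Section Arithmetic.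
Variable R : realFieldType.
Implicit Types C D E P a b d e t : R.

Lemma arith_coercive C D E : D <= 4 * E + C -> 0 <= D -> - (C / 4) <= E.
Proof. lra. Qed.

Lemma arith_half a b e : a < e + b -> b <= - e / 2 -> a < e / 2.
Proof. lra. Qed.

Lemma arith_energy D P e : 2^-1 * D - P < e / 2 -> P <= - e / 2 -> 0 <= D -> False.
Proof. lra. Qed.

Lemma arith_error D P d t : 2^-1 * D < t * P -> t <= 1 + d -> 0 <= P -> 2^-1 * D - P <= d * P.
Proof. by move=> h1 h2 h3; have := ler_wpM2r h3 h2; lra. Qed.

(** The first two bounds give E <= 60 K d E + 15 K d C, and 60 K d <= 1/2 lets the left side absorb
    the energy. *)
Lemma arith_absorb D E C K d : E <= 15 * d * (K * D) -> D <= 4 * E + C -> 0 <= E -> 0 <= C ->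
  0 <= K * d -> 120 * (K * d) <= 1 -> E <= 120 * (K * d) * (C + 1).
Proof.
move=> h1 h2 h3 h4 h5 h6; have := ler_wpM2l h5 h2; have := ler_wpM2r h3 h6; move: h1.
have := mulr_ge0 h5 h4; lra.
Qed.

Lemma arith_spread D P t : 2^-1 * D < t * P -> t <= 16 -> 0 <= P -> P <= D / 64 -> 0 < D -> False.
Proof. by move=> h1 h2 h3 h4 h5; have := ler_wpM2r h3 h2; lra. Qed.

Lemma arith_15 d : 0 < d <= 1 -> 1 + 15 * d <= 16.
Proof. by move=> /andP[]; lra. Qed.

Lemma arith_pow4 d : 0 < d <= 1 -> (1 + d) ^+ 4 <= 1 + 15 * d.
Proof.
move=> /andP[d0 d1].
have d2 : d ^+ 2 <= d by rewrite expr2 ler_piMl// ltW.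
have d3 : d ^+ 3 <= d by rewrite exprS ler_piMr// ?(ltW d0)// (le_trans d2).
have d4 : d ^+ 4 <= d by rewrite exprS ler_piMr// ?(ltW d0)// (le_trans d3).
have -> : (1 + d) ^+ 4 = 1 + 4 * d + 6 * d ^+ 2 + 4 * d ^+ 3 + d ^+ 4 by ring.
lra.
Qed.

End Arithmetic.

Section GroundStates.
Variables (R : realType) (l p : R).
Hypothesis l0 : 0 < l.
Hypothesis p46 : 4 <= p < 6.
Implicit Types (f h : hedge -> R -> R) (e : hedge).

Let p4 : 4 <= p. Proof. by case/andP: p46. Qed.
Let p46' : 4 <= p <= 6. Proof. by case/andP: p46 => -> /ltW. Qed.
Let p26 : 2 < p <= 6. Proof. by case/andP: p46' => h1 ->; rewrite andbT; lra. Qed.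
Let p0 : 0 < p. Proof. by case/andP: p26 => h1 _; lra. Qed.

Lemma exists_ground_state (m e0 c : R) (F H : nat -> hedge -> R -> R) :
  0 < m -> e0 <= 0 -> 0 < c ->
  (forall f h, adm l f h -> tsum (sqn l f) = m -> e0 <= renergy l p f h) ->
  (forall n, adm l (F n) (H n)) -> (forall n, tsum (sqn l (F n)) = m) ->
  (forall n, renergy l p (F n) (H n) <= e0 + n.+1%:R^-1) ->
  (forall n, exists e, exists2 x, 0 <= x <= l & c <= F n e x) ->
  exists u, ground_state l p m u.
Proof.
move=> m0 e00 c0 He FH Fm FE Fc.
have [C HC] := coercive l0 p46 m0.
have D n : tsum (sqn l (H n)) <= 4 * (e0 + 1) + C.
  apply: (le_trans (HC _ _ (FH n) (Fm n))); rewrite lerD2r ler_pM2l//.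
  apply: (le_trans (FE n)); rewrite lerD2l invf_le1//; by rewrite ler1n.
have cvg : renergy l p (F n) (H n) @[n --> \oo] --> e0.
  apply: (@squeeze_cvgr _ _ _ _ (fun=> e0) (fun n => e0 + n.+1%:R^-1)).
  - by apply: nearW => n; rewrite He //= FE.
  - exact: cvg_cst.
  - rewrite -[X in _ --> X]addr0; apply: cvgD; first exact: cvg_cst.
    exact: cvg_harmonic.
have [f [h [fh fm fE]]] := minimizer_exists l0 p46' m0 e00 c0 He FH Fm D cvg Fc.
apply: (adm_ground_state l0 p26 fh fm) => f' h' fh' fm'.
by apply: (le_trans fE); exact: He.
Qed.

Lemma small_pwn c f h : c <= 1 -> 0 < c -> adm l f h ->
  (forall e x, 0 <= x <= l -> f e x <= c) -> tsum (pwn l p f) <= c * tsum (sqn l f).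
Proof.
move=> c1 c0 fh fc; apply: (@le_trans _ _ (c `^ (p - 2) * tsum (sqn l f))).
  rewrite -tsumZ ?powR_ge0//; last exact: adm_mass fh.
  apply: tsum_mono; last by apply: smbZ; [exact: powR_ge0|exact: adm_mass fh].
  by apply: (pwn_le l0 p26 fh).
rewrite ler_wpM2r ?tsum_ge0//; first exact: adm_mass fh.
by apply: ge1r_powR; rewrite ?c0//; move: p4; lra.
Qed.

Lemma pwn_le_pw4 c f h : 0 < c -> adm l f h ->
  (forall e x, 0 <= x <= l -> f e x <= c) ->
  tsum (pwn l p f) <= c `^ (p - 4) * (48 * l * (tsum (sqn l f) * tsum (sqn l h))).
Proof.
move=> c0 fh fc; have [s4 g4] := gn4 l0 fh.
apply: (@le_trans _ _ (c `^ (p - 4) * tsum (pw4 l f))); last by rewrite ler_wpM2l ?powR_ge0.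
rewrite -tsumZ ?powR_ge0//; apply: tsum_mono; last by apply: smbZ => //; exact: powR_ge0.
have p16 : 1 <= p <= 6 by case/andP: p26 => h1 ->; rewrite andbT; lra.
move=> e; have i4 : itg 0 l (fun x => f e x ^+ 4) by apply: cts_itg; apply: ctsX; exact: adm_cts fh.
rewrite /pw4 -itlZ//; apply: itl_le; [by apply: cts_itg; exact: cts_powR fh|exact: itgZ|].
move=> x xl; have fx := adm_ge0 fh e xl; have [->|fn] := eqVneq (f e x) 0.
  by rewrite powR0 ?gt_eqF// expr0n /= mulr0.
have fx0 : 0 < f e x by rewrite lt_neqAle eq_sym fn.
have -> : f e x `^ p = f e x `^ (p - 4) * f e x ^+ 4.
  by rewrite -powR_mulrn// -powRD ?subrK//; apply/implyP => _.
rewrite ler_wpM2r ?exprn_ge0//; apply: ge0_ler_powR; rewrite ?nnegrE ?(ltW c0)// ?subr_ge0//.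
exact: fc.
Qed.

Lemma ground_state_above m : 0 < m -> neg_energy l p m -> exists u, ground_state l p m u.
Proof.
move=> m0 [f0 [h0 [fh0 fm0 E0]]]; have [C HC] := coercive l0 p46 m0.
pose S : set R := [set E | exists f h, [/\ adm l f h, tsum (sqn l f) = m & E = renergy l p f h]].
have lS : has_inf S.
  split; first by exists (renergy l p f0 h0); exists f0, h0.
  exists (- (C / 4)) => _ [f [h [fh fm ->]]].
  exact: arith_coercive (HC f h fh fm) (tsum_ge0 (adm_dirichlet fh)).
pose e0 := inf S.
have He f h : adm l f h -> tsum (sqn l f) = m -> e0 <= renergy l p f h.
  by move=> fh fm; apply: ge_inf lS.2 _ _; exists f, h.
have e00 : e0 < 0 by apply: le_lt_trans E0; exact: He.
have /choice[FH FHP] : forall n : nat, exists fh : (hedge -> R -> R) * (hedge -> R -> R),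
    [/\ adm l fh.1 fh.2, tsum (sqn l fh.1) = m,
       renergy l p fh.1 fh.2 <= e0 + n.+1%:R^-1 & renergy l p fh.1 fh.2 < e0 / 2].
  move=> n; have d0 : 0 < Num.min (n.+1%:R^-1) (- e0 / 2) by rewrite lt_min invr_gt0 ltr0n /= divr_gt0 ?oppr_gt0.
  have [_ [f [h [fh fm ->]]] fE] := inf_adherent d0 lS.
  exists (f, h); split=> //=; first by apply: (le_trans (ltW fE)); rewrite lerD2l ge_min lexx.
  by apply: (arith_half fE); rewrite ge_min lexx orbT.
(* If the function stayed below [c], the potential term would be at most -e0 / 2, incompatible with
   an energy below e0 / 2. *)
pose c := Num.min 1 (- e0 / 2 * p / m).
have c0 : 0 < c by rewrite lt_min ltr01 /= divr_gt0// mulr_gt0// divr_gt0 ?oppr_gt0.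
apply: (exists_ground_state m0 (ltW e00) c0 He (F := fun n => (FH n).1) (H := fun n => (FH n).2)).
- by move=> n; have [] := FHP n.
- by move=> n; have [] := FHP n.
- by move=> n; have [] := FHP n.
- move=> n; have [fh fm _ E1] := FHP n; apply: contrapT => /forallNP H.
  have fc e x : 0 <= x <= l -> (FH n).1 e x <= c.
    by move=> xl; rewrite leNgt; apply/negP => /ltW cf; apply: (H e); exists x.
  have c1 : c <= 1 by rewrite ge_min lexx.
  have := small_pwn c1 c0 fh fc; rewrite fm => P1.
  have P2 : c * m <= - e0 / 2 * p.
    by rewrite -ler_pdivlMr// ge_min lexx orbT.
  have P3 : p^-1 * tsum (pwn l p (FH n).1) <= - e0 / 2.
    by rewrite mulrC ler_pdivrMr// (le_trans P1).
  exact: arith_energy E1 P3 (tsum_ge0 (adm_dirichlet fh)).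
Qed.

(** A function of negative energy and mass t^2 * mup, divided by [t]; the loss t^(p-2) is at most
    t^4. *)
Lemma almost_critical mup t : 0 < mup -> (forall m, mup < m -> neg_energy l p m) -> 1 < t ->
  exists f h, [/\ adm l f h, tsum (sqn l f) = mup &
    2^-1 * tsum (sqn l h) < t ^+ 4 * (p^-1 * tsum (pwn l p f))].
Proof.
move=> m0 Hn t1; have t0 : 0 < t by exact: lt_trans t1.
have tm : mup < t ^+ 2 * mup by rewrite ltr_pMl// exprn_egt1.
have [g [k [gk gm E0]]] := Hn _ tm.
have ti0 : 0 <= t^-1 by rewrite invr_ge0 ltW.
have fh := adm_scale ti0 gk.
exists (scale t^-1 g), (scale t^-1 k); split => //.
  by rewrite (mass_scale _ gk) gm mulrA -exprMn mulVf ?gt_eqF// expr1n mul1r.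
have gE u : scale t (scale t^-1 u) = u.
  by apply/funext => e; apply/funext => x; rewrite /scale mulrA divff ?mul1r ?gt_eqF.
move: E0; rewrite -[X in renergy _ _ X _]gE -[X in renergy _ _ _ X]gE.
rewrite renergy_scaleE// pmulr_rlt0 ?exprn_gt0// subr_lt0 => H.
apply: (lt_le_trans H); apply: ler_wpM2r.
  by rewrite mulr_ge0 ?invr_ge0 ?(ltW p0)// (pwn_ge0_tsum l0 p26 fh).
rewrite -powR_mulrn ?(ltW t0)//; apply: ler_powR; first exact: ltW.
by case/andP: p26 => ? ?; lra.
Qed.

(** The functions of [almost_critical] with t tending to 1 minimize and do not vanish: if the
    supremum were at most [c], the potential term would be at most D / 64, against D / 2 < t^4 * D /
    64 <= D / 4. *)
Lemma ground_state_critical mup : 4 < p -> 0 < mup -> nonneg_energy l p mup ->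
  (forall m, mup < m -> neg_energy l p m) -> exists u, ground_state l p mup u.
Proof.
move=> p4' m0 gm Hn; have [C HC] := coercive l0 p46 m0.
pose K := (48 * l * mup + 16 * mup ^+ 2) / p.
have K0 : 0 < K.
  by rewrite divr_gt0// addr_gt0// mulr_gt0 ?exprn_gt0// mulr_gt0.
(* Chosen so that, with d = 1 / (B (n + 1)), the bound of [arith_absorb] is at most 1 / (n + 1). *)
pose B := Num.max 1 (120 * K * (`|C| + 1)).
have B1 : 1 <= B by rewrite le_max lexx.
have B0 : 0 < B by exact: lt_le_trans B1.
have BK : 120 * K * (`|C| + 1) <= B by rewrite le_max lexx orbT.
have C1 : 1 <= `|C| + 1 by rewrite lerDr.
have BK' : 120 * K <= B by apply: le_trans BK; rewrite ler_peMr// mulr_ge0// ltW.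
pose t (n : nat) : R := 1 + (B * n.+1%:R)^-1.
have tn n : 0 < (B * n.+1%:R)^-1 <= 1.
  by rewrite invr_gt0 mulr_gt0//= invf_le1 ?mulr_gt0// mulr_ege1// ler1n.
have t1 n : 1 < t n by rewrite ltrDl; case/andP: (tn n).
have /choice[FH FHP] : forall n : nat, exists fh : (hedge -> R -> R) * (hedge -> R -> R),
    [/\ adm l fh.1 fh.2, tsum (sqn l fh.1) = mup &
      2^-1 * tsum (sqn l fh.2) < t n ^+ 4 * (p^-1 * tsum (pwn l p fh.1))].
  by move=> n; have [f [h H]] := almost_critical m0 Hn (t1 n); exists (f, h).
have t4 n : t n ^+ 4 <= 1 + 15 * (B * n.+1%:R)^-1.
  exact: arith_pow4 (tn n).
have FE n : renergy l p (FH n).1 (FH n).2 <= 0 + n.+1%:R^-1.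
  have [fh fm EE] := FHP n; rewrite add0r.
  have := gn_small l0 p46' fh; have := HC _ _ fh fm; rewrite fm.
  have D0 := tsum_ge0 (adm_dirichlet fh); have P0 := pwn_ge0_tsum l0 p26 fh.
  move: EE D0 P0; rewrite /renergy; set D := tsum (sqn l _); set P := tsum _ => EE D0 P0 H1 H2.
  have {H2} P1 : p^-1 * P <= K * D by rewrite mulrC ler_pdivrMr// /K mulrAC divfK ?gt_eqF.
  set E := _ - _ in H1 *; set d := (B * n.+1%:R)^-1.
  have Ed : E <= 15 * d * (p^-1 * P).
    by apply: (arith_error EE (t4 n)); rewrite mulr_ge0// invr_ge0 ltW.
  have d0 : 0 < d by case/andP: (tn n).
  have Kd : 120 * (K * d) * (`|C| + 1) <= n.+1%:R^-1.
    have -> : 120 * (K * d) * (`|C| + 1) = 120 * K * (`|C| + 1) * d by ring.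
    apply: (le_trans (ler_wpM2r (ltW d0) BK)).
    by rewrite /d invfM mulrA divff ?gt_eqF// mul1r.
  have i1 : n.+1%:R^-1 <= 1 :> R by rewrite invf_le1// ler1n.
  have Kd0 : 0 < K * d by exact: mulr_gt0.
  have Kd1 : 120 * (K * d) <= 1.
    apply: le_trans i1; apply: le_trans Kd; rewrite ler_peMr// ltW// mulr_gt0//.
  have E2 : E <= 15 * d * (K * D).
    by apply: (le_trans Ed); rewrite ler_wpM2l// mulr_ge0// ltW.
  have H3 : D <= 4 * E + `|C| by apply: (le_trans H1); rewrite lerD2l ler_norm.
  have E0 : 0 <= E by exact: gm fh fm.
  by apply: le_trans Kd; exact: arith_absorb E2 H3 E0 (normr_ge0 _) (ltW Kd0) Kd1.
(* Solves c^(p-4) * 48 * l * mup = p / 64; here p > 4 is essential. *)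
pose c := (p / (64 * (48 * l * mup))) `^ ((p - 4)^-1).
have lm : 0 < 64 * (48 * l * mup) by rewrite !mulr_gt0.
have c0 : 0 < c by rewrite powR_gt0// divr_gt0.
apply: (@exists_ground_state mup 0 c (fun n => (FH n).1) (fun n => (FH n).2)) => //.
- by move=> n; have [] := FHP n.
- by move=> n; have [] := FHP n.
- move=> n; have [fh fm EE] := FHP n; apply: contrapT => /forallNP H.
  have fc e x : 0 <= x <= l -> (FH n).1 e x <= c.
    by move=> xl; rewrite leNgt; apply/negP => /ltW cf; apply: (H e); exists x.
  have := pwn_le_pw4 c0 fh fc; rewrite fm.
  have -> : c `^ (p - 4) = p / (64 * (48 * l * mup)).
    by rewrite /c -powRrM mulVf ?subr_eq0 ?gt_eqF// powRr1// ltW// divr_gt0.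
  move: EE; set P := tsum (pwn _ _ _); set D := tsum _ => EE P1.
  have D0 : 0 < D by apply: (mass_pos_dirichlet l0 fh); rewrite fm.
  have P2 : p^-1 * P <= D / 64.
    rewrite mulrC ler_pdivrMr//; apply: (le_trans P1).
    by rewrite le_eqVlt; apply/orP; left; apply/eqP; field; rewrite !gt_eqF.
  have P0 := pwn_ge0_tsum l0 p26 fh.
  have P0' : 0 <= p^-1 * P by rewrite mulr_ge0// invr_ge0 ltW.
  have T : t n ^+ 4 <= 16.
    apply: le_trans (t4 n) _; have := tn n; set d := (B * _)^-1; exact: arith_15.
  exact: arith_spread EE T P0' P2 D0.
Qed.

End GroundStates.

(** * The critical exponent: lower bound *)

Section Profile.
Variables (R : realType).
Implicit Types (s t x : R).

Lemma FTC_itl (F G : R -> R) a b : a <= b -> cts a b F ->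
  (forall x, a <= x <= b -> is_derive x (1 : R) G (F x)) -> itl a b F = G b - G a.
Proof.
move=> ab cF dG; have [ab'|ba] := ltP a b; last first.
  have -> : b = a by apply/eqP; rewrite eq_le ab ba.
  by rewrite itl_id subrr.
have dv x : a <= x <= b -> derivable G x 1 by move=> /dG[].
have cG x : a <= x <= b -> {for x, continuous G}.
  by move=> xab; apply: differentiable_continuous; apply/derivable1_diffP; exact: dv.
have aab : a <= a <= b by rewrite lexx.
have bab : a <= b <= b by rewrite lexx andbT.
rewrite /itl /Rintegral (@continuous_FTC2 _ F G)//.
- split; [|apply: cvg_at_right_filter; exact: cG|apply: cvg_at_left_filter; exact: cG].
  by move=> x /=; rewrite in_itv /= => /andP[ax xb]; apply: dv; rewrite !ltW.
- move=> x; rewrite in_itv /= => /andP[ax xb]; rewrite derive1E.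
  have xab : a <= x <= b by rewrite !ltW.
  by have [] := dG x xab.
Qed.

Variable M : R.
Hypothesis M0 : 0 < M.

(* Chosen so that [h^2 + (M^4 f^2 - f^6) / 3 = h^2 + prof f ^ 2 >= 2 prof f |h|]; the soliton of
   height [M] solves [|f'| = prof f]. *)
Definition prof t := M ^+ 2 / Num.sqrt 3 * t * Num.sqrt (1 - (t ^+ 2 / M ^+ 2) ^+ 2).

Let s3 : 0 < Num.sqrt 3 :> R. Proof. by rewrite sqrtr_gt0. Qed.
Let s31 : 1 <= Num.sqrt 3 :> R. Proof. by rewrite -[leLHS]sqrtr1 ler_wsqrtr// ler1n. Qed.
Let c0 : 0 < M ^+ 2 / Num.sqrt 3. Proof. by rewrite divr_gt0// exprn_gt0. Qed.

Lemma prof_ge0 t : 0 <= t -> 0 <= prof t.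
Proof. by move=> t0; rewrite !mulr_ge0 ?sqrtr_ge0// ltW. Qed.

Lemma prof_arg t : 0 <= t <= M -> 0 <= t ^+ 2 / M ^+ 2 <= 1.
Proof.
move=> /andP[t0 tM]; rewrite divr_ge0 ?sqr_ge0//= ler_pdivrMr ?exprn_gt0// mul1r.
by rewrite lerXn2r// nnegrE ltW.
Qed.

Lemma prof_sqr t : 0 <= t <= M -> prof t ^+ 2 = (M ^+ 4 * t ^+ 2 - t ^+ 6) / 3.
Proof.
move=> tM; rewrite /prof exprMn sqr_sqrtr; last first.
  have /andP[h0 h1] := prof_arg tM; by rewrite subr_ge0 exprn_ile1.
have -> : M ^+ 2 / Num.sqrt 3 * t = M ^+ 2 * t * (Num.sqrt 3)^-1 by ring.
rewrite exprMn exprVn sqr_sqrtr//; field; by rewrite gt_eqF.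
Qed.

Lemma prof_cts : continuous prof.
Proof.
move=> t; rewrite /prof; apply: cvgM; first by apply: cvgM; [exact: cvg_cst|exact: cvg_id].
apply: (@continuous_comp _ _ _ (fun t => 1 - (t ^+ 2 / M ^+ 2) ^+ 2) Num.sqrt); last exact: sqrt_continuous.
apply: cvgB; first exact: cvg_cst.
apply: (@continuous_comp _ _ _ (fun t => t ^+ 2 / M ^+ 2) (fun t => t ^+ 2)); last exact: exprn_continuous.
by apply: cvgM; [exact: exprn_continuous|exact: cvg_cst].
Qed.

Lemma prof_le t : 0 <= t -> prof t <= M ^+ 2 * t.
Proof.
move=> t0; have h : Num.sqrt (1 - (t ^+ 2 / M ^+ 2) ^+ 2) <= 1.
  by rewrite -[leRHS]sqrtr1 ler_wsqrtr// lerBlDr lerDl sqr_ge0.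
have h2 : M ^+ 2 / Num.sqrt 3 <= M ^+ 2 by rewrite ler_pdivrMr// ler_peMr// sqr_ge0.
rewrite /prof; apply: (@le_trans _ _ (M ^+ 2 / Num.sqrt 3 * t)).
  by rewrite ler_piMr// mulr_ge0// ltW.
by rewrite ler_wpM2r.
Qed.

Lemma itg_prof a b : itg a b prof.
Proof. by apply: cts_itg; apply: ctsT; exact: prof_cts. Qed.

Definition pot t := itl 0 t prof.

Lemma potB s t : 0 <= s -> s <= t -> pot t - pot s = itl s t prof.
Proof.
move=> s0 st; rewrite /pot (@itl_split _ 0 t s); [by rewrite addrC addKr|by rewrite s0|exact: itg_prof].
Qed.

Lemma pot_le s t : 0 <= s -> s <= t -> pot s <= pot t.
Proof.
move=> s0 st; rewrite -subr_ge0 potB//; apply: itl_ge0 => x /andP[sx _].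
by apply: prof_ge0; exact: le_trans sx.
Qed.

Lemma pot_ge0 t : 0 <= t -> 0 <= pot t.
Proof. by move=> t0; apply: itl_ge0 => x /andP[x0 _]; exact: prof_ge0. Qed.

Lemma pot_mvt s t : 0 <= s -> s <= t -> exists2 z, s <= z <= t & `|pot t - pot s| <= prof z * (t - s).
Proof.
move=> s0 st; have cp : cts s t prof by apply: ctsT; exact: prof_cts.
have [z] := EVT_max st cp; rewrite in_itv /= => zst zmax; exists z => //.
rewrite potB// ger0_norm; last first.
  by apply: itl_ge0 => x /andP[sx _]; apply: prof_ge0; exact: le_trans sx.
rewrite -itl_cst//; apply: itl_le; [exact: itg_prof|by apply: cts_itg; exact: cts_cst|].
by move=> x xst; apply: zmax; rewrite in_itv.
Qed.

Lemma pot_small t : 0 <= t -> pot t <= M ^+ 2 * t ^+ 2.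
Proof.
move=> t0; rewrite expr2 mulrA -[X in _ * _ * X]subr0 -itl_cst//.
apply: itl_le; [exact: itg_prof|by apply: cts_itg; exact: cts_cst|].
move=> x /andP[x0 xt]; apply: (le_trans (prof_le x0)).
by rewrite ler_wpM2l// sqr_ge0.
Qed.

Lemma pot_gt0 t : 0 < t -> t <= M -> 0 < pot t.
Proof.
move=> t0 tM; pose b := M ^+ 2 / Num.sqrt 3 * (t / 4) * Num.sqrt (1 - (1 / 4) ^+ 2).
have b0 : 0 < b.
  by rewrite !mulr_gt0// ?sqrtr_gt0 ?invr_gt0 ?sqrtr_gt0// ?exprn_gt0//; lra.
have t42 : t / 4 <= t / 2 by lra.
apply: (@lt_le_trans _ _ (itl (t / 4) (t / 2) (fun=> b))).
  by rewrite itl_cst// mulr_gt0//; lra.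
apply: (@le_trans _ _ (itl (t / 4) (t / 2) prof)).
  apply: itl_le; [by apply: cts_itg; exact: cts_cst|exact: itg_prof|].
  move=> x /andP[x1 x2]; rewrite /b /prof; apply: ler_pM.
  - by rewrite !mulr_ge0// ltW// divr_gt0.
  - exact: sqrtr_ge0.
  - by rewrite ler_pM2l.
  - apply: ler_wsqrtr; rewrite lerD2l lerN2.
    have x0 : 0 <= x by apply: le_trans x1; lra.
    have h : x ^+ 2 / M ^+ 2 <= 1 / 4.
      rewrite ler_pdivrMr ?exprn_gt0//; have h : x <= M / 2 by lra.
      have := ler_pM x0 x0 h h; rewrite -!expr2; lra.
    by rewrite lerXn2r// nnegrE ?divr_ge0 ?sqr_ge0.
apply: itl_mono; [lra|lra|lra|exact: itg_prof|].
by move=> x /andP[x0 _]; exact: prof_ge0.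
Qed.

(** A primitive of [prof]: the substitution s = t^2 / M^2 turns it into a multiple of sqrt(1 -
    s^2). *)
Definition prim t := M ^+ 4 / (4 * Num.sqrt 3) *
  (t ^+ 2 / M ^+ 2 * Num.sqrt (1 - (t ^+ 2 / M ^+ 2) ^+ 2) + asin (t ^+ 2 / M ^+ 2)).

Lemma prim_derive t : 0 <= t < M -> is_derive t (1 : R) prim (prof t).
Proof.
move=> /andP[t0 tM]; pose s (t : R) := t ^+ 2 / M ^+ 2.
have ds : is_derive t (1 : R) s (2 * t / M ^+ 2).
  rewrite /s; apply: is_derive_eq; rewrite /GRing.scale /= ; ring.
have s0 : 0 <= s t by rewrite divr_ge0// sqr_ge0.
have s1 : s t < 1.
  by rewrite /s ltr_pdivrMr ?exprn_gt0// mul1r ltrXn2r// nnegrE ltW.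
have sq : 0 < 1 - s t ^+ 2 by rewrite subr_gt0 exprn_ilt1.
have dq : is_derive t (1 : R) (fun t => Num.sqrt (1 - s t ^+ 2))
   ((2 * Num.sqrt (1 - s t ^+ 2))^-1 * (- (2 * s t * (2 * t / M ^+ 2)))).
  apply: (@is_derive1_comp _ Num.sqrt (fun t => 1 - s t ^+ 2)); first exact: is_derive1_sqrt.
  apply: is_derive_eq; rewrite /GRing.scale /=; ring.
have da : is_derive t (1 : R) (fun t => asin (s t)) ((Num.sqrt (1 - s t ^+ 2))^-1 * (2 * t / M ^+ 2)).
  apply: (@is_derive1_comp _ (@asin R) s) => //; apply: is_derive1_asin.
  by rewrite s1 andbT (lt_le_trans _ s0).
pose g t := M ^+ 4 / (4 * Num.sqrt 3) * (s t * Num.sqrt (1 - s t ^+ 2) + asin (s t)).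
have -> : prim = g by [].
rewrite /g; apply: is_derive_eq; rewrite /GRing.scale /=.
rewrite /prof -/(s t); set q := Num.sqrt (1 - s t ^+ 2).
have q0 : 0 < q by rewrite sqrtr_gt0.
have q2 : q ^+ 2 = 1 - s t ^+ 2 by rewrite sqr_sqrtr// ltW.
have S2 : s t ^+ 2 = 1 - q ^+ 2 by rewrite q2; ring.
move: (s t) S2 q0 => S S2 q0; clear - S2 q0 s3 M0.
have -> : M ^+ 4 / (4 * Num.sqrt 3) * (S * ((2 * q)^-1 * - (2 * S * (2 * t / M ^+ 2))) +
    q * (2 * t / M ^+ 2) + q^-1 * (2 * t / M ^+ 2)) =
  M ^+ 2 / (2 * Num.sqrt 3) * t * ((q ^+ 2 + 1 - S ^+ 2) / q).
  by field; rewrite !gt_eqF.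
by rewrite S2; field; rewrite !gt_eqF.
Qed.

(** Twice this value is M^4 / 6 times pi sqrt 3 / 2, which is how the critical mass arises. As
    [asin] is not differentiable at 1, the integral is evaluated up to t < M with t^2 / M^2 = sin
    th, for th close to pi / 2. *)
Lemma pot_max : M ^+ 4 * pi / (8 * Num.sqrt 3) <= pot M.
Proof.
pose c := M ^+ 4 / (4 * Num.sqrt 3).
have c4 : 0 < c by rewrite divr_gt0 ?exprn_gt0 ?mulr_gt0.
have -> : M ^+ 4 * pi / (8 * Num.sqrt 3) = c * (pi / 2).
  by rewrite /c; field; rewrite gt_eqF.
rewrite mulrC -ler_pdivlMr//; apply/ler_addgt0Pr => d d0.
have p0 : 0 < pi / 2 :> R by rewrite divr_gt0// pi_gt0.
pose th : R := Num.max 0 (pi / 2 - d).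
have th0 : 0 <= th by rewrite le_max lexx.
have th1 : th < pi / 2 by rewrite gt_max p0 gtrBl.
suff : th <= pot M / c by rewrite /th ge_max => /andP[_]; rewrite lerBlDr.
have sn0 : 0 <= sin th.
  by apply: sin_ge0_pi; rewrite th0 /= (le_trans (ltW th1))// ler_pdivrMr// ler_peMr ?ler1n ?pi_ge0.
have sn1 : sin th < 1.
  by rewrite -[ltRHS](@sin_pihalf R) ltr_sin// in_itv /=; apply/andP; split; lra.
pose t := M * Num.sqrt (sin th).
have t0 : 0 <= t by rewrite mulr_ge0 ?sqrtr_ge0// ltW.
have tM : t < M by rewrite /t gtr_pMr// -[ltRHS]sqrtr1 ltr_sqrt.
have st : t ^+ 2 / M ^+ 2 = sin th.
  by rewrite /t exprMn sqr_sqrtr// mulrAC divff ?mul1r// expf_neq0// gt_eqF.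
rewrite ler_pdivlMr//; apply: (le_trans _ (pot_le t0 (ltW tM))).
have asin0 : asin (0 : R) = 0.
  by rewrite -[in LHS](@sin0 R) sinK// in_itv /=; apply/andP; split; lra.
have dp x : 0 <= x <= t -> is_derive x (1 : R) prim (prof x).
  by move=> /andP[x0 xt]; apply: prim_derive; rewrite x0 (le_lt_trans xt).
have cp : cts 0 t prof by apply: ctsT; exact: prof_cts.
rewrite /pot (FTC_itl t0 cp dp).
rewrite /prim st expr0n /= !mul0r asin0 addr0 mulr0 subr0 sinK; last first.
  by rewrite in_itv /=; apply/andP; split; lra.
rewrite mulrC ler_pM2l// lerDr mulr_ge0 ?sqrtr_ge0//.
Qed.

End Profile.

Section RayEdges.
Implicit Types (v : int * int).

(* Three disjoint rays leave a_v: edges 0 and 1 alternate along the first,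
   2 and 3 along the second, 4 and 5 along the third. *)
Definition ray_edge v (ci : 'I_6 * nat) : hedge :=
  let i := ci.2 in
  match val ci.1 with
  | 0%N => (shift k1 i%:Z v, k0)
  | 1%N => (shift k1 i.+1%:Z v, k1)
  | 2%N => (shift k1 (- i%:Z) v, k1)
  | 3%N => (shift k1 (- i.+1%:Z) v, k0)
  | 4%N => (shift k2 (- i%:Z) v, k2)
  | _ => (shift k2 (- i.+1%:Z) v, k0)
  end.

Lemma ray_edge_inj v : injective (ray_edge v).
Proof.
move=> [[c c6] i] [[c' c6'] j].
case: c c6 => [|[|[|[|[|[|//]]]]]] c6; case: c' c6' => [|[|[|[|[|[|//]]]]]] c6';
  rewrite /ray_edge /shift /= => -[]; try (move=> *; exfalso; lia); move=> *.
all: by congr (_, _); [exact: val_inj|lia].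
Qed.

End RayEdges.

Section SmbMax.
Variable R : realType.

(** A finite sequence whose sum misses the total by less than [a e1] leaves out only terms smaller
    than [a e1], so a maximum among its members and [e1] is global. *)
Lemma smb_max (T : choiceType) (a : T -> R) e1 : (forall e, 0 <= a e) -> smb a -> 0 < a e1 ->
  exists e, forall e', a e' <= a e.
Proof.
move=> a0 sa ae1; have [s us hs] := tsum_approx sa ae1.
have [e es he] : exists2 e, e \in e1 :: s & forall e', e' \in e1 :: s -> a e' <= a e.
  elim: (s) (e1) {us hs ae1} => [|x t IH] y.
    by exists y; rewrite ?mem_head// => e'; rewrite inE => /eqP->.
  have [e et he] := IH x; have [ye|ey] := leP (a y) (a e).
    exists e; first by rewrite inE et orbT.
    by move=> e'; rewrite inE => /orP[/eqP->//|]; exact: he.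
  exists y; first by rewrite mem_head.
  by move=> e'; rewrite inE => /orP[/eqP->//|/he h]; exact: le_trans (ltW ey).
exists e => e'; have [es'|es'] := boolP (e' \in s); first by apply: he; rewrite inE es' orbT.
apply: le_trans (he e1 (mem_head _ _)).
have := @tsum_ge _ _ a (e' :: s) sa; rewrite /= es' us => /(_ isT); rewrite big_cons.
move: hs; lra.
Qed.

End SmbMax.

Lemma sum_ord6 (R : realType) (G : 'I_6 -> R) : \sum_(c < 6) G c =
  G (inord 0) + G (inord 1) + G (inord 2) + G (inord 3) + G (inord 4) + G (inord 5).
Proof.
rewrite !big_ord_recl big_ord0 addr0 !addrA.
by congr (_ + _ + _ + _ + _ + _); congr G; apply: val_inj; rewrite /= inordK.
Qed.

Lemma arith_identity (R : realFieldType) (D m P w d M6 : R) :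
  2^-1 * D + M6 * m = 6^-1 * P + (w + 2^-1 * d) -> 2^-1 * D - 6^-1 * P + M6 * m = w + 2^-1 * d.
Proof. lra. Qed.

Lemma arith_rays (R : realFieldType) (c0 c1 c2 d a0 a1 a2 a3 a4 a5 b0 b1 b2 b3 b4 b5 T : R) :
  c0 <= d / 3 + (a0 + a1) -> c1 <= d / 3 + (a2 + a3) -> c2 <= d / 3 + (a4 + a5) ->
  a0 <= b0 -> a1 <= b1 -> a2 <= b2 -> a3 <= b3 -> a4 <= b4 -> a5 <= b5 ->
  b0 + b1 + b2 + b3 + b4 + b5 <= T -> c0 + c1 + c2 <= T + d.
Proof. lra. Qed.

Section CriticalPower.
Variables (R : realType) (l : R).
Hypothesis l0 : 0 < l.
Implicit Types (e : hedge).

Variables (f h : hedge -> R -> R).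
Hypothesis fh : adm l f h.
Variable M : R.
Hypothesis M0 : 0 < M.
Hypothesis fM : forall e x, 0 <= x <= l -> f e x <= M.

Local Notation F := (prof M).
Local Notation Phi := (pot M).

Definition wk e : R := itl 0 l (fun x => F (f e x) * `|h e x|).
Definition defect e : R := itl 0 l (fun x => (`|h e x| - F (f e x)) ^+ 2).

Let f0M e x : 0 <= x <= l -> 0 <= f e x <= M.
Proof. by move=> xl; rewrite fM// (adm_ge0 fh). Qed.

Lemma cts_prof e : cts 0 l (fun x => F (f e x)).
Proof. by apply: cts_comp; [exact: prof_cts|exact: adm_cts fh]. Qed.

Lemma itg_wk e : itg 0 l (fun x => F (f e x) * `|h e x|).
Proof.
apply: itgM; first exact: cts_prof.
by apply: itg_norm; apply: L2_itg; exact: (adm_der fh e).1.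
Qed.

Lemma wk_fun_ge0 e x : 0 <= x <= l -> 0 <= F (f e x) * `|h e x|.
Proof. by move=> xl; rewrite mulr_ge0// prof_ge0// (adm_ge0 fh). Qed.

Lemma wk_ge0 e : 0 <= wk e. Proof. by apply: itl_ge0 => x; exact: wk_fun_ge0. Qed.

Lemma defect_ge0 e : 0 <= defect e.
Proof. by apply: itl_ge0 => x _; exact: sqr_ge0. Qed.

Lemma pot_chain e x y : 0 <= x -> x <= y -> y <= l ->
  `|Phi (f e y) - Phi (f e x)| <= itl x y (fun t => F (f e t) * `|h e t|).
Proof.
apply: (@der_chain R l (f e) (h e) 0 M Phi F (ltW l0) (adm_der fh e)).
- by move=> t tl; exact: f0M.
- by apply: ctsT; exact: prof_cts.
- by move=> t /andP[t0 _]; exact: prof_ge0.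
- by move=> s t s0 st _; exact: pot_mvt.
- exact: cts_prof.
Qed.

Lemma itg_defect e : itg 0 l (fun x => (`|h e x| - F (f e x)) ^+ 2).
Proof.
have L : L2 0 l (fun x => `|h e x| + (-1) * F (f e x)).
  apply: L2D; first by apply: L2_norm; exact: (adm_der fh e).1.
  by apply: L2Z; apply: cts_L2; exact: cts_prof.
by apply: eq_itg L.2 => x _; rewrite mulN1r.
Qed.

(** By [prof_sqr], M^4 f^2 / 6 - f^6 / 6 is half of F(f)^2; completing the square in h^2 / 2 +
    F(f)^2 / 2 gives [wk] and the defect. *)
Lemma edge_energy e : 2^-1 * sqn l h e + M ^+ 4 / 6 * sqn l f e =
  6^-1 * pwn l 6 f e + (wk e + 2^-1 * defect e).
Proof.
have i2 : itg 0 l (fun x => f e x ^+ 2) by apply: cts_itg; apply: ctsX; exact: adm_cts fh.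
have i6 : itg 0 l (fun x => f e x ^+ 6) by apply: cts_itg; apply: ctsX; exact: adm_cts fh.
have ih := (adm_der fh e).1.2; have iw := itg_wk e; have id := itg_defect e.
have -> : pwn l 6 f e = itl 0 l (fun x => f e x ^+ 6).
  by apply: eq_itl => x xl; rewrite powR_mulrn// (adm_ge0 fh).
rewrite /sqn /wk /defect -!itlZ// -!itlD//; try exact: itgZ; last first.
  by apply: itgD => //; exact: itgZ.
apply: eq_itl => x xl /=; have := prof_sqr M0 (f0M e xl).
rewrite -[h e x ^+ 2]real_normK ?num_real//.
move: (f e x) `|h e x| => t z gE.
have -> : 6^-1 * t ^+ 6 + (F t * z + 2^-1 * (z - F t) ^+ 2) =
   6^-1 * t ^+ 6 + (2^-1 * z ^+ 2 + 2^-1 * F t ^+ 2) by field.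
by rewrite gE; field.
Qed.

Let p26 : 2 < (6 : R) <= 6. Proof. by rewrite lexx andbT ltr_nat. Qed.

Lemma energy_identity : [/\ smb wk, smb defect &
  renergy l 6 f h + M ^+ 4 / 6 * tsum (sqn l f) = tsum wk + 2^-1 * tsum defect].
Proof.
have sf := adm_mass fh; have sh := adm_dirichlet fh; have sp := adm_smb_pwn l0 p26 fh.
have M6 : 0 <= M ^+ 4 / 6 by rewrite divr_ge0// exprn_ge0// ltW.
have s1 : smb (fun e => 2^-1 * sqn l h e + M ^+ 4 / 6 * sqn l f e) by apply: smbD; exact: smbZ.
have sw : smb wk.
  apply: smb_le s1 => e; rewrite edge_energy.
  have := pwn_ge0 l 6 f e; have := defect_ge0 e; lra.
have sd : smb defect.
  have s2 : smb (fun e => 2 * (2^-1 * sqn l h e + M ^+ 4 / 6 * sqn l f e)) by exact: smbZ.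
  apply: smb_le s2 => e; rewrite edge_energy.
  have := pwn_ge0 l 6 f e; have := wk_ge0 e; lra.
split=> //.
have sd2 : smb (fun e => 2^-1 * defect e) by exact: smbZ.
have E : tsum (fun e => 2^-1 * sqn l h e + M ^+ 4 / 6 * sqn l f e) =
   tsum (fun e => 6^-1 * pwn l 6 f e + (wk e + 2^-1 * defect e)) by apply: eq_tsum => e; exact: edge_energy.
have h2 : 0 <= 2^-1 :> R by [].
have h6 : 0 <= 6^-1 :> R by [].
have n1 e : 0 <= 2^-1 * sqn l h e by rewrite mulr_ge0// sqn_ge0.
have n2 e : 0 <= M ^+ 4 / 6 * sqn l f e by rewrite mulr_ge0// sqn_ge0.
have n3 e : 0 <= 6^-1 * pwn l 6 f e by rewrite mulr_ge0// pwn_ge0.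
have n4 e : 0 <= 2^-1 * defect e by rewrite mulr_ge0// defect_ge0.
have n5 e : 0 <= wk e + 2^-1 * defect e by rewrite addr_ge0// wk_ge0.
have swd : smb (fun e => wk e + 2^-1 * defect e) by exact: smbD.
rewrite (tsumD n1 n2 (smbZ h2 sh) (smbZ M6 sf)) (tsumD n3 n5 (smbZ h6 sp) swd) in E.
rewrite (tsumD wk_ge0 n4 sw sd2) !tsumZ// in E.
rewrite /renergy; exact: arith_identity E.
Qed.

Lemma wk_sub_edge e x y : 0 <= x -> x <= y -> y <= l -> itl x y (fun t => F (f e t) * `|h e t|) <= wk e.
Proof. by move=> x0 xy yl; apply: itl_mono => //; [exact: itg_wk|exact: wk_fun_ge0]. Qed.

Definition ray_sum v (c : 'I_6) (N : nat) : R := \sum_(j < N) wk (ray_edge v (c, nat_of_ord j)).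

Lemma ray_sum_le v c N N' : (N <= N')%N -> ray_sum v c N <= ray_sum v c N'.
Proof.
move=> NN; rewrite /ray_sum -!(big_mkord predT (fun j => wk (ray_edge v (c, j)))) (big_cat_nat (leq0n N) NN)//= lerDl.
by apply: sumr_ge0 => *; exact: wk_ge0.
Qed.

Lemma ray_sums v N : smb wk -> \sum_(c < 6) ray_sum v c N <= tsum wk.
Proof.
move=> sw; pose s := [seq ray_edge v ci | ci <- [seq (c, i) | c <- enum 'I_6, i <- iota 0 N]].
have us : uniq s.
  rewrite map_inj_uniq; last exact: ray_edge_inj.
  by apply: allpairs_uniq; [exact: enum_uniq|exact: iota_uniq|move=> [? ?] [? ?] _ _ [-> ->]].
apply: le_trans (tsum_ge sw us); rewrite /s big_map big_allpairs /= big_enum /=.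
apply: ler_sum => c _; rewrite /ray_sum.
have -> : iota 0 N = index_iota 0 N by rewrite /index_iota subn0.
by rewrite big_mkord.
Qed.

Section Rays.
Variable v : int * int.

(* The value of [Phi f] at a_v is replaced by [c]: with [c = 2 Phi (max f) - Phi f(a_v)], the ray
   through the edge carrying the maximum also accounts for the climb to that maximum. *)
Lemma ray_bound (r : 'I_3) (c : R) (vx : hvertex -> R) :
  (forall e, f e 0 = vx (htail e) /\ f e l = vx (hhead e)) ->
  `|c - Phi (vx (hhead (v, r)))| <= wk (v, r) -> forall eps, 0 < eps ->
  exists N, c <= eps + (ray_sum v (inord r.*2) N + ray_sum v (inord r.*2.+1) N).
Proof.
move=> hv hc eps eps0.
pose psi w := if w == inl v then c else Phi (vx w).
(* The changed value at a_v imposes arbitrary weights on the two edges other than [r] there; the ray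
   avoids them. *)
pose W e := if (e.1 == v) && (e.2 != r) then `|c - Phi (vx (hhead e))| else wk e.
have z0 : 0 <= (0 : R) <= l by rewrite lexx ltW.
have psiW e : `|psi (htail e) - psi (hhead e)| <= W e.
  have -> : psi (hhead e) = Phi (vx (hhead e)) by case: e => -[a b] k.
  rewrite /psi /W; have -> : (htail e == inl v) = (e.1 == v) by [].
  case: eqVneq => /= [ev|_]; first case: eqVneq => /= [er|_] //.
    by case: e ev er => e1 e2 /= -> ->.
  have [<- <-] := hv e; rewrite distrC; apply: le_trans (pot_chain e (lexx 0) (ltW l0) (lexx l)) _.
  by apply: wk_sub_edge; rewrite ?(ltW l0).
have shv k (j : int) : j != 0 -> shift k j v != v.
  by apply: contra => /eqP; rewrite -[RHS](shift0 k) => /shift_inj ->.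
(* A positive index keeps the far vertex distinct from a_v, where [psi] was modified. *)
have far k (g : nat -> int) : injective g -> (forall N, (0 < N)%N -> g N != 0) ->
    exists2 N, (0 < N)%N & psi (inl (shift k (g N) v)) <= eps.
  move=> ginj gn; have inj : injective (fun j => (shift k (g j) v, k0) : hedge).
    by move=> i j [] /shift_inj /ginj.
  have d0 : 0 < eps / M ^+ 2 by rewrite divr_gt0// exprn_gt0.
  have [N N0 hN] := edge_small l0 fh inj d0 1; exists N => //.
  have -> : psi (inl (shift k (g N) v)) = Phi (f (shift k (g N) v, k0) 0).
    rewrite /psi (hv _).1 /htail /=; case: eqP => // -[] /eqP.
    by rewrite (negbTE (shv k _ (gn _ N0))).
  apply: (le_trans (pot_small M0 (adm_ge0 fh _ z0))).
  by rewrite mulrC -ler_pdivlMr ?exprn_gt0// ltW// hN.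
have Wfar k k' (j : int) : j != 0 -> W (shift k j v, k') = wk (shift k j v, k').
  by move=> /(shv k) /negbTE sv; rewrite /W /= sv.
have Wr k (j : int) : W (shift k j v, r) = wk (shift k j v, r) by rewrite /W eqxx andbF.
have pv : psi (inl v) = c by rewrite /psi eqxx.
have S1n (j : nat) : (j.+1%:Z != 0) * (- j.+1%:Z != 0) by rewrite oppr_eq0.
(* Edge 0 starts the ray going up in direction 1; edges 1 and 2 start those going down in directions
   1 and 2. *)
case: (ord3P r) Wr => rE Wr; rewrite {}rE in Wr *.
- have [] := @far k1 (fun N => N%:Z); [by move=> i j []|by case|].
  move=> N N0 fN; exists N; rewrite -pv; apply: (le_trans (line_up psiW v N (isT : k1 != k0))).
  apply: lerD => //; rewrite big_split /= /ray_sum; apply: lerD; apply: ler_sum => j _.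
    by rewrite Wr /ray_edge /= inordK.
  by rewrite Wfar ?S1n// /ray_edge /= inordK.
- have [] := @far k1 (fun N => - N%:Z); [by move=> i j /oppr_inj []|by move=> [//|N] _; rewrite S1n|].
  move=> N N0 fN; exists N; rewrite -pv; apply: (le_trans (line_down psiW v N (isT : k1 != k0))).
  apply: lerD => //; rewrite big_split /= /ray_sum; apply: lerD; apply: ler_sum => j _.
    by rewrite Wr /ray_edge /= inordK.
  by rewrite Wfar ?S1n// /ray_edge /= inordK.
- have [] := @far k2 (fun N => - N%:Z); [by move=> i j /oppr_inj []|by move=> [//|N] _; rewrite S1n|].
  move=> N N0 fN; exists N; rewrite -pv; apply: (le_trans (line_down psiW v N (isT : k2 != k0))).
  apply: lerD => //; rewrite big_split /= /ray_sum; apply: lerD; apply: ler_sum => j _.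
    by rewrite Wr /ray_edge /= inordK.
  by rewrite Wfar ?S1n// /ray_edge /= inordK.
Qed.

End Rays.

(** The rays are disjoint. Two of them contribute tau, the value of [Phi f] at a_v, and the one
    through [e] contributes 2 Phi (f e x) - tau. *)
Lemma three_rays e x : smb wk -> 0 <= x <= l -> 2 * Phi (f e x) + Phi (f e 0) <= tsum wk.
Proof.
move=> sw xl; have [vx hv] := adm_vertex fh; have /andP[x0 xl'] := xl.
set P := 2 * Phi (f e x) + _.
pose v := e.1; pose tau := Phi (vx (inl v)).
have tauE r : Phi (f (v, r) 0) = tau by rewrite (hv _).1.
have tauE' : Phi (f e 0) = tau by rewrite (hv _).1.
pose c (r : 'I_3) := if r == e.2 then 2 * Phi (f e x) - tau else tau.
(* On [e], 2 Phi (f x) - Phi (f 0) - Phi (f l) is the sum of the climbs from both ends, each bounded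
   by the part of [wk e] on its side of [x]. *)
have hc r : `|c r - Phi (vx (hhead (v, r)))| <= wk (v, r).
  rewrite /c; case: eqVneq => [->|_]; last first.
    rewrite -(tauE r) -(hv _).2 distrC.
    apply: le_trans (pot_chain _ (lexx 0) (ltW l0) (lexx l)) _.
    by apply: wk_sub_edge; rewrite ?(ltW l0).
  rewrite -surjective_pairing -(hv e).2 -tauE'.
  have h1 := pot_chain e (lexx 0) x0 xl'; have h2 := pot_chain e x0 xl' (lexx l).
  have -> : wk e = itl 0 x (fun t => F (f e t) * `|h e t|) + itl x l (fun t => F (f e t) * `|h e t|).
    by apply: itl_split => //; exact: itg_wk.
  have -> : 2 * Phi (f e x) - Phi (f e 0) - Phi (f e l) =
    (Phi (f e x) - Phi (f e 0)) + - (Phi (f e l) - Phi (f e x)) by ring.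
  by apply: (le_trans (ler_normD _ _)); rewrite normrN lerD.
apply/ler_addgt0Pr => eps eps0; have e3 : 0 < eps / 3 by rewrite divr_gt0.
have [N0 H0] := ray_bound hv (hc k0) e3.
have [N1 H1] := ray_bound hv (hc k1) e3.
have [N2 H2] := ray_bound hv (hc k2) e3.
have cs : c k0 + c k1 + c k2 = P.
  rewrite /P tauE' /c; case: (e) => w k /=; case: (ord3P k) => -> /=; ring.
have RS := ray_sums v (N0 + N1 + N2) sw.
have m0 a : ray_sum v a N0 <= ray_sum v a (N0 + N1 + N2) by apply: ray_sum_le; rewrite -addnA leq_addr.
have m1 a : ray_sum v a N1 <= ray_sum v a (N0 + N1 + N2) by apply: ray_sum_le; rewrite addnAC leq_addl.
have m2 a : ray_sum v a N2 <= ray_sum v a (N0 + N1 + N2) by apply: ray_sum_le; rewrite leq_addl.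
rewrite sum_ord6 in RS; rewrite -cs.
exact: (arith_rays H0 H1 H2 (m0 _) (m0 _) (m1 _) (m1 _) (m2 _) (m2 _) RS).
Qed.

End CriticalPower.

(** * Strictness at the critical exponent *)

Section Strict.
Variables (R : realType) (l : R).
Hypothesis l0 : 0 < l.
Implicit Types (e : hedge) (f h : hedge -> R -> R).

(** Here [z] stands for |f'| and [g] for F(f): the left side bounds the derivative of ln (f + eps),
    and when the defect vanishes only a constant independent of [eps] remains after integration. *)
Lemma arith_defect (M t z g eps : R) : 0 < eps -> 0 <= t -> 0 <= g -> g <= M ^+ 2 * t ->
  (t + eps)^-1 * z <= (M ^+ 2 + 1) + eps^-1 ^+ 2 * (z - g) ^+ 2.
Proof.
move=> e0 t0 g0 gt; have te : 0 < t + eps by rewrite ltr_wpDl.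
pose u := (t + eps)^-1 * (z - g).
have -> : (t + eps)^-1 * z = (t + eps)^-1 * g + u by rewrite /u; ring.
have h1 : (t + eps)^-1 * g <= M ^+ 2.
  rewrite mulrC ler_pdivrMr//; apply: (le_trans gt).
  by rewrite ler_wpM2l ?sqr_ge0// lerDl ltW.
have h2 : u <= 1 + u ^+ 2 by nra.
have h3 : u ^+ 2 <= eps^-1 ^+ 2 * (z - g) ^+ 2.
  rewrite /u exprMn ler_wpM2r ?sqr_ge0// lerXn2r ?nnegrE ?invr_ge0 ?(ltW te) ?(ltW e0)//.
  by rewrite lef_pV2 ?posrE// lerDr.
by rewrite -addrA; apply: lerD => //; exact: le_trans h2 (lerD _ h3).
Qed.

Lemma inv_lip (eps s t : R) : 0 < eps -> 0 <= s -> 0 <= t ->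
  `|(s + eps)^-1 - (t + eps)^-1| <= eps^-1 ^+ 2 * `|s - t|.
Proof.
move=> e0 s0 t0; have se : 0 < s + eps by rewrite ltr_wpDl.
have te : 0 < t + eps by rewrite ltr_wpDl.
have -> : (s + eps)^-1 - (t + eps)^-1 = ((s + eps)^-1 * (t + eps)^-1) * (t - s).
  by field; rewrite !gt_eqF.
rewrite normrM [`|t - s|]distrC ler_wpM2r// ger0_norm; last by rewrite mulr_ge0// invr_ge0 ltW.
by rewrite expr2 ler_pM ?invr_ge0 ?(ltW se) ?(ltW te)// lef_pV2 ?posrE// lerDr.
Qed.

Lemma ln_mvt (eps s t : R) : 0 < eps -> 0 <= s -> s <= t ->
  `|ln (t + eps) - ln (s + eps)| <= (s + eps)^-1 * (t - s).
Proof.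
move=> e0 s0 st; have se : 0 < s + eps by rewrite ltr_wpDl.
have te : 0 < t + eps by rewrite (lt_le_trans se)// lerD2r.
rewrite ger0_norm; last by rewrite subr_ge0 ler_ln ?posrE// lerD2r.
rewrite -ln_div ?posrE//.
have -> : (t + eps) / (s + eps) = 1 + (s + eps)^-1 * (t - s) by field; rewrite gt_eqF.
apply: le_ln1Dx; apply: (@lt_le_trans _ _ 0) => //.
by rewrite mulr_ge0 ?subr_ge0// invr_ge0 ltW.
Qed.

Variables (f h : hedge -> R -> R) (M : R).
Hypotheses (fh : adm l f h) (M0 : 0 < M).
Hypothesis fM : forall e x, 0 <= x <= l -> f e x <= M.

(** A Gronwall argument in logarithmic form: ln (f + eps) increases by at most C along the edge, so
    f <= e^C eps for every eps. *)
Lemma zero_edge e : defect l f h M e = 0 -> f e 0 = 0 -> forall x, 0 <= x <= l -> f e x = 0.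
Proof.
move=> d0 f0 x xl; have /andP[x0 xl'] := xl.
have fx := adm_ge0 fh e xl; apply/eqP; rewrite eq_le fx andbT.
pose C := (M ^+ 2 + 1) * l; apply/ler_addgt0Pr => eps' e'0; rewrite add0r.
pose eps := eps' / expR C; have eps0 : 0 < eps by rewrite divr_gt0// expR_gt0.
have lip0 s t : 0 <= s <= M -> 0 <= t <= M ->
    `|(s + eps)^-1 - (t + eps)^-1| <= eps^-1 ^+ 2 * `|s - t|.
  by move=> /andP[s0 _] /andP[t0 _]; exact: inv_lip.
have f0M t : 0 <= t <= l -> 0 <= f e t <= M by move=> tl; rewrite fM// (adm_ge0 fh).
have c1 : cts 0 M (fun s => (s + eps)^-1).
  have ci : cts 0 M id by apply: ctsT => z; exact: cvg_id.
  exact: (@cts_lip _ _ _ id (fun s => (s + eps)^-1) (eps^-1 ^+ 2) ci lip0).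
have c2 : cts 0 l (fun t => (f e t + eps)^-1).
  apply: (@cts_lip _ _ _ (f e) (fun s => (s + eps)^-1) (eps^-1 ^+ 2)); first exact: adm_cts fh.
  by move=> s t sl tl; apply: lip0; exact: f0M.
have dc := @der_chain R l (f e) (h e) 0 M (fun t => ln (t + eps)) (fun t => (t + eps)^-1) (ltW l0)
  (adm_der fh e) f0M c1.
have {dc} : `|ln (f e x + eps) - ln (f e 0 + eps)| <= itl 0 x (fun t => (f e t + eps)^-1 * `|h e t|).
  apply: dc => //.
  - by move=> t /andP[t0 _]; rewrite invr_ge0 addr_ge0// ltW.
  - by move=> s t s0 st _; exists s; [rewrite lexx|exact: ln_mvt].
have i1 : itg 0 l (fun t => (f e t + eps)^-1 * `|h e t|).
  by apply: itgM => //; apply: itg_norm; apply: L2_itg; exact: (adm_der fh e).1.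
have i2 := itg_defect fh M e.
have : itl 0 x (fun t => (f e t + eps)^-1 * `|h e t|) <= C.
  apply: (@le_trans _ _ (itl 0 l (fun t => (f e t + eps)^-1 * `|h e t|))).
    apply: itl_mono => // t tl; rewrite mulr_ge0// invr_ge0 addr_ge0 ?(ltW eps0)//.
    by case/andP: (f0M t tl).
  apply: (@le_trans _ _ (itl 0 l (fun t => (M ^+ 2 + 1) + eps^-1 ^+ 2 * (`|h e t| - prof M (f e t)) ^+ 2))).
    apply: itl_le => //.
      by apply: itgD; [apply: cts_itg; exact: cts_cst|exact: itgZ].
    move=> t tl; have /andP[t0 _] := f0M t tl.
    by apply: arith_defect => //; [exact: prof_ge0|exact: prof_le].
  rewrite itlD; [|by apply: cts_itg; exact: cts_cst|exact: itgZ].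
  by rewrite itl_cst ?(ltW l0)// itlZ// -/(defect l f h M e) d0 mulr0 addr0 subr0.
move=> hC /le_trans /(_ hC); rewrite f0 add0r => /ler_normlW.
rewrite lerBlDr => hl.
have fe : 0 < f e x + eps by rewrite ltr_wpDl.
have : f e x + eps <= expR C * eps.
  by rewrite -[f e x + eps]lnK ?posrE// -[X in _ * X]lnK ?posrE// -expRD ler_expR.
move=> H; have -> : eps' = expR C * eps by rewrite /eps mulrC divfK// gt_eqF// expR_gt0.
by apply: le_trans H; rewrite lerDl ltW.
Qed.

End Strict.

Section Threshold.
Variables (R : realType) (l : R).
Hypothesis l0 : 0 < l.
Implicit Types (e : hedge) (f h : hedge -> R -> R).

Definition mu6 : R := pi * Num.sqrt 3 / 2.

Lemma arith_threshold (E m M4 s q P d T : R) : 0 < s -> s ^+ 2 = 3 -> 0 <= M4 ->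
  E + M4 / 6 * m = T + 2^-1 * d -> m <= q * s / 2 -> M4 * q / (8 * s) <= P ->
  forall tau, 2 * P + tau <= T -> tau + 2^-1 * d <= E.
Proof.
move=> s0 s3 M40 h1 h2 h3 tau h4.
have h5 : M4 / 6 * m <= 2 * (M4 * q / (8 * s)).
  have -> : 2 * (M4 * q / (8 * s)) = M4 / 6 * (q * s / 2).
    have -> : M4 / 6 * (q * s / 2) = M4 * q * (s ^+ 2) / (12 * s) by field; rewrite gt_eqF.
    by rewrite s3; field; rewrite gt_eqF.
  by rewrite ler_wpM2l// divr_ge0.
by move: h1 h3 h4 h5; lra.
Qed.

Lemma energy6_gt0 f h : adm l f h -> 0 < tsum (sqn l f) -> tsum (sqn l f) <= mu6 ->
  0 < renergy l 6 f h.
Proof.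
move=> fh m0 mle; have sf := adm_mass fh; have sh := adm_dirichlet fh.
(* The global maximum is found in two stages: on each edge, then among the edges, where the squares
   of the maxima are summable by [der_sup]. *)
have /choice[xm hxm] : forall e, exists x, 0 <= x <= l /\ forall t, 0 <= t <= l -> f e t <= f e x.
  move=> e; have [x] := EVT_max (ltW l0) (adm_cts fh (e := e)); rewrite in_itv /= => xl hx.
  by exists x; split=> // t tl; apply: hx; rewrite in_itv.
have sG : smb (fun e => 2 / l * sqn l f e + 2 * l * sqn l h e).
  by apply: smbD; apply: smbZ => //; [rewrite divr_ge0// ltW|rewrite mulr_ge0// ltW].
pose a e := f e (xm e) ^+ 2.
have sa : smb a.
  by apply: smb_le sG => e; have [xl _] := hxm e; have := der_sup l0 (adm_der fh e) xl.
have [e1 ae1] : exists e1, 0 < a e1.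
  apply: contrapT => /forallNP H; move: m0; rewrite ltNge => /negP; apply.
  apply: tsum_le => s _; rewrite big1// => e _.
  rewrite /sqn (eq_itl (g := fun=> 0)); first by rewrite itl_cst ?mul0r// ltW.
  move=> x xl; have az : f e (xm e) = 0.
    by apply/eqP; apply/negPn/negP => fn; apply: (H e); rewrite /a exprn_even_gt0.
  have := (hxm e).2 x xl; rewrite az => fx0.
  by rewrite (_ : f e x = 0) ?expr0n//; apply/eqP; rewrite eq_le fx0 (adm_ge0 fh).
have [e he] := smb_max (fun e => sqr_ge0 (f e (xm e))) sa ae1.
pose M := f e (xm e); have xl := (hxm e).1.
have M0 : 0 < M.
  rewrite lt_neqAle (adm_ge0 fh)// andbT eq_sym; apply/negP => /eqP Mz.
  by have := lt_le_trans ae1 (he e1); rewrite -/M Mz expr0n ltxx.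
have fM e' x : 0 <= x <= l -> f e' x <= M.
  move=> x'l; apply: (le_trans ((hxm e').2 x x'l)).
  have nn e0 : 0 <= f e0 (xm e0) by apply: (adm_ge0 fh); case: (hxm e0).
  by have := he e'; rewrite /a ler_pXn2r ?nnegrE ?nn.
have [sw sd EI] := energy_identity l0 fh M0 fM.
have TR : 2 * pot M M + pot M (f e 0) <= tsum (wk l f h M) := @three_rays _ _ l0 _ _ fh _ M0 fM e _ sw xl.
have z0 : 0 <= (0 : R) <= l by rewrite lexx ltW.
have M4 : 0 <= M ^+ 4 by rewrite exprn_ge0// ltW.
have s30 : 0 < Num.sqrt 3 :> R by rewrite sqrtr_gt0.
have s32 : Num.sqrt 3 ^+ 2 = 3 :> R by rewrite sqr_sqrtr.
(* A mass at most [mu6] makes M^4 m / 6 at most 2 Phi(M); the two cancel and leave Phi (f e 0) plus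
   half the defect as a lower bound for the energy. *)
have key := arith_threshold s30 s32 M4 EI mle (pot_max M0) TR.
have t0 : 0 <= f e 0 by exact: (adm_ge0 fh).
have Pt := pot_ge0 M0 t0; have D0 := tsum_ge0 sd.
rewrite lt_neqAle (le_trans _ key) ?addr_ge0 ?mulr_ge0// andbT eq_sym; apply/negP => /eqP E0.
rewrite E0 in key.
have /eqP : pot M (f e 0) + 2^-1 * tsum (defect l f h M) == 0 by rewrite eq_le key addr_ge0// mulr_ge0.
move=> /eqP; rewrite paddr_eq0 ?mulr_ge0// => /andP[/eqP p0 /eqP d0].
have f0 : f e 0 = 0.
  apply/eqP/negPn/negP => fn; have fp : 0 < f e 0 by rewrite lt_neqAle eq_sym fn.
  by have := pot_gt0 M0 fp (fM _ _ z0); rewrite p0 ltxx.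
have de : defect l f h M e = 0.
  apply/eqP; rewrite eq_le defect_ge0 andbT; apply: (le_trans (tsum_ge1 e sd)).
  by move/eqP: d0; rewrite mulf_eq0 invr_eq0 pnatr_eq0 /= => /eqP ->.
by have := zero_edge l0 fh M0 fM de f0 xl; move: M0; rewrite /M => /[swap] ->; rewrite ltxx.
Qed.

End Threshold.

(** * The critical exponent: concentrating solitons *)

Lemma arith_flux (R : realFieldType) (Z k m n : R) : 0 <= Z -> - Z = k / 2 * m - 4 / 3 * n ->
  3 / 8 * k * m <= n.
Proof.
have -> : k / 2 * m = 2^-1 * (k * m) by ring.
have -> : 3 / 8 * k * m = 3 / 8 * (k * m) by ring.
lra.
Qed.

Lemma arith_flux2 (R : realFieldType) (k m n : R) : 3 / 8 * k * m <= n -> k / 4 * m - 3^-1 * n <= n / 3.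
Proof.
have -> : k / 4 * m = 4^-1 * (k * m) by ring.
have -> : 3 / 8 * k * m = 3 / 8 * (k * m) by ring.
lra.
Qed.

Section Soliton.
Variables (R : realType) (l K : R).
Hypotheses (l0 : 0 < l) (K0 : 0 < K).
Implicit Types (x : R).

Let s3 : 0 < Num.sqrt 3 :> R. Proof. by rewrite sqrtr_gt0. Qed.
Let s32 : Num.sqrt 3 ^+ 2 = 3 :> R. Proof. by rewrite sqr_sqrtr. Qed.

(** [ch2] is twice the hyperbolic cosine of K (x - l / 2) and [th] its hyperbolic tangent; [sol] is
    the soliton of the line centred at the midpoint of the edge, and K governs its concentration. *)
Definition ep x : R := expR (K * (x - l / 2)).
Definition en x : R := expR (- (K * (x - l / 2))).
Definition ch2 x : R := ep x + en x.
Definition th x : R := (ep x - en x) / ch2 x.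
Definition sol2 x : R := K * Num.sqrt 3 / ch2 x.
Definition sol x : R := Num.sqrt (sol2 x).
Definition dsol x : R := - (K / 2) * sol x * th x.

Lemma ep_gt0 x : 0 < ep x. Proof. exact: expR_gt0. Qed.
Lemma en_gt0 x : 0 < en x. Proof. exact: expR_gt0. Qed.
Lemma ch2_gt0 x : 0 < ch2 x. Proof. exact: addr_gt0 (ep_gt0 x) (en_gt0 x). Qed.
Lemma ep_en x : ep x * en x = 1. Proof. by rewrite /ep /en expRN divff// gt_eqF// expR_gt0. Qed.
Lemma sol2_gt0 x : 0 < sol2 x. Proof. by rewrite divr_gt0 ?ch2_gt0// mulr_gt0. Qed.
Lemma sol_gt0 x : 0 < sol x. Proof. by rewrite sqrtr_gt0 sol2_gt0. Qed.
Lemma sol_sqr x : sol x ^+ 2 = sol2 x. Proof. by rewrite sqr_sqrtr// ltW// sol2_gt0. Qed.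

Lemma th_sqr x : th x ^+ 2 = 1 - 4 * sol2 x ^+ 2 / (3 * K ^+ 2).
Proof.
have c := ch2_gt0 x; have e := ep_en x.
have -> : th x ^+ 2 = ((ch2 x) ^+ 2 - 4 * (ep x * en x)) / (ch2 x) ^+ 2.
  by rewrite /th /ch2; field; rewrite gt_eqF.
rewrite e /sol2 !exprMn s32; field.
by rewrite !gt_eqF.
Qed.

Lemma ep_derive x : is_derive x (1 : R) ep (K * ep x).
Proof.
rewrite /ep; apply: is_derive_eq; rewrite /GRing.scale /=; ring.
Qed.

Lemma en_derive x : is_derive x (1 : R) en (- (K * en x)).
Proof.
rewrite /en; apply: is_derive_eq; rewrite /GRing.scale /=; ring.
Qed.

Lemma sol2_derive x : is_derive x (1 : R) sol2 (- (K * (sol2 x * th x))).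
Proof.
have de := ep_derive x; have dn := en_derive x.
have dc : is_derive x (1 : R) ch2 (K * (ep x - en x)).
  rewrite /ch2; apply: is_derive_eq; ring.
have c0 : ch2 x != 0 by rewrite gt_eqF// ch2_gt0.
have dV := @is_deriveV _ ch2 x _ 1 c0 dc.
have -> : sol2 = fun x => K * Num.sqrt 3 * (ch2 x)^-1 by [].
apply: is_derive_eq; rewrite /GRing.scale /= /th.
field.
exact: c0.
Qed.

Lemma th_derive x : is_derive x (1 : R) th (K * (1 - th x ^+ 2)).
Proof.
have de := ep_derive x; have dn := en_derive x.
have dc : is_derive x (1 : R) ch2 (K * (ep x - en x)).
  rewrite /ch2; apply: is_derive_eq; ring.
have c0 : ch2 x != 0 by rewrite gt_eqF// ch2_gt0.
have dV := @is_deriveV _ ch2 x _ 1 c0 dc.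
have -> : th = fun x => (ep x - en x) * (ch2 x)^-1 by [].
apply: is_derive_eq; rewrite /GRing.scale /=.
rewrite opprK -mulrDr -/(ch2 x); field.
exact: c0.
Qed.

Lemma sol_derive x : is_derive x (1 : R) sol (dsol x).
Proof.
have d2 := sol2_derive x.
have dq : is_derive x (1 : R) (fun x => Num.sqrt (sol2 x)) ((2 * Num.sqrt (sol2 x))^-1 * (- (K * (sol2 x * th x)))).
  by apply: (@is_derive1_comp _ Num.sqrt sol2); apply: is_derive1_sqrt; exact: sol2_gt0.
have -> : dsol x = (2 * Num.sqrt (sol2 x))^-1 * (- (K * (sol2 x * th x))).
  rewrite /dsol -sol_sqr sqrtr_sqr ger0_norm ?(ltW (sol_gt0 x))//; field.
  by rewrite gt_eqF// sol_gt0.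
by [].
Qed.

Lemma derive_cont (phi k : R -> R) : (forall x, is_derive x (1 : R) phi (k x)) -> continuous phi.
Proof.
move=> d x; have [dx _] := d x.
by apply: differentiable_continuous; apply/derivable1_diffP.
Qed.

Lemma sol2_cont : continuous sol2. Proof. exact: derive_cont sol2_derive. Qed.
Lemma th_cont : continuous th. Proof. exact: derive_cont th_derive. Qed.
Lemma sol_cont : continuous sol. Proof. exact: derive_cont sol_derive. Qed.
Lemma dsol_cont : continuous dsol.
Proof.
move=> x; apply: cvgM; last exact: th_cont.
by apply: cvgM; [exact: cvg_cst|exact: sol_cont].
Qed.

Definition m2 : R := itl 0 l sol2.
Definition m6 : R := itl 0 l (fun x => sol2 x ^+ 3).

Let itgc (g : R -> R) : continuous g -> itg 0 l g.
Proof. by move=> cg; apply: cts_itg; exact: ctsT. Qed.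

Let cX (g : R -> R) n : continuous g -> continuous (fun x => g x ^+ n).
Proof.
move=> cg x; apply: (@continuous_comp _ _ _ g (fun t => t ^+ n)); [exact: cg|exact: exprn_continuous].
Qed.

(** sqrt 3 atan ([ep]) is a primitive of [sol2], and over the whole line it would increase by
    [mu6]. *)
Lemma m2_lt : m2 < mu6 R.
Proof.
pose phi x := Num.sqrt 3 * atan (ep x).
have dphi x : is_derive x (1 : R) phi (sol2 x).
  have de := ep_derive x.
  have da : is_derive x (1 : R) (fun x => atan (ep x)) ((1 + ep x ^+ 2)^-1 * (K * ep x)).
    exact: (@is_derive1_comp _ (@atan R) ep).
  have -> : sol2 x = Num.sqrt 3 * ((1 + ep x ^+ 2)^-1 * (K * ep x)).
    have e0 := ep_gt0 x; have n0 := en_gt0 x.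
    rewrite /sol2 /ch2; have -> : en x = (ep x)^-1 by rewrite -[RHS]mulr1 -(ep_en x) mulKf// gt_eqF.
    by field; rewrite (gt_eqF e0) gt_eqF// ltr_pwDl ?sqr_ge0.
  exact: is_deriveZ da.
rewrite /m2 -(C1_itl (ltW l0) dphi sol2_cont) /phi /mu6 -mulrBr mulrAC [ltRHS]mulrC ltr_pM2l//.
have h1 := @atan_ltpi2 R (ep l).
have h2 : 0 < atan (ep 0) by rewrite -[ltLHS](@atan0 R); apply: lt_atan; exact: ep_gt0.
by move: h1 h2; lra.
Qed.

Lemma end_en : ep 0 = en l /\ en 0 = ep l.
Proof. by split; rewrite /ep /en; congr expR; field. Qed.

Lemma ch2_end : ch2 0 = ch2 l.
Proof. by rewrite /ch2; have [-> ->] := end_en; rewrite addrC. Qed.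

Lemma sol_end : sol 0 = sol l. Proof. by rewrite /sol /sol2 ch2_end. Qed.

Lemma th_end : th 0 = - th l.
Proof. by rewrite /th ch2_end; have [-> ->] := end_en; ring. Qed.

Lemma th_l_ge0 : 0 <= th l.
Proof.
rewrite divr_ge0 ?(ltW (ch2_gt0 l))// subr_ge0 /en /ep ler_expR.
have : 0 <= K * (l - l / 2) by rewrite mulr_ge0 ?(ltW K0)// subr_ge0 ler_pdivrMr// ler_peMr ?(ltW l0)// ler1n.
by move=> h; rewrite (le_trans _ h)// oppr_le0.
Qed.

(* [sol * dsol] is nonnegative at 0 and nonpositive at [l]: integrating its derivative
   replaces the virial identity of the soliton on the whole line. *)
Lemma m6_ge : 3 / 8 * K ^+ 2 * m2 <= m6.
Proof.
pose phi x := - (K / 2) * (sol2 x * th x).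
have dphi x : is_derive x (1 : R) phi (K ^+ 2 / 2 * sol2 x - 4 / 3 * sol2 x ^+ 3).
  have d1 := sol2_derive x; have d2 := th_derive x.
  have -> : K ^+ 2 / 2 * sol2 x - 4 / 3 * sol2 x ^+ 3 =
    - (K / 2) * (sol2 x * (K * (1 - th x ^+ 2)) + th x * (- (K * (sol2 x * th x)))).
    have -> : - (K / 2) * (sol2 x * (K * (1 - th x ^+ 2)) + th x * (- (K * (sol2 x * th x)))) =
       - (K ^+ 2 / 2) * sol2 x * (1 - 2 * th x ^+ 2) by field.
    by rewrite th_sqr; field; rewrite gt_eqF.
  exact: is_deriveZ (is_deriveM d1 d2).
have ck : continuous (fun x => K ^+ 2 / 2 * sol2 x - 4 / 3 * sol2 x ^+ 3).
  move=> x; apply: cvgB; apply: cvgM; try exact: cvg_cst; [exact: sol2_cont|exact: (cX sol2_cont)].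
have i1 := itgc sol2_cont; have i3 := itgc (@cX sol2 3 sol2_cont).
have := C1_itl (ltW l0) dphi ck.
rewrite itlB; [|exact: itgZ|exact: itgZ]; rewrite (itlZ _ i1) (itlZ _ i3) -/m2 -/m6 /phi.
have -> : sol2 0 = sol2 l by rewrite /sol2 ch2_end.
rewrite th_end => H.
have Z : 0 <= K * (sol2 l * th l) by rewrite mulr_ge0 ?(ltW K0)// mulr_ge0 ?th_l_ge0// ltW// sol2_gt0.
have E : - (K / 2) * (sol2 l * th l) - - (K / 2) * (sol2 l * - th l) = - (K * (sol2 l * th l)) by field.
by rewrite E in H; exact: arith_flux Z H.
Qed.

(** Pointwise the integrand is K^2 sol^2 / 4 - sol^6 / 3, and [m6_ge] bounds the first term. It says
    that the truncated soliton has nonpositive energy. *)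
Lemma dsol_dirichlet : itl 0 l (fun x => dsol x ^+ 2) <= m6 / 3.
Proof.
have i1 := itgc sol2_cont; have i3 := itgc (@cX sol2 3 sol2_cont).
have -> : itl 0 l (fun x => dsol x ^+ 2) = K ^+ 2 / 4 * m2 - 3^-1 * m6.
  rewrite /m2 /m6 -(itlZ _ i1) -(itlZ _ i3) -itlB; [|exact: itgZ|exact: itgZ].
  apply: eq_itl => x _; have -> : dsol x ^+ 2 = K ^+ 2 / 4 * sol x ^+ 2 * th x ^+ 2 by rewrite /dsol; field.
  rewrite sol_sqr th_sqr; field.
  by rewrite gt_eqF.
exact: arith_flux2 m6_ge.
Qed.

Lemma ch2_le x : 0 <= x <= l -> ch2 x <= ch2 0.
Proof.
move=> /andP[x0 xl]; rewrite ch2_end /ch2.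
have h1 : ep x <= ep l by rewrite /ep ler_expR ler_pM2l// lerD2r.
have h2 : en l <= ep x by rewrite /ep /en ler_expR -mulrN ler_pM2l//; move: x0; lra.
have e1 := ep_en x; have e2 := ep_en l; have p1 := ep_gt0 x; have p2 := ep_gt0 l.
have n1 := en_gt0 x; have n2 := en_gt0 l.
have : 0 <= (ep l - ep x) * (1 - en x * en l).
  rewrite mulr_ge0 ?subr_ge0// -e1 mulrC ler_pM2r//.
by nra.
Qed.

Lemma sol_end_le x : 0 <= x <= l -> sol 0 <= sol x.
Proof.
move=> xl; apply: ler_wsqrtr; rewrite /sol2 ler_pM2l ?mulr_gt0// lef_pV2 ?posrE ?ch2_gt0//.
exact: ch2_le.
Qed.

Lemma sol2_max x : sol2 x <= K * Num.sqrt 3 / 2.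
Proof.
rewrite /sol2 ler_pM2l ?mulr_gt0// lef_pV2 ?posrE ?ch2_gt0//.
have e1 := ep_en x; have p1 := ep_gt0 x; have n1 := en_gt0 x.
have : 0 <= (ep x - en x) ^+ 2 by exact: sqr_ge0.
by rewrite /ch2; nra.
Qed.

Definition wmax : R := Num.sqrt (K * Num.sqrt 3 / 2).

Lemma sol_max x : sol x <= wmax.
Proof. by apply: ler_wsqrtr; exact: sol2_max. Qed.

(** Subtracting the end value from the soliton costs at most 6 sol(0) wmax^3 times the mass in the
    integral of the sixth power. This factor is of order K^(3/2), below the K^2 that is gained; the
    bound 1 + y <= e^y suffices for it. *)
Lemma tail_small : (sol 0 * wmax ^+ 3) ^+ 2 <= 9 / (4 * l) * K ^+ 3.
Proof.
have w2 : wmax ^+ 2 = K * Num.sqrt 3 / 2 by rewrite sqr_sqrtr// divr_ge0// mulr_ge0 ?(ltW K0).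
have -> : (sol 0 * wmax ^+ 3) ^+ 2 = sol 0 ^+ 2 * (wmax ^+ 2) ^+ 3 by ring.
rewrite w2 sol_sqr /sol2.
have c0 := ch2_gt0 0.
have -> : K * Num.sqrt 3 / ch2 0 * (K * Num.sqrt 3 / 2) ^+ 3 = K ^+ 4 * (Num.sqrt 3 ^+ 2) ^+ 2 / (8 * ch2 0).
  by field; rewrite gt_eqF.
rewrite s32.
have h : K * l / 2 <= ch2 0.
  rewrite ch2_end /ch2; apply: (@le_trans _ _ (ep l)); last by rewrite lerDl ltW// en_gt0.
  have := @expR_ge1Dx R (K * (l - l / 2)); rewrite -/(ep l).
  have -> : K * (l - l / 2) = K * l / 2 by field.
  lra.
have Kl : 0 < K * l / 2 by rewrite divr_gt0// mulr_gt0.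
have -> : 9 / (4 * l) * K ^+ 3 = K ^+ 4 * 3 ^+ 2 / (8 * (K * l / 2)) by field; rewrite !gt_eqF.
rewrite ler_pM2l; last by rewrite mulr_gt0 ?exprn_gt0.
by rewrite lef_pV2 ?posrE ?mulr_gt0// ler_pM2l.
Qed.

Lemma sol_end_lt : sol 0 < sol (l / 2).
Proof.
have h2 : ch2 (l / 2) = 2 by rewrite /ch2 /ep /en subrr mulr0 oppr0 expR0.
rewrite /sol ltr_sqrt ?sol2_gt0// /sol2 ltr_pM2l ?mulr_gt0// ltf_pV2 ?posrE ?ch2_gt0// h2.
have Kl : 0 < K * (l - l / 2) by rewrite mulr_gt0// subr_gt0 ltr_pdivrMr// ltr_pMr ?ltr1n.
have p1 : 1 < ep l by rewrite /ep expR_gt1.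
have n1 : en l < 1 by rewrite /en expR_lt1 oppr_lt0.
have e1 := ep_en l; rewrite ch2_end /ch2.
have : 0 < (ep l - 1) * (1 - en l) by rewrite mulr_gt0 ?subr_gt0.
have -> : (ep l - 1) * (1 - en l) = ep l + en l - 1 - ep l * en l by ring.
by rewrite e1; lra.
Qed.

End Soliton.

(** * Functions supported on a single edge *)

Section SingleEdge.
Variables (R : realType) (l : R).
Hypothesis l0 : 0 < l.

Lemma tsum_single (T : choiceType) (a : T -> R) e0 : (forall e, 0 <= a e) ->
  (forall e, e != e0 -> a e = 0) -> smb a /\ tsum a = a e0.
Proof.
move=> a0 ae; have [sa le] := @tsum_supp _ _ a [:: e0] a0 isT (fun e => ltac:(by rewrite inE => /ae)).
split=> //; apply/eqP; rewrite eq_le tsum_ge1// andbT (le_trans le)//.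
by rewrite big_seq1.
Qed.

Definition single (v : R -> R) : hedge -> R -> R := fun e x => if e == ((0, 0), k0) then v x else 0.

Variables (v k : R -> R).
Hypothesis vk : der l v k.
Hypotheses (v_ge0 : forall x, 0 <= x <= l -> 0 <= v x) (v0 : v 0 = 0) (vl : v l = 0).

Lemma single_sqn w : smb (sqn l (single w)) /\ tsum (sqn l (single w)) = itl 0 l (fun x => w x ^+ 2).
Proof.
have [h1 h2] := @tsum_single _ (sqn l (single w)) ((0, 0), k0) (sqn_ge0 l _)
  (fun e => ltac:(by move=> /negbTE en; rewrite /sqn /single en expr0n /= itl_cst ?mul0r// ltW)).
by split=> //; rewrite h2 /sqn /single eqxx.
Qed.

Lemma single_pwn : tsum (pwn l 6 (single v)) = itl 0 l (fun x => v x ^+ 6).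
Proof.
have [h1 ->] := @tsum_single _ (pwn l 6 (single v)) ((0, 0), k0) (pwn_ge0 l 6 _)
  (fun e => ltac:(by move=> /negbTE en; rewrite /pwn /single en powR0 ?itl_cst ?mul0r ?pnatr_eq0// ltW)).
by apply: eq_itl => x xl; rewrite /single eqxx powR_mulrn// v_ge0.
Qed.

Lemma single_adm : adm l (single v) (single k).
Proof.
split.
- move=> e; rewrite /single; case: eqP => // _; split; first by apply: cts_L2; exact: cts_cst.
  by move=> x y _ xy _; rewrite itl_cst// mul0r subrr.
- by move=> e x xl; rewrite /single; case: eqP => // _; exact: v_ge0.
- by exists (fun=> 0) => e; rewrite /single; case: eqP.
- exact: (single_sqn v).1.
- exact: (single_sqn k).1.
Qed.

End SingleEdge.

Section Supercritical.
Variables (R : realType) (l : R).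
Hypothesis l0 : 0 < l.

Lemma bernoulli6 (d w : R) : 0 <= d -> d <= w -> w ^+ 6 - 6 * d * w ^+ 5 <= (w - d) ^+ 6.
Proof.
move=> d0 dw; pose a := w - d; have a0 : 0 <= a by rewrite subr_ge0.
have -> : w = a + d by rewrite subrK.
have -> : a + d - d = a by rewrite addrK.
have -> : (a + d) ^+ 6 - 6 * d * (a + d) ^+ 5 = a ^+ 6 - (15 * (a ^+ 4 * d ^+ 2) +
   40 * (a ^+ 3 * d ^+ 3) + 45 * (a ^+ 2 * d ^+ 4) + 24 * (a * d ^+ 5) + 5 * d ^+ 6) by ring.
by rewrite lerBlDr lerDl !addr_ge0// !mulr_ge0// exprn_ge0.
Qed.

(** The factor A2^2 >= r on the potential gains (r - 1) I6 / 6, at least (r - 1) K^2 I2 / 16; the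
    correction [w] consumes at most half of this. *)
Lemma arith_super (A2 mu r D P I2 I6 K w : R) : 1 < r -> 0 <= I2 -> 0 <= P -> r <= A2 -> mu <= A2 * I2 ->
  D <= I6 / 3 -> 3 / 8 * K ^+ 2 * I2 <= I6 -> I6 - 6 * w * I2 <= P -> 0 <= w -> w <= (r - 1) / (32 * r) * K ^+ 2 ->
  A2 * (2^-1 * D - A2 ^+ 2 * (6^-1 * P)) <= - (mu * (r - 1) * K ^+ 2 / 32).
Proof.
move=> r1 I20 P0 rA mA DI IK IP w0 wK.
have r0 : 0 < r by exact: lt_trans r1.
have A1 : 1 <= A2 by apply: le_trans rA; exact: ltW.
have A0 : 0 <= A2 by exact: le_trans A1.
have rA2 : r <= A2 ^+ 2 by rewrite expr2 (le_trans rA)// ler_peMl.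
have s1 : r * P <= A2 ^+ 2 * P by rewrite ler_wpM2r.
have s2 : r * (I6 - 6 * w * I2) <= r * P by rewrite ler_pM2l.
have s3 : r * w * I2 <= (r - 1) / 32 * K ^+ 2 * I2.
  rewrite ler_wpM2r//; have -> : (r - 1) / 32 * K ^+ 2 = r * ((r - 1) / (32 * r) * K ^+ 2).
    by field; rewrite gt_eqF.
  by rewrite ler_pM2l.
have s4 : (r - 1) * (3 / 8 * K ^+ 2 * I2) <= (r - 1) * I6 by rewrite ler_wpM2l// subr_ge0 ltW.
have s5 : 2^-1 * D - A2 ^+ 2 * (6^-1 * P) <= - ((r - 1) / 32 * (K ^+ 2 * I2)).
  have e1 : r * (I6 - 6 * w * I2) = I6 + (r - 1) * I6 - 6 * (r * w * I2) by ring.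
  have e2 : (r - 1) * (3 / 8 * K ^+ 2 * I2) = 12 * ((r - 1) / 32 * (K ^+ 2 * I2)) by field.
  have e3 : (r - 1) / 32 * K ^+ 2 * I2 = (r - 1) / 32 * (K ^+ 2 * I2) by ring.
  have e4 : A2 ^+ 2 * (6^-1 * P) = 6^-1 * (A2 ^+ 2 * P) by ring.
  rewrite e1 in s2; rewrite e2 in s4; rewrite e3 in s3; rewrite e4.
  move: (r * w * I2) ((r - 1) / 32 * (K ^+ 2 * I2)) ((r - 1) * I6) (A2 ^+ 2 * P) (r * P) s1 s2 s3 s4 DI.
  by clear; move=> *; lra.
apply: (le_trans (ler_wpM2l A0 s5)); rewrite mulrN lerN2.
have -> : A2 * ((r - 1) / 32 * (K ^+ 2 * I2)) = A2 * I2 * ((r - 1) / 32 * K ^+ 2) by ring.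
have -> : mu * (r - 1) * K ^+ 2 / 32 = mu * ((r - 1) / 32 * K ^+ 2) by ring.
by rewrite ler_wpM2r// mulr_ge0 ?sqr_ge0// divr_ge0// subr_ge0 ltW.
Qed.

Lemma supercritical mu C : mu6 R < mu -> exists f h,
  [/\ adm l f h, tsum (sqn l f) = mu & renergy l 6 f h <= - C].
Proof.
move=> muc; have p46 : 4 <= (6 : R) <= 6 by rewrite lexx andbT ler_nat.
have mu60 : 0 < mu6 R by rewrite divr_gt0// mulr_gt0 ?pi_gt0// sqrtr_gt0.
have mu0 : 0 < mu by exact: lt_trans muc.
pose r := mu / mu6 R; have r1 : 1 < r by rewrite ltr_pdivlMr// mul1r.
have r0 : 0 < r by exact: lt_trans r1.
pose c := (r - 1) / (32 * r).
have c0 : 0 < c by apply: divr_gt0; [rewrite subr_gt0|apply: mulr_gt0].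
pose b := mu * (r - 1) / 32.
have b0 : 0 < b by apply: divr_gt0 => //; apply: mulr_gt0 => //; rewrite subr_gt0.
(* The second entry makes the correction [w] at most c K^2 through [tail_small]; the third, with K
   >= 1, makes b K^2 at least |C|. *)
pose K := Num.max 1 (Num.max (9 / (4 * l) / c ^+ 2) (`|C| / b)).
have K1 : 1 <= K by rewrite le_max lexx.
have K0 : 0 < K by exact: lt_le_trans K1.
have Kc : 9 / (4 * l) / c ^+ 2 <= K by rewrite !le_max lexx /= orbT.
have KC : `|C| / b <= K by rewrite !le_max lexx /= !orbT.
(* Subtracting the common end value makes the profile vanish at both ends, so that it extends by 0
   to the graph; its mass stays below [mu6], and normalizing it to [mu] multiplies the mass by more
   than r. *)
pose W := sol l K; pose d := W 0; pose v x := W x - d; pose k := dsol l K.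
have W0 x : 0 < W x by exact: sol_gt0.
have cW : continuous W by exact: sol_cont.
have cv : continuous v by move=> x; apply: cvgB; [exact: cW|exact: cvg_cst].
have vk : der l v k.
  apply: C1_der; last exact: dsol_cont.
  move=> x; have dW := sol_derive l K0 x.
  have := is_deriveB dW (is_derive_cst d x 1); by rewrite subr0.
have vge x : 0 <= x <= l -> 0 <= v x by move=> xl; rewrite subr_ge0; exact: sol_end_le.
have v0 : v 0 = 0 by rewrite /v subrr.
have vl : v l = 0 by rewrite /v /d /W sol_end// subrr.
have gk := single_adm l0 vk vge v0 vl.
have itgc (g : R -> R) : continuous g -> itg 0 l g by move=> cg; apply: cts_itg; exact: ctsT.
have cX (g : R -> R) n : continuous g -> continuous (fun x => g x ^+ n).
  by move=> cg x; apply: (@continuous_comp _ _ _ g (fun t => t ^+ n)); [exact: cg|exact: exprn_continuous].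
have i2 : itg 0 l (sol2 l K) by apply: itgc; exact: sol2_cont.
have mE : tsum (sqn l (single v)) = itl 0 l (fun x => v x ^+ 2) := (single_sqn l0 v).2.
have DE : tsum (sqn l (single k)) = itl 0 l (fun x => k x ^+ 2) := (single_sqn l0 k).2.
have PE := single_pwn l0 vge.
have mle : tsum (sqn l (single v)) <= m2 l K.
  rewrite mE; apply: itl_le => //; first exact: itgc (cX _ _ cv).
  move=> x xl; rewrite -(sol_sqr l K0) ler_pXn2r ?nnegrE ?vge ?(ltW (W0 x))//.
  by rewrite /v gerBl; exact: ltW (W0 0).
have hl : 0 <= l / 2 <= l by rewrite divr_ge0 ?(ltW l0)//= ler_pdivrMr// ler_peMr ?(ltW l0)// ler1n.
have m0 : 0 < tsum (sqn l (single v)).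
  apply: (sup_pos_mass (e := ((0, 0), k0)) l0 gk hl); rewrite /single eqxx gt_eqF// subr_gt0.
  exact: sol_end_lt.
pose A2 := mu / tsum (sqn l (single v)); pose a := Num.sqrt A2.
have A20 : 0 < A2 by exact: divr_gt0.
have a0 : 0 < a by rewrite sqrtr_gt0.
have a2 : a ^+ 2 = A2 by rewrite sqr_sqrtr// ltW.
exists (scale a (single v)), (scale a (single k)); split.
- by apply: adm_scale => //; exact: ltW.
- by apply: (scale_to_mass _ gk m0); exact: ltW.
rewrite (renergy_scaleE l0 p46 a0 gk).
have -> : a `^ (6 - 2) = A2 ^+ 2.
  have -> : 6 - 2 = 4%:R :> R by ring.
  by rewrite powR_mulrn ?(ltW a0)// -a2 -exprM.
rewrite a2 PE DE.
pose w := d * wmax K ^+ 3.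
have w0 : 0 <= w by rewrite mulr_ge0 ?(ltW (W0 0))// exprn_ge0// sqrtr_ge0.
have wK : w <= c * K ^+ 2.
  have cK : 0 <= c * K ^+ 2 := mulr_ge0 (ltW c0) (sqr_ge0 K).
  rewrite -(@ler_pXn2r _ 2) ?nnegrE ?w0 ?cK//.
  apply: (le_trans (tail_small l0 K0)).
  have -> : (c * K ^+ 2) ^+ 2 = c ^+ 2 * K * K ^+ 3 by ring.
  rewrite ler_wpM2r ?exprn_ge0 ?(ltW K0)//.
  by move: Kc; rewrite ler_pdivrMr ?exprn_gt0// [K * _]mulrC.
have IP : m6 l K - 6 * w * m2 l K <= itl 0 l (fun x => v x ^+ 6).
  have i3 : itg 0 l (fun x => sol2 l K x ^+ 3) by apply: itgc; apply: cX; exact: sol2_cont.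
  rewrite /m6 /m2 -(itlZ _ i2) -itlB//; last exact: itgZ.
  apply: itl_le; [by apply: itgB => //; exact: itgZ|exact: itgc (cX _ _ cv)|].
  move=> x xl; have B := bernoulli6 (ltW (W0 0)) (sol_end_le K0 xl); apply: (le_trans _ B).
  have -> : sol2 l K x ^+ 3 = W x ^+ 6 by rewrite -(sol_sqr l K0) -exprM.
  rewrite lerD2l lerN2 -/d.
  have -> : 6 * d * W x ^+ 5 = 6 * d * (W x ^+ 3 * sol2 l K x) by rewrite -(sol_sqr l K0) -exprD.
  rewrite mulrA; apply: ler_wpM2r; first exact: ltW (sol2_gt0 l K0 x).
  rewrite -mulrA ler_pM2l// ler_pM2l; last exact: W0.
  by rewrite lerXn2r ?nnegrE ?(ltW (W0 x)) ?sqrtr_ge0// (sol_max l K0).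
have P0 : 0 <= itl 0 l (fun x => v x ^+ 6).
  by apply: itl_ge0 => x xl; rewrite exprn_ge0// vge.
have I20 : 0 <= m2 l K by exact: le_trans (ltW m0) mle.
have rA : r <= A2.
  rewrite /r /A2 ler_pM2l// lef_pV2 ?posrE//.
  by rewrite (le_trans mle)// ltW// m2_lt.
have mA : mu <= A2 * m2 l K by rewrite /A2 mulrAC ler_pdivlMr// ler_pM2l.
apply: (le_trans (arith_super r1 I20 P0 rA mA (dsol_dirichlet l0 K0) (m6_ge l0 K0) IP w0 wK)).
rewrite lerN2 (le_trans (ler_norm C))//.
have -> : mu * (r - 1) * K ^+ 2 / 32 = b * K * K by rewrite /b; ring.
rewrite ler_pdivrMr// mulrC in KC; apply: (le_trans KC).
by rewrite ler_peMr// mulr_ge0 ?(ltW b0) ?(ltW K0).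
Qed.

End Supercritical.

Section CriticalExponent.
Variables (R : realType) (l : R).
Hypothesis l0 : 0 < l.

Let p46 : 4 <= (6 : R) <= 6. Proof. by rewrite lexx andbT ler_nat. Qed.
Let p26 : 2 < (6 : R) <= 6. Proof. by rewrite lexx andbT ltr_nat. Qed.

Lemma mu6_gt0 : 0 < mu6 R.
Proof. by rewrite divr_gt0// mulr_gt0 ?pi_gt0// sqrtr_gt0. Qed.

Lemma level6_eq0 mu : 0 < mu -> mu <= mu6 R -> energy_level l 6 mu = 0%E.
Proof.
move=> m0 mle; apply: level_eq0 => // f h fh fm.
by apply: ltW; apply: (energy6_gt0 l0 fh); rewrite fm.
Qed.

Lemma level6_Ny mu : mu6 R < mu -> energy_level l 6 mu = -oo%E.
Proof.
move=> mlt; have H C : (energy_level l 6 mu <= (- C)%:E)%E.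
  have [f [h [fh fm fE]]] := supercritical l0 C mlt.
  by apply: (le_trans (level_le l0 p26 fh fm)); rewrite lee_fin.
case E : (energy_level l 6 mu) => [x| |] //; last by have := H 0; rewrite E.
by have := H (1 - x); rewrite E lee_fin => h; exfalso; move: h; lra.
Qed.

Lemma no_ground_state6 mu : 0 < mu -> ~ exists u, ground_state l 6 mu u.
Proof.
move=> m0 [u /(ground_state_adm l0 p26)[f [h [fh fm]]]].
have [mle|mlt] := leP mu (mu6 R); last by rewrite level6_Ny.
by rewrite level6_eq0// lee_fin leNgt (energy6_gt0 l0 fh) ?fm.
Qed.

End CriticalExponent.

Unset Implicit Arguments.

Theorem theorem1p2 (R : realType) (l : R) (hl : 0 < l)
    (p : R) (hp : 4 <= p <= 6) :
  exists2 mup : R, 0 < mup &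
    [/\ 4 < p < 6 -> forall mu : R, 0 < mu ->
          [/\ (exists u : gfun R, ground_state l p mu u) <-> mup <= mu,
              mu <= mup -> energy_level l p mu = 0%:E &
              mup < mu -> (energy_level l p mu < 0%:E)%E],
        p = 4 -> forall mu : R, 0 < mu ->
          [/\ mup < mu -> exists u : gfun R, ground_state l p mu u,
              mu < mup -> ~ (exists u : gfun R, ground_state l p mu u),
              mu <= mup -> energy_level l p mu = 0%:E &
              mup < mu -> (energy_level l p mu < 0%:E)%E] &
        p = 6 -> forall mu : R, 0 < mu ->
          [/\ ~ (exists u : gfun R, ground_state l p mu u),
              mu <= mup -> energy_level l p mu = 0%:E &
              mup < mu -> energy_level l p mu = -oo%E]].
Proof.
have [p6|pn6] := eqVneq p 6.
  exists (mu6 R); first exact: mu6_gt0.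
  rewrite p6; split=> [|/eqP|_ mu m0]; first by rewrite ltxx andbF.
    by rewrite eqr_nat.
  by split; [exact: no_ground_state6|exact: level6_eq0|exact: level6_Ny].
have p46 : 4 <= p < 6 by case/andP: hp => -> h; rewrite lt_neqAle pn6.
have p26 : 2 < p <= 6 by case/andP: hp => h ->; rewrite andbT (lt_le_trans _ h)// ltr_nat.
have [mup mup0 [below above]] := critical_mass hl hp.
exists mup => //.
have level0 mu : 0 < mu -> mu <= mup -> energy_level l p mu = 0%E.
  by move=> m0 mle; apply: level_eq0 => //; exact: below.
have levelN mu : mup < mu -> (energy_level l p mu < 0)%E.
  move=> mlt; have [f [h [fh fm E0]]] := above _ mlt.
  by apply: (le_lt_trans (level_le hl p26 fh fm)); rewrite lte_fin.
have gs mu : mup < mu -> exists u, ground_state l p mu u.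
  by move=> mlt; apply: ground_state_above => //; [exact: lt_trans mlt|exact: above].
have ngs mu : 0 < mu -> mu < mup -> ~ exists u, ground_state l p mu u.
  by apply: no_ground_state_below => //; exact: below.
split=> [/andP[p4 _] mu m0|_ mu m0|/eqP]; last by rewrite (negbTE pn6).
  split; [|exact: level0|exact: levelN].
  split=> [ex|]; first by rewrite leNgt; apply/negP => mlt; exact: (ngs mu).
  rewrite le_eqVlt => /orP[/eqP <-|]; last exact: gs.
  by apply: ground_state_critical => //; exact: below.
by split; [exact: gs|exact: ngs|exact: level0|exact: levelN].
Qed.
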